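(* Let $p,q$ satisfy \[ p(q-1)>2+\frac{1}{pq},\qquad 1<q<2,\qquad 2<p<3 . \] Consider the system \[ \partial_t^2u-\Delta u=|v|^q,\qquad \partial_t^2v-\Delta v=|\partial_t u|^p,\qquad (t,x)\in[0,\infty)\times\mathbb{R}^3, \] \[ (u,\partial_tu)|_{t=0}=\varepsilon\big(f(x),g(x)\big),\qquad (v,\partial_tv)|_{t=0}=\varepsilon\big(\tilde f(x),\tilde g(x)\big), \] where $\varepsilon>0$. Suppose $f,\tilde f\in C^2(\mathbb{R}^3)$, $g,\tilde g\in C^1(\mathbb{R}^3)$ are spherically symmetric and supported in the unit ball $B_1(0)$. Then there exists $\varepsilon_0>0$ such that for every $0<\varepsilon<\varepsilon_0$ there exists a global solution $(u,v)$ of this system satisfying $u,v,\partial_tu\in C(\mathbb{R}^+\times\mathbb{R}^3)$. *)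

(* Defs.v *)
From Stdlib Require Import Reals Lra.
From Coquelicot Require Import Coquelicot.
Open Scope R_scope.

Definition pt := (R * R * R)%type.
Definition c1 (x : pt) : R := fst (fst x).
Definition c2 (x : pt) : R := snd (fst x).
Definition c3 (x : pt) : R := snd x.

Definition nrm3 (x : pt) : R := sqrt (c1 x ^ 2 + c2 x ^ 2 + c3 x ^ 2).

Definition padd (x : pt) (r : R) (w : pt) : pt :=
  (c1 x + r * c1 w, c2 x + r * c2 w, c3 x + r * c3 w).

Definition omega (th ph : R) : pt := (sin th * cos ph, sin th * sin ph, cos th).

Definition sph_mean (h : pt -> R) (x : pt) (r : R) : R :=
  / (4 * PI) * RInt (fun th => RInt (fun ph => h (padd x r (omega th ph)) * sin th)
                                    0 (2 * PI)) 0 PI.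

(** Kirchhoff / Duhamel representation of the solution of
    w_tt - Lap w = F,  (w, w_t)(0) = (phi, psi)  in R^3. *)
Definition kirchhoff (phi psi : pt -> R) (F : R -> pt -> R) (t : R) (x : pt) : R :=
  Derive (fun r => r * sph_mean phi x r) t
  + t * sph_mean psi x t
  + RInt (fun s => (t - s) * sph_mean (F s) x (t - s)) 0 t.

(** a^q for a >= 0 (with 0^q = 0, q > 0). *)
Definition rpow (a q : R) : R := if Rle_dec a 0 then 0 else Rpower a q.

Definition d1 (f : pt -> R) (x : pt) : R := Derive (fun y => f (y, c2 x, c3 x)) (c1 x).
Definition d2 (f : pt -> R) (x : pt) : R := Derive (fun y => f (c1 x, y, c3 x)) (c2 x).
Definition d3 (f : pt -> R) (x : pt) : R := Derive (fun y => f (c1 x, c2 x, y)) (c3 x).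

Definition cont3 (f : pt -> R) : Prop := forall x : pt, continuous f x.

Definition C1_3 (f : pt -> R) : Prop :=
  cont3 f /\
  (forall x : pt, ex_derive (fun y => f (y, c2 x, c3 x)) (c1 x)) /\
  (forall x : pt, ex_derive (fun y => f (c1 x, y, c3 x)) (c2 x)) /\
  (forall x : pt, ex_derive (fun y => f (c1 x, c2 x, y)) (c3 x)) /\
  cont3 (d1 f) /\ cont3 (d2 f) /\ cont3 (d3 f).

Definition C2_3 (f : pt -> R) : Prop :=
  C1_3 f /\ C1_3 (d1 f) /\ C1_3 (d2 f) /\ C1_3 (d3 f).

Definition radial (f : pt -> R) : Prop :=
  forall x y : pt, nrm3 x = nrm3 y -> f x = f y.
Definition supp_unit_ball (f : pt -> R) : Prop :=
  forall x : pt, 1 < nrm3 x -> f x = 0.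

Definition cont_half (w : R -> pt -> R) : Prop :=
  forall (t : R) (x : pt), 0 <= t ->
    filterlim (fun z : R * pt => w (fst z) (snd z))
              (within (fun z : R * pt => 0 <= fst z) (locally (t, x)))
              (locally (w t x)).

Definition is_dt_half (w wt : R -> pt -> R) : Prop :=
  forall (t : R) (x : pt), 0 <= t ->
    filterlim (fun h => (w (t + h) x - w t x) / h)
              (within (fun h => h <> 0 /\ 0 <= t + h) (locally 0))
              (locally (wt t x)).

Definition scal_fun (e : R) (f : pt -> R) : pt -> R := fun x => e * f x.

(* Main.v *)
From Stdlib Require Import Reals Lra Lia ClassicalEpsilon.
From Coquelicot Require Import Coquelicot.
Require Import Defs.
Open Scope R_scope.

(* Spherical means of radial functions reduce Kirchhoff's formula to one space dimension: with
   G odd in l, a radial wave is w(t,r) = 1/(2r) int_{t-r}^{t+r} Y(t,x) dx, where Y(t,x) is the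
   datum k(x) plus the integral of G(s, x-s) over 0 <= s <= t.  In this form v needs only
   G = l |u_t|^p to be continuous, while d/dr (r v) is again given by Y, so that l |v|^q is C^1 in
   l and u_t is a continuous average of its derivative, even at r = 0.

   With xi = t+r+2 and eta = t-r+2, choose b with 1/(pq) < b <= p(q-1)-2 and q b < 1.  If
   |u_t| <= C eps xi^(1-q) eta^(-qb), then the source of v is integrable across the cone because
   p q b > 1, and |v| <= C eps xi^(-1) eta^(-b) because p(q-1)-2 >= b; conversely this bound on v
   reproduces the one on u_t, up to the factor eps^q.  The map H -> l |u_t|^p, H being the source
   of r v, preserves a ball in the weighted sup norm.  It is also a contraction there: a difference
   of two sources need only control r |u_t - u_t'|, for which no derivative of |v|^q (which is not
   Lipschitz, as q < 2) is required. *)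

(** * Parameter integrals *)

(** The obstacle is the axis. Up to data, [2 r u_t] is a difference of integrals of [l |v|^q] along
    two characteristics, and dividing by [r] calls for a gain of that factor without loss of decay.
    The radial derivative of [l v] contains [Y] at [t - r], which has no decay in [xi]. Its
    derivative along an outgoing ray is [Y] at [t + r] alone, because the source is odd, and this
    decays like [xi^(-1-b)]. So the source of [u] is compared along outgoing rays only, while the
    formula for its derivative in [l] gives regularity and is never estimated.

    A single unknown [H] suffices, since [H] determines [v], then the source of [u], then [u_t].
    Smallness comes from powers alone: invariance of the ball uses [eps^p <= eps^2] and the
    contraction [eps^(p-1) <= eps], both from [p > 2], so the ball can have radius [eps] itself. *)

Lemma cts_plus {T : UniformSpace} (f g : T -> R) (x : T) :
  continuous f x -> continuous g x -> continuous (fun z => f z + g z) x.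
Proof. intros Hf Hg. exact (continuous_plus f g x Hf Hg). Qed.

Lemma cts_opp {T : UniformSpace} (f : T -> R) (x : T) :
  continuous f x -> continuous (fun z => - f z) x.
Proof. intros Hf. exact (continuous_opp f x Hf). Qed.

Lemma cts_minus {T : UniformSpace} (f g : T -> R) (x : T) :
  continuous f x -> continuous g x -> continuous (fun z => f z - g z) x.
Proof. intros Hf Hg. exact (continuous_minus f g x Hf Hg). Qed.

Lemma cts_mult {T : UniformSpace} (f g : T -> R) (x : T) :
  continuous f x -> continuous g x -> continuous (fun z => f z * g z) x.
Proof. intros Hf Hg. exact (continuous_mult f g x Hf Hg). Qed.

Lemma cts_fst {T U V : UniformSpace} (f : T -> U * V) (x : T) :
  continuous f x -> continuous (fun z => fst (f z)) x.
Proof. intros Hf. exact (continuous_comp f fst x Hf (continuous_fst _ _)). Qed.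

Lemma cts_snd {T U V : UniformSpace} (f : T -> U * V) (x : T) :
  continuous f x -> continuous (fun z => snd (f z)) x.
Proof. intros Hf. exact (continuous_comp f snd x Hf (continuous_snd _ _)). Qed.

Lemma cts_app {T : UniformSpace} (g : R -> R) (f : T -> R) (x : T) :
  (forall y, continuous g y) -> continuous f x -> continuous (fun z => g (f z)) x.
Proof. intros Hg Hf. exact (continuous_comp f g x Hf (Hg _)). Qed.

Lemma cts_pair {T U V : UniformSpace} (f : T -> U) (g : T -> V) (x : T) :
  continuous f x -> continuous g x -> continuous (fun z => (f z, g z)) x.
Proof.
  intros Hf Hg. unfold continuous.
  eapply filterlim_filter_le_2; [ | exact (filterlim_pair f g Hf Hg) ].
  intros P [d Hd].
  exists (ball (f x) d) (ball (g x) d); try apply locally_ball.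
  intros u v Hu Hv. apply Hd. split; assumption.
Qed.

Definition cont2 (f : R -> R -> R) : Prop :=
  forall z : R * R, continuous (fun z : R * R => f (fst z) (snd z)) z.

Lemma cts_app2 {T : UniformSpace} (g : R -> R -> R) (a b : T -> R) (x : T) :
  cont2 g -> continuous a x -> continuous b x -> continuous (fun z => g (a z) (b z)) x.
Proof.
  intros Hg Ha Hb. apply (continuous_comp_2 a b g x Ha Hb). exact (Hg (a x, b x)).
Qed.

(** A tube argument: [T] carries no compactness, so the neighbourhood of [x] comes from covering
    [[a, b]] by balls given by joint continuity at the points [(x, s)]. *)
Lemma cts_RInt_fixed {T : UniformSpace} (f : T -> R -> R) (a b : R) (x : T) :
  a <= b ->
  (forall z : T * R, continuous (fun z : T * R => f (fst z) (snd z)) z) ->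
  continuous (fun z => RInt (f z) a b) x.
Proof.
  intros Hab Hf.
  assert (Hi : forall z, ex_RInt (f z) a b).
  { intros z. apply (ex_RInt_continuous (V := R_CompleteNormedModule)). intros s _.
    apply (continuous_comp (fun s : R => (z, s)) (fun w : T * R => f (fst w) (snd w))).
    - apply cts_pair. apply continuous_const. apply continuous_id.
    - apply Hf. }
  apply filterlim_locally. intros eps.
  assert (He : 0 < eps / (4 * (b - a + 1))).
  { apply Rdiv_lt_0_compat. apply cond_pos. lra. }
  set (e := mkposreal _ He).
  assert (Hd : forall s, { d : posreal | forall y r, ball x d y -> ball s d r ->
              ball (f x s) e (f y r) }).
  { intros s.
    pose proof (proj1 (filterlim_locally _ _) (Hf (x, s)) e) as H.
    apply constructive_indefinite_description.
    destruct H as [d H]. exists d. intros y r Hy Hr.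
    apply (H (y, r)). split; assumption. }
  set (delta := fun s => proj1_sig (Hd s)).
  destruct (compactness_value_1d a b delta) as [d Hc].
  exists d. intros y Hy.
  assert (Hpt : forall r, a <= r <= b -> Rabs (f y r - f x r) <= 2 * e).
  { intros r Hr. apply Rnot_lt_le. intros Hlt.
    apply (Hc r Hr). intros [s [Hs [Hrs Hds]]].
    pose proof (proj2_sig (Hd s)) as H. fold (delta s) in H. simpl in H.
    assert (H1 : ball (f x s) e (f y r)).
    { apply H. apply ball_le with d; assumption. exact Hrs. }
    assert (H2 : ball (f x s) e (f x r)).
    { apply H. apply ball_center. exact Hrs. }
    change (Rabs (f y r - f x s) < e) in H1.
    change (Rabs (f x r - f x s) < e) in H2.
    assert (Rabs (f y r - f x r) <= Rabs (f y r - f x s) + Rabs (f x r - f x s)).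
    { replace (f y r - f x r) with ((f y r - f x s) - (f x r - f x s)) by ring.
      unfold Rminus at 1. eapply Rle_trans. apply Rabs_triang. rewrite Rabs_Ropp. lra. }
    lra. }
  change (Rabs (RInt (f y) a b - RInt (f x) a b) < eps).
  replace (RInt (f y) a b - RInt (f x) a b) with (RInt (fun r => f y r - f x r) a b)
    by exact (RInt_minus (f y) (f x) a b (Hi y) (Hi x)).
  eapply Rle_lt_trans.
  { apply (abs_RInt_le_const _ a b (2 * e) Hab).
    - exact (ex_RInt_minus (f y) (f x) a b (Hi y) (Hi x)).
    - exact Hpt. }
  unfold e; simpl. assert (0 < eps) by apply cond_pos.
  replace ((b - a) * (2 * (eps / (4 * (b - a + 1))))) with
    (eps / 2 * ((b - a) / (b - a + 1))) by (field; lra).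
  assert ((b - a) / (b - a + 1) <= 1).
  { apply Rle_div_l; lra. }
  nra.
Qed.

Lemma section_cts {T : UniformSpace} (f : T -> R -> R) (z : T) :
  (forall z : T * R, continuous (fun z : T * R => f (fst z) (snd z)) z) ->
  forall s, continuous (f z) s.
Proof.
  intros Hf s. apply (continuous_comp (fun s : R => (z, s)) (fun w : T * R => f (fst w) (snd w))).
  - apply cts_pair. apply continuous_const. apply continuous_id.
  - apply Hf.
Qed.

Lemma ex_RInt_cts (f : R -> R) (a b : R) :
  (forall s, continuous f s) -> ex_RInt f a b.
Proof.
  intros Hf. apply (ex_RInt_continuous (V := R_CompleteNormedModule)). intros s _. apply Hf.
Qed.

Lemma RInt_unit_interval (f : R -> R) (a b : R) :
  (forall s, continuous f s) ->
  RInt f a b = RInt (fun th => (b - a) * f ((b - a) * th + a)) 0 1.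
Proof.
  intros Hf. symmetry.
  transitivity (RInt f ((b - a) * 0 + a) ((b - a) * 1 + a)).
  - apply (RInt_comp_lin f (b - a) a 0 1). apply ex_RInt_cts, Hf.
  - f_equal; ring.
Qed.

(** Rescaling to [[0, 1]] moves the variable endpoints into the integrand. *)
Lemma cts_RInt {T : UniformSpace} (f : T -> R -> R) (a b : T -> R) (x : T) :
  (forall z : T * R, continuous (fun z : T * R => f (fst z) (snd z)) z) ->
  (forall z, continuous a z) -> (forall z, continuous b z) ->
  continuous (fun z => RInt (f z) (a z) (b z)) x.
Proof.
  intros Hf Ha Hb.
  apply (continuous_ext
    (fun z => RInt (fun th => (b z - a z) * f z ((b z - a z) * th + a z)) 0 1)).
  { intros z. symmetry. apply RInt_unit_interval. now apply section_cts. }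
  apply cts_RInt_fixed. lra. intros [z s].
  assert (Ha' : continuous (fun w : T * R => a (fst w)) (z, s)).
  { apply (continuous_comp fst a). apply continuous_fst. apply Ha. }
  assert (Hb' : continuous (fun w : T * R => b (fst w)) (z, s)).
  { apply (continuous_comp fst b). apply continuous_fst. apply Hb. }
  apply cts_mult. now apply cts_minus.
  apply (continuous_comp
    (fun w : T * R => (fst w, (b (fst w) - a (fst w)) * snd w + a (fst w)))
    (fun w : T * R => f (fst w) (snd w))); [ | apply Hf].
  apply cts_pair. apply continuous_fst.
  apply cts_plus; [apply cts_mult; [now apply cts_minus | apply continuous_snd] | assumption].
Qed.

Lemma is_derive_RInt_upper (f : R -> R) (a x : R) :
  (forall s, continuous f s) -> is_derive (fun x => RInt f a x) x (f x).
Proof.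
  intros Hf. apply (is_derive_RInt f (fun x => RInt f a x) a x); [ | apply Hf].
  apply filter_forall. intros y. exact (RInt_correct (V := R_CompleteNormedModule) f a y (ex_RInt_cts f a y Hf)).
Qed.

Lemma is_derive_RInt_fixed (f f' : R -> R -> R) (a b x : R) :
  (forall x s, is_derive (fun x => f x s) x (f' x s)) -> cont2 f -> cont2 f' ->
  is_derive (fun x => RInt (f x) a b) x (RInt (f' x) a b).
Proof.
  intros Hd Hf Hf'.
  replace (RInt (f' x) a b) with (RInt (fun t => Derive (fun u => f u t) x) a b).
  2: { apply RInt_ext. intros t _. apply is_derive_unique, Hd. }
  apply (is_derive_RInt_param f a b x).
  - apply filter_forall. intros y t _. eexists. apply Hd.
  - intros t _. apply continuity_2d_pt_filterlim.
    apply (filterlim_ext (fun z : R * R => f' (fst z) (snd z))).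
    + intros z. symmetry. apply is_derive_unique, Hd.
    + replace (Derive (fun z => f z t) x) with (f' x t).
      apply (Hf' (x, t)). symmetry. apply is_derive_unique, Hd.
  - apply filter_forall. intros y. apply ex_RInt_cts.
    apply (section_cts f y). exact Hf.
Qed.

Lemma is_derive_eq (f : R -> R) (x l l' : R) : is_derive f x l' -> l' = l -> is_derive f x l.
Proof. now intros H <-. Qed.

Lemma is_derive_RInt_bound (f f' : R -> R -> R) (a : R) (b : R -> R) (x b' : R) :
  (forall x s, is_derive (fun x => f x s) x (f' x s)) -> cont2 f -> cont2 f' ->
  is_derive b x b' ->
  is_derive (fun x => RInt (f x) a (b x)) x (RInt (f' x) a (b x) + b' * f x (b x)).
Proof.
  intros Hd Hf Hf' Hb.
  assert (Hs : forall y s, continuous (f y) s) by (intros y; apply (section_cts f y Hf)).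
  assert (H2 : forall y t, continuity_2d_pt (fun u v => Derive (fun z => f z v) u) y t).
  { intros y t. apply continuity_2d_pt_filterlim.
    apply (filterlim_ext (fun z : R * R => f' (fst z) (snd z))).
    + intros z. symmetry. apply is_derive_unique, Hd.
    + replace (Derive (fun z => f z t) y) with (f' y t).
      apply (Hf' (y, t)). symmetry. apply is_derive_unique, Hd. }
  assert (Hi : forall c d, locally x (fun y : R => ex_RInt (fun t : R => f y t) c d)).
  { intros c d. apply filter_forall. intros y. apply ex_RInt_cts, Hs. }
  assert (Hc : forall t, continuity_pt (fun t => f x t) t).
  { intros t. apply continuity_pt_filterlim. apply Hs. }
  eapply is_derive_eq.
  - apply (is_derive_RInt_param_bound_comp f (fun _ => a) b x 0 b').
    + apply Hi.
    + exists (mkposreal 1 Rlt_0_1). apply Hi.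
    + exists (mkposreal 1 Rlt_0_1). apply Hi.
    + apply (is_derive_const a x).
    + exact Hb.
    + exists (mkposreal 1 Rlt_0_1). apply filter_forall. intros y t _. eexists. apply Hd.
    + intros t _. apply H2.
    + apply locally_2d_forall. apply H2.
    + apply locally_2d_forall. apply H2.
    + apply Hc.
    + apply Hc.
  - rewrite (RInt_ext (fun t => Derive (fun u => f u t) x) (f' x)).
    + cbv beta. ring.
    + intros t _. apply is_derive_unique, Hd.
Qed.

Lemma cont2_section (f : R -> R -> R) (x : R) : cont2 f -> forall s, continuous (f x) s.
Proof. exact (section_cts f x). Qed.

(** As functions of the endpoint [b] both sides have the same derivative and vanish at [b = a]. *)
Lemma RInt_Fubini (f : R -> R -> R) (a b c d : R) :
  cont2 f ->
  RInt (fun x => RInt (fun y => f x y) c d) a b = RInt (fun y => RInt (fun x => f x y) a b) c d.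
Proof.
  intros Hf.
  set (L := fun b => RInt (fun x => RInt (fun y => f x y) c d) a b).
  set (Q := fun b => RInt (fun y => RInt (fun x => f x y) a b) c d).
  assert (Hf2 : forall y s, continuous (fun x => f x y) s).
  { intros y s. apply (continuous_comp (fun x : R => (x, y)) (fun w : R * R => f (fst w) (snd w))).
    - apply cts_pair. apply continuous_id. apply continuous_const.
    - apply Hf. }
  assert (HL : forall x, is_derive L x (RInt (fun y => f x y) c d)).
  { intros x. apply (is_derive_RInt_upper (fun x => RInt (fun y => f x y) c d) a x). intros s.
    apply (cts_RInt (T := R_UniformSpace) f (fun _ => c) (fun _ => d)); [ exact Hf | intros; apply continuous_const .. ]. }
  assert (HQ : forall x, is_derive Q x (RInt (fun y => f x y) c d)).
  { intros x. apply (is_derive_RInt_fixed (fun x y => RInt (fun x => f x y) a x) f).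
    - intros z y. apply (is_derive_RInt_upper (fun x => f x y)). apply Hf2.
    - intros z. apply (cts_RInt (fun (z : R * R) x => f x (snd z)) (fun _ => a) (fun z => fst z)).
      + intros w. apply cts_app2. exact Hf. apply continuous_snd.
        apply cts_snd. apply continuous_fst.
      + intros; apply continuous_const.
      + intros; apply continuous_fst.
    - exact Hf. }
  assert (Hd : forall x, is_derive (fun x => L x - Q x) x 0).
  { intros x. apply (is_derive_eq _ _ _ _ (is_derive_minus L Q x _ _ (HL x) (HQ x))).
    unfold minus, plus, opp; simpl; ring. }
  assert (H0 : L a - Q a = 0).
  { unfold L, Q.
    rewrite (RInt_point a (fun x => RInt (fun y => f x y) c d)).
    rewrite (RInt_ext (fun y => RInt (fun x => f x y) a a) (fun _ => 0)).
    - rewrite RInt_const. unfold zero, scal; simpl; unfold mult; simpl. ring.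
    - intros y _. exact (RInt_point a (fun x => f x y)). }
  destruct (MVT_gen (fun x => L x - Q x) a b (fun _ => 0)) as [x [_ Hx]].
  - intros; apply Hd.
  - intros x _. apply continuity_pt_filterlim.
    apply (ex_derive_continuous (fun x => L x - Q x)). eexists; apply Hd.
  - fold (L b) (Q b). lra.
Qed.

(** * Integrals over the unit sphere *)

(** Continuity of abstract functions is taken from the context, so proofs assert it first. The cases
    [Rmult ?u] and the like catch functions that have been eta-reduced. *)
Ltac cts :=
  repeat first
    [ lazymatch goal with
      | |- continuous cos _ => apply continuous_cos
      | |- continuous sin _ => apply continuous_sin
      | |- continuous sqrt _ => apply continuous_sqrt
      | |- continuous Rabs _ => apply continuous_Rabs
      | |- continuous fst _ => apply continuous_fst
      | |- continuous snd _ => apply continuous_snd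
      | |- continuous (Rmult ?u) _ => apply (cts_mult (fun _ => u) (fun z => z))
      | |- continuous (Rplus ?u) _ => apply (cts_plus (fun _ => u) (fun z => z))
      | |- continuous (Rminus ?u) _ => apply (cts_minus (fun _ => u) (fun z => z))
      | |- continuous Ropp _ => apply (cts_opp (fun z => z))
      | |- continuous (fun z => z) _ => apply continuous_id
      | |- continuous (fun z => fst z) _ => apply continuous_fst
      | |- continuous (fun z => snd z) _ => apply continuous_snd
      | |- continuous (fun _ => ?c) _ => apply continuous_const
      | |- continuous (fun z => _ + _) _ => apply cts_plus
      | |- continuous (fun z => _ - _) _ => apply cts_minus
      | |- continuous (fun z => - _) _ => apply cts_opp
      | |- continuous (fun z => _ * _) _ => apply cts_mult
      | |- continuous (fun z => cos _) _ => apply (cts_app cos); [exact continuous_cos | ]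
      | |- continuous (fun z => sin _) _ => apply (cts_app sin); [exact continuous_sin | ]
      | |- continuous (fun z => sqrt _) _ => apply (cts_app sqrt); [exact continuous_sqrt | ]
      | |- continuous (fun z => Rabs _) _ => apply (cts_app Rabs); [exact continuous_Rabs | ]
      | |- continuous (fun z => fst _) _ => apply cts_fst
      | |- continuous (fun z => snd _) _ => apply cts_snd
      | |- continuous (fun z => (_, _)) _ => apply cts_pair
      end
    | match goal with
      | H : cont2 ?g |- continuous (fun z => ?g _ _) _ => apply (cts_app2 g); [exact H | | ]
      | H : forall y, continuous ?g y |- continuous (fun z => ?g _) _ => apply (cts_app g); [exact H | ]
      | H : forall y, continuous ?g y |- continuous ?g _ => apply H
      | H : cont2 ?g |- continuous (?g ?a) _ => apply (cont2_section g a H)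
      end ].

(* Coquelicot types its integrals in [R_CompleteNormedModule], where [ring] fails; moving to one
   side puts the equation in [R]. *)
Ltac rring := cbv beta; apply Rminus_diag_uniq; ring.

Lemma RInt_multl (k : R) (f : R -> R) (a b : R) :
  ex_RInt f a b -> RInt (fun x => k * f x) a b = k * RInt f a b.
Proof. intros Hf. exact (RInt_scal f a b k Hf). Qed.

Lemma RInt_lin (f : R -> R) (u v a b : R) :
  (forall y, continuous f y) ->
  u * RInt (fun y => f (u * y + v)) a b = RInt f (u * a + v) (u * b + v).
Proof.
  intros Hf. rewrite <- RInt_multl.
  - apply (RInt_comp_lin f u v a b). now apply ex_RInt_cts.
  - apply ex_RInt_cts. intros s. cts.
Qed.

Lemma RInt_split (f : R -> R) (a b c : R) :
  (forall x, continuous f x) -> RInt f a b + RInt f b c = RInt f a c.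
Proof. intros Hf. apply (RInt_Chasles f a b c); now apply ex_RInt_cts. Qed.

Lemma RInt_antiderivative (F f : R -> R) (a b : R) :
  (forall x, is_derive F x (f x)) -> (forall x, continuous f x) -> RInt f a b = F b - F a.
Proof.
  intros Hd Hf. apply is_RInt_unique. exact (is_RInt_derive F f a b (fun x _ => Hd x) (fun x _ => Hf x)).
Qed.

Lemma derive_zero_eq (f : R -> R) (a b : R) : (forall x, is_derive f x 0) -> f a = f b.
Proof.
  intros Hd. destruct (MVT_gen f a b (fun _ => 0)) as [c [_ Hc]].
  - intros; apply Hd.
  - intros x _. apply continuity_pt_filterlim. apply (ex_derive_continuous f). eexists; apply Hd.
  - lra.
Qed.

Lemma continuous_of_is_derive (f f' : R -> R) :
  (forall x, is_derive f x (f' x)) -> forall x, continuous f x.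
Proof. intros H x. apply (ex_derive_continuous f). eexists; apply H. Qed.

Lemma is_derive_comp_R (f g : R -> R) (x df dg : R) :
  is_derive f (g x) df -> is_derive g x dg -> is_derive (fun x => f (g x)) x (dg * df).
Proof. intros Hf Hg. exact (is_derive_comp f g x df dg Hf Hg). Qed.

Lemma is_derive_mult_R (f g : R -> R) (x df dg : R) :
  is_derive f x df -> is_derive g x dg -> is_derive (fun x => f x * g x) x (df * g x + f x * dg).
Proof. intros Hf Hg. apply (is_derive_mult f g x df dg Hf Hg). intros; apply Rmult_comm. Qed.

Lemma polar_coordinates (a b : R) :
  exists t, a = sqrt (a ^ 2 + b ^ 2) * cos t /\ b = sqrt (a ^ 2 + b ^ 2) * sin t.
Proof.
  set (r := sqrt (a ^ 2 + b ^ 2)).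
  assert (Hr2 : r * r = a ^ 2 + b ^ 2) by (apply sqrt_sqrt; nra).
  assert (Hr0 : 0 <= r) by apply sqrt_pos.
  destruct (Req_dec r 0) as [H | H].
  - exists 0. rewrite H in *. split; nra.
  - assert (Hr : 0 < r) by lra.
    assert (Ha : -1 <= a / r <= 1).
    { split. apply Rle_div_r; nra. apply Rle_div_l; nra. }
    assert (Hs : r * sqrt (1 - Rsqr (a / r)) = Rabs b).
    { assert (Hp : 0 <= 1 - Rsqr (a / r)).
      { unfold Rsqr. assert (0 <= (a / r + 1) * (1 - a / r)) by (apply Rmult_le_pos; lra). lra. }
      apply Rsqr_inj.
      - apply Rmult_le_pos. lra. apply sqrt_pos.
      - apply Rabs_pos.
      - rewrite <- Rsqr_abs, Rsqr_mult, Rsqr_sqrt by exact Hp. unfold Rsqr.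
        replace (r * r * (1 - a / r * (a / r))) with (r * r - a * a) by (field; lra).
        rewrite Hr2. ring. }
    destruct (Rle_dec 0 b) as [Hb | Hb].
    + exists (acos (a / r)). rewrite cos_acos, sin_acos by lra. split. field; lra.
      rewrite Hs, Rabs_pos_eq; lra.
    + exists (- acos (a / r)). rewrite cos_neg, sin_neg, cos_acos, sin_acos by lra. split. field; lra.
      replace (r * - sqrt (1 - (a / r)²)) with (- (r * sqrt (1 - (a / r)²))) by ring.
      rewrite Hs, Rabs_left; lra.
Qed.

(** The integral over one full period has derivative [g (x + 2 PI) - g x = 0] in its starting point
    [x]. *)
Lemma RInt_cos_shift (G : R -> R) (t : R) :
  (forall y, continuous G y) ->
  RInt (fun ph => G (cos (ph - t))) 0 (2 * PI) = RInt (fun ph => G (cos ph)) 0 (2 * PI).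
Proof.
  intros HG.
  set (g := fun s => G (cos s)).
  assert (Hg : forall y, continuous g y) by (intros y; unfold g; cts).
  set (L := fun t => RInt g 0 (t + 2 * PI) - RInt g 0 t).
  assert (HL : L (- t) = L 0).
  { apply derive_zero_eq. intros x. unfold L. eapply is_derive_eq.
    - apply @is_derive_minus.
      + apply (is_derive_comp_R (fun x => RInt g 0 x) (fun x => x + 2 * PI)).
        * apply (is_derive_RInt_upper g 0). apply Hg.
        * instantiate (1 := 1). auto_derive; trivial.
      + apply (is_derive_RInt_upper g 0). apply Hg.
    - unfold g. rewrite (cos_plus x), cos_2PI, sin_2PI.
      unfold minus, plus, opp; simpl. replace (cos x * 1 - sin x * 0) with (cos x) by ring. ring. }
  assert (E : forall t, RInt g t (t + 2 * PI) = L t).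
  { intros s. unfold L.
    rewrite <- (RInt_split g 0 s (s + 2 * PI) Hg). rring. }
  transitivity (RInt g (- t) (- t + 2 * PI)).
  - rewrite <- (Rmult_1_l (RInt _ 0 _)).
    rewrite (RInt_ext (fun ph => G (cos (ph - t))) (fun ph => g (1 * ph + - t))).
    + rewrite RInt_lin by exact Hg. f_equal; ring.
    + intros ph _. unfold g. f_equal. f_equal. ring.
  - rewrite E, HL, <- E. f_equal; ring.
Qed.

Section RotationInvariance.
Variables (F f : R -> R) (rho : R).
Hypothesis HF : forall x, is_derive F x (f x).
Hypothesis Hf : forall x, continuous f x.

Let m (al th ph : R) : R := rho * (sin al * (sin th * cos ph) + cos al * cos th).

(* Rotating the sphere in the plane of the axes 1 and 3 is the flow of the field
   [cos ph d_th - cot th sin ph d_ph], which is divergence free for [sin th dth dph]. *)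
Lemma zonal_rotation (al : R) :
  RInt (fun th => RInt (fun ph => F (m al th ph) * sin th) 0 (2 * PI)) 0 PI =
  RInt (fun th => RInt (fun ph => F (m 0 th ph) * sin th) 0 (2 * PI)) 0 PI.
Proof.
  assert (Fc := continuous_of_is_derive F f HF).
  set (dm := fun al th ph => rho * (cos al * (sin th * cos ph) - sin al * cos th)).
  set (g := fun al th => RInt (fun ph => f (m al th ph) * dm al th ph * sin th) 0 (2 * PI)).
  apply (derive_zero_eq (fun al => RInt (fun th => RInt (fun ph => F (m al th ph) * sin th) 0 (2 * PI)) 0 PI)).
  intros a. eapply is_derive_eq.
  { apply (is_derive_RInt_fixed (fun al th => RInt (fun ph => F (m al th ph) * sin th) 0 (2 * PI)) g).
    - intros x th.
      apply (is_derive_RInt_fixed (fun al ph => F (m al th ph) * sin th)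
               (fun al ph => f (m al th ph) * dm al th ph * sin th)).
      + intros y ph. eapply is_derive_eq.
        * apply is_derive_mult_R; [ | apply is_derive_const ].
          apply (is_derive_comp_R F (fun al => m al th ph)). apply HF.
          instantiate (1 := dm y th ph). unfold m, dm. auto_derive; [ trivial | ring ].
        * unfold zero; simpl. rring.
      + intros z. unfold m. cts.
      + intros z. unfold m, dm. cts.
    - intros z. apply (cts_RInt (fun (z : R * R) ph => F (m (fst z) (snd z) ph) * sin (snd z))); intros; unfold m; cts.
    - intros z. apply (cts_RInt (fun (z : R * R) ph =>
        f (m (fst z) (snd z) ph) * dm (fst z) (snd z) ph * sin (snd z))); intros; unfold m, dm; cts. }
  (* [J] is the [th]-component of the flux of the field, integrated in [ph]. The [ph]-component is
     the antiderivative of [k] below and drops out over a full period; the total [th]-derivative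
     leaves only the poles, where [sin th = 0]. *)
  set (J := fun th => RInt (fun ph => sin th * cos ph * F (m a th ph)) 0 (2 * PI)).
  set (j := fun th => RInt (fun ph => cos th * cos ph * F (m a th ph)
     + sin th * cos ph * (f (m a th ph) * (rho * (sin a * (cos th * cos ph) - cos a * sin th)))) 0 (2 * PI)).
  assert (HJ : forall th, is_derive J th (j th)).
  { intros th. apply (is_derive_RInt_fixed (fun th ph => sin th * cos ph * F (m a th ph))
     (fun th ph => cos th * cos ph * F (m a th ph)
     + sin th * cos ph * (f (m a th ph) * (rho * (sin a * (cos th * cos ph) - cos a * sin th))))).
    - intros x ph. eapply is_derive_eq.
      + apply is_derive_mult_R.
        * instantiate (1 := cos x * cos ph). auto_derive; [ trivial | ring ].
        * apply (is_derive_comp_R F (fun th => m a th ph)). apply HF.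
          instantiate (1 := rho * (sin a * (cos x * cos ph) - cos a * sin x)).
          unfold m. auto_derive; [ trivial | ring ].
      + cbv beta. rring.
    - intros z. unfold m. cts.
    - intros z. unfold m. cts. }
  assert (Hj : forall th, continuous j th).
  { intros th. apply (cts_RInt (T := R_UniformSpace) (fun th ph => cos th * cos ph * F (m a th ph)
     + sin th * cos ph * (f (m a th ph) * (rho * (sin a * (cos th * cos ph) - cos a * sin th)))));
    intros; unfold m; cts. }
  assert (Hg : forall th, g a th = - 1 * j th).
  { intros th.
    set (k := fun ph => cos th * (cos ph * F (m a th ph)
                 + sin ph * (f (m a th ph) * (rho * (sin a * (sin th * - sin ph)))))).
    assert (Hk : RInt k 0 (2 * PI) = 0).
    { rewrite (RInt_antiderivative (fun ph => cos th * (sin ph * F (m a th ph))) k).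
      - rewrite sin_2PI, sin_0. rring.
      - intros ph. unfold k. eapply is_derive_eq.
        + apply (is_derive_scal (fun ph => sin ph * F (m a th ph))).
          apply is_derive_mult_R.
          * instantiate (1 := cos ph). auto_derive; [ trivial | ring ].
          * apply (is_derive_comp_R F (fun ph => m a th ph)). apply HF.
            instantiate (1 := rho * (sin a * (sin th * - sin ph))).
            unfold m. auto_derive; [ trivial | ring ].
        + cbv beta. rring.
      - intros ph. unfold k, m. cts. }
    assert (E : RInt (fun ph => f (m a th ph) * dm a th ph * sin th + -1 * k ph) 0 (2 * PI) = -1 * j th).
    { unfold j. rewrite <- RInt_multl.
      - apply RInt_ext. intros ph _. unfold k, dm.
        assert (Hs := sin2_cos2 ph). unfold Rsqr in Hs.
        transitivity (-1 * (cos th * cos ph * F (m a th ph)) + f (m a th ph) * rho * sin th *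
           (cos a * sin th * cos ph - sin a * cos th + sin a * cos th * (sin ph * sin ph))).
        rring. replace (sin ph * sin ph) with (1 - cos ph * cos ph) by lra. rring.
      - apply ex_RInt_cts. intros ph. unfold m. cts. }
    rewrite <- E. unfold g. symmetry.
    transitivity (RInt (fun ph => f (m a th ph) * dm a th ph * sin th) 0 (2 * PI)
       + RInt (fun ph => -1 * k ph) 0 (2 * PI)).
    - apply (RInt_plus (fun ph => f (m a th ph) * dm a th ph * sin th) (fun ph => -1 * k ph));
        apply ex_RInt_cts; intros; unfold k, dm, m; cts.
    - rewrite RInt_multl, Hk. rring. apply ex_RInt_cts; intros; unfold k, m; cts. }
  rewrite (RInt_ext (g a) (fun th => -1 * j th)) by (intros; apply Hg).
  rewrite RInt_multl by now apply ex_RInt_cts.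
  rewrite (RInt_antiderivative J j) by assumption.
  unfold J. rewrite sin_PI, sin_0.
  rewrite 2 (RInt_ext (fun ph => 0 * cos ph * _) (fun _ => 0)) by (intros; rring).
  rring.
Qed.
End RotationInvariance.

(** The integral of [F (x . w)] over the unit sphere of [w], for [x = (x1, x2, x3)]. *)
Definition zonal_int (F : R -> R) (x1 x2 x3 : R) : R :=
  RInt (fun th => RInt (fun ph =>
    F (x1 * (sin th * cos ph) + x2 * (sin th * sin ph) + x3 * cos th) * sin th) 0 (2 * PI)) 0 PI.

(** Rotate [x] to the polar axis: a shift of [ph] moves it into the plane of axes 1 and 3, and
    [zonal_rotation] does the rest. Then [s = cos th] reduces the integral, as in Archimedes'
    hat-box theorem. *)
Lemma zonal_int_C1 (F f : R -> R) (x1 x2 x3 : R) :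
  (forall x, is_derive F x (f x)) -> (forall x, continuous f x) ->
  zonal_int F x1 x2 x3 =
  2 * PI * RInt (fun s => F (sqrt (x1 ^ 2 + x2 ^ 2 + x3 ^ 2) * s)) (-1) 1.
Proof.
  intros HF Hf. assert (Fc := continuous_of_is_derive F f HF).
  destruct (polar_coordinates x1 x2) as [t [H1 H2]].
  set (r := sqrt (x1 ^ 2 + x2 ^ 2)) in *.
  assert (Hr : r ^ 2 = x1 ^ 2 + x2 ^ 2) by (apply pow2_sqrt; nra).
  destruct (polar_coordinates x3 r) as [al [H3 H4]].
  replace (x1 ^ 2 + x2 ^ 2 + x3 ^ 2) with (x3 ^ 2 + r ^ 2) by (rewrite Hr; ring).
  set (rho := sqrt (x3 ^ 2 + r ^ 2)) in *.
  transitivity (RInt (fun th => RInt (fun ph =>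
     F (rho * (sin al * (sin th * cos ph) + cos al * cos th)) * sin th) 0 (2 * PI)) 0 PI).
  { apply RInt_ext. intros th _.
    rewrite <- (RInt_cos_shift (fun c => F (rho * (sin al * (sin th * c) + cos al * cos th)) * sin th) t)
      by (intros; cts).
    apply RInt_ext. intros ph _. f_equal. f_equal.
    rewrite cos_minus. rewrite H1, H2, H3.
    transitivity (r * (sin th * (cos ph * cos t + sin ph * sin t)) + rho * cos al * cos th); [ring | ].
    rewrite H4 at 1. ring. }
  rewrite (zonal_rotation F f rho HF Hf al).
  set (L := fun y => RInt (fun s => F (rho * s)) 0 y).
  assert (Lc : forall s, continuous (fun s => F (rho * s)) s) by (intros; cts).
  assert (HL : forall y, is_derive L y (F (rho * y))).
  { intros y. apply (is_derive_RInt_upper (fun s => F (rho * s)) 0 y Lc). }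
  rewrite (RInt_antiderivative L (fun s => F (rho * s)) (-1) 1 HL Lc).
  transitivity (RInt (fun th => 2 * PI * (F (rho * cos th) * sin th)) 0 PI).
  - apply RInt_ext. intros th _. rewrite sin_0, cos_0.
    rewrite (RInt_ext _ (fun _ => F (rho * cos th) * sin th)).
    + rewrite RInt_const. unfold scal; simpl; unfold mult; simpl. rring.
    + intros ph _. f_equal. f_equal. ring.
  - rewrite (RInt_antiderivative (fun th => - (2 * PI) * L (cos th))).
    + rewrite cos_PI, cos_0. rring.
    + intros th. eapply is_derive_eq.
      * apply is_derive_mult_R. apply is_derive_const.
        apply (is_derive_comp_R L cos). apply HL.
        instantiate (1 := - sin th). auto_derive; [trivial | ring].
      * unfold zero; simpl. rring.
    + intros th. cts.
Qed.

(** With [G] a primitive of [F], the integral for [F] is the derivative in [c], at [0], of the one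
    for [y -> G (y + c)]. Differentiating the identity for these smooth functions gives the
    continuous case. *)
Lemma zonal_int_eq (F : R -> R) (x1 x2 x3 : R) :
  (forall x, continuous F x) ->
  zonal_int F x1 x2 x3 =
  2 * PI * RInt (fun s => F (sqrt (x1 ^ 2 + x2 ^ 2 + x3 ^ 2) * s)) (-1) 1.
Proof.
  intros HF. set (rho := sqrt (x1 ^ 2 + x2 ^ 2 + x3 ^ 2)).
  set (G := fun y => RInt F 0 y).
  assert (HG : forall y, is_derive G y (F y)) by (intros; now apply is_derive_RInt_upper).
  assert (Gc := continuous_of_is_derive G F HG).
  assert (HGc : forall c y, is_derive (fun c => G (y + c)) c (F (y + c))).
  { intros c y. eapply is_derive_eq. apply (is_derive_comp_R G (fun c => y + c)). apply HG.
    instantiate (1 := 1). auto_derive; [trivial | ring]. ring. }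
  assert (H1 : is_derive (fun c => zonal_int (fun y => G (y + c)) x1 x2 x3) 0
    (zonal_int (fun y => F (y + 0)) x1 x2 x3)).
  { unfold zonal_int.
    set (m := fun th ph => x1 * (sin th * cos ph) + x2 * (sin th * sin ph) + x3 * cos th).
    apply (is_derive_RInt_fixed
      (fun c th => RInt (fun ph => G (m th ph + c) * sin th) 0 (2 * PI))
      (fun c th => RInt (fun ph => F (m th ph + c) * sin th) 0 (2 * PI))).
    - intros c th. apply (is_derive_RInt_fixed (fun c ph => G (m th ph + c) * sin th)
        (fun c ph => F (m th ph + c) * sin th)).
      + intros y ph. eapply is_derive_eq. apply is_derive_mult_R. apply HGc. apply is_derive_const.
        unfold zero; simpl; ring.
      + intros z; unfold m; cts.
      + intros z; unfold m; cts.
    - intros z. apply (cts_RInt (fun (z : R * R) ph => G (m (snd z) ph + fst z) * sin (snd z)));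
        intros; unfold m; cts.
    - intros z. apply (cts_RInt (fun (z : R * R) ph => F (m (snd z) ph + fst z) * sin (snd z)));
        intros; unfold m; cts. }
  assert (H2 : is_derive (fun c => 2 * PI * RInt (fun s => G (rho * s + c)) (-1) 1) 0
     (2 * PI * RInt (fun s => F (rho * s + 0)) (-1) 1)).
  { eapply is_derive_eq.
    - apply is_derive_mult_R. apply is_derive_const.
      apply (is_derive_RInt_fixed (fun c s => G (rho * s + c)) (fun c s => F (rho * s + c))).
      + intros; apply HGc.
      + intros z; cts.
      + intros z; cts.
    - unfold zero; simpl; rring. }
  assert (H3 : is_derive (fun c => zonal_int (fun y => G (y + c)) x1 x2 x3) 0
     (2 * PI * RInt (fun s => F (rho * s + 0)) (-1) 1)).
  { apply (is_derive_ext (fun c => 2 * PI * RInt (fun s => G (rho * s + c)) (-1) 1)); [ | exact H2].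
    intros c. symmetry. apply (zonal_int_C1 (fun y => G (y + c)) (fun y => F (y + c))).
    - intros y. eapply is_derive_eq. apply (is_derive_comp_R G (fun y => y + c)). apply HG.
      instantiate (1 := 1). auto_derive; [trivial | ring]. ring.
    - intros; cts. }
  apply is_derive_unique in H1. apply is_derive_unique in H3.
  rewrite H1 in H3.
  rewrite (RInt_ext (fun s => F (rho * s)) (fun s => F (rho * s + 0))).
  - rewrite <- H3. unfold zonal_int.
    apply RInt_ext. intros th _. apply RInt_ext. intros ph _. f_equal. f_equal. ring.
  - intros s _. f_equal. ring.
Qed.

Lemma nrm3_padd_omega (x : pt) (r th ph : R) :
  nrm3 (padd x r (omega th ph)) =
  sqrt (nrm3 x ^ 2 + r ^ 2 +
        2 * r * (c1 x * (sin th * cos ph) + c2 x * (sin th * sin ph) + c3 x * cos th)).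
Proof.
  unfold nrm3 at 1. f_equal. unfold nrm3. rewrite pow2_sqrt by nra.
  unfold padd, omega, c1, c2, c3; simpl.
  assert (Ht := sin2_cos2 th). assert (Hp := sin2_cos2 ph). unfold Rsqr in *.
  set (a := fst (fst x)). set (b := snd (fst x)). set (c := snd x).
  replace (r * (r * 1)) with (r * r * (sin th * sin th * (sin ph * sin ph + cos ph * cos ph) + cos th * cos th)).
  ring. rewrite Hp. replace (sin th * sin th * 1 + cos th * cos th) with 1 by lra. ring.
Qed.

Lemma sph_mean_ext (f g : pt -> R) (x : pt) (r : R) :
  (forall y, f y = g y) -> sph_mean f x r = sph_mean g x r.
Proof.
  intros H. unfold sph_mean. f_equal. apply RInt_ext. intros th _. apply RInt_ext.
  intros ph _. now rewrite H.
Qed.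

(* Substituting [l ^ 2 = rho ^ 2 + r ^ 2 + 2 r rho s]; working with the square keeps the
   antiderivative smooth where [l = 0]. *)
Lemma radial_sph_mean (phi : R -> R) (x : pt) (r : R) :
  (forall y, continuous phi y) ->
  r * sph_mean (fun y => phi (nrm3 y)) x r =
  / 2 * RInt (fun s => (r + nrm3 x * s) * phi (Rabs (r + nrm3 x * s))) (-1) 1.
Proof.
  intros Hphi. set (rho := nrm3 x).
  assert (Hrho : 0 <= rho) by apply sqrt_pos.
  set (F := fun m => phi (sqrt (rho ^ 2 + r ^ 2 + 2 * r * m))).
  assert (HF : forall m, continuous F m) by (intros; unfold F; cts).
  assert (E : sph_mean (fun y => phi (nrm3 y)) x r = / 2 * RInt (fun s => F (rho * s)) (-1) 1).
  { unfold sph_mean.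
    transitivity (/ (4 * PI) * zonal_int F (c1 x) (c2 x) (c3 x)).
    - f_equal. unfold zonal_int. apply RInt_ext. intros th _. apply RInt_ext. intros ph _.
      unfold F. now rewrite nrm3_padd_omega.
    - rewrite zonal_int_eq by exact HF. fold (nrm3 x) rho. field. apply PI_neq0. }
  rewrite E.
  set (h := fun l => l * phi (Rabs l)).
  assert (Hh : forall l, continuous h l) by (intros; unfold h; cts).
  change (r * (/ 2 * RInt (fun s => F (rho * s)) (-1) 1) = / 2 * RInt (fun s => h (r + rho * s)) (-1) 1).
  (* The antiderivative [Psi] only gives the identity multiplied by [rho], so the centre is treated
     apart. *)
  destruct (Req_dec rho 0) as [H0 | H0].
  - unfold F. rewrite H0.
    rewrite (RInt_ext _ (fun _ => phi (Rabs r))), (RInt_ext (fun s => h (r + 0 * s)) (fun _ => h r)).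
    + rewrite 2 RInt_const. unfold h, scal; simpl; unfold mult; simpl. ring.
    + intros s _. f_equal. ring.
    + intros s _. f_equal. rewrite <- sqrt_Rsqr_abs. f_equal. unfold Rsqr. ring.
  - set (Psi := fun y => RInt (fun s => / 2 * phi (sqrt (Rabs s))) 0 y).
    assert (HPsi : forall y, is_derive Psi y (/ 2 * phi (sqrt (Rabs y)))).
    { intros y. apply (is_derive_RInt_upper (fun s => / 2 * phi (sqrt (Rabs s))) 0 y).
      intros; cts. }
    assert (HPsi2 : forall l, is_derive (fun l => Psi (l ^ 2)) l (h l)).
    { intros l. eapply is_derive_eq. apply (is_derive_comp_R Psi (fun l => l ^ 2)). apply HPsi.
      instantiate (1 := 2 * l). auto_derive; [trivial | ring].
      unfold h. rewrite (Rabs_pos_eq (l ^ 2)) by apply pow2_ge_0.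
      replace (sqrt (l ^ 2)) with (Rabs l); [field | ].
      rewrite <- sqrt_Rsqr_abs. f_equal. unfold Rsqr. ring. }
    assert (H1 : rho * RInt (fun s => h (rho * s + r)) (-1) 1 = Psi ((r + rho) ^ 2) - Psi ((r - rho) ^ 2)).
    { rewrite RInt_lin by exact Hh. rewrite (RInt_antiderivative (fun l => Psi (l ^ 2)) h) by assumption.
      f_equal. f_equal; f_equal; ring. do 2 f_equal. ring. }
    assert (H2 : r * rho * RInt (fun s => F (rho * s)) (-1) 1 = Psi ((r + rho) ^ 2) - Psi ((r - rho) ^ 2)).
    { rewrite <- RInt_multl by (apply ex_RInt_cts; intros; cts).
      transitivity (RInt (fun s => 2 * r * rho * (/ 2 * phi (sqrt (Rabs (rho ^ 2 + r ^ 2 + 2 * r * (rho * s)))))) (-1) 1).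
      - apply RInt_ext. intros s Hs. unfold F.
        rewrite Rmin_left, Rmax_right in Hs by lra.
        rewrite (Rabs_pos_eq (rho ^ 2 + r ^ 2 + 2 * r * (rho * s))). apply Rminus_diag_uniq; field.
        (* Negative [r] occurs because [kirchhoff] differentiates in [r] also at [t = 0]. *)
        destruct (Rle_dec 0 r).
        + assert (0 <= r * rho * (1 + s)) by (repeat apply Rmult_le_pos; lra).
          assert (Hsq := pow2_ge_0 (rho - r)). lra.
        + assert (0 <= (- r) * rho * (1 - s)) by (repeat apply Rmult_le_pos; lra).
          assert (Hsq := pow2_ge_0 (rho + r)). lra.
      - rewrite (RInt_antiderivative (fun s => Psi (rho ^ 2 + r ^ 2 + 2 * r * (rho * s)))).
        + f_equal. f_equal; ring. do 2 f_equal. ring.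
        + intros s. eapply is_derive_eq.
          apply (is_derive_comp_R Psi (fun s => rho ^ 2 + r ^ 2 + 2 * r * (rho * s))). apply HPsi.
          instantiate (1 := 2 * r * rho). auto_derive; [trivial | ring]. rring.
        + intros; cts. }
    rewrite (RInt_ext (fun s => h (r + rho * s)) (fun s => h (rho * s + r)))
      by (intros; f_equal; ring).
    apply (Rmult_eq_reg_l rho); [ | exact H0].
    transitivity (/ 2 * (r * rho * RInt (fun s => F (rho * s)) (-1) 1)); [ring | ].
    rewrite H2, <- H1. ring.
Qed.

(** * Characteristic representation of radial waves *)

Lemma RInt_odd (h : R -> R) (a : R) :
  (forall x, continuous h x) -> (forall x, h (- x) = - h x) -> RInt h (- a) a = 0.
Proof.
  intros Hc Ho.
  assert (E : RInt h (- a) a = - RInt h (- a) a).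
  { transitivity (RInt h (-1 * a + 0) (-1 * - a + 0)). f_equal; ring.
    rewrite <- RInt_lin by exact Hc.
    rewrite (RInt_ext _ (fun y => -1 * h y)).
    - rewrite RInt_multl by now apply ex_RInt_cts.
      rewrite <- (opp_RInt_swap h a (- a)) by now apply ex_RInt_cts.
      unfold opp; simpl. rring.
    - intros y _. replace (-1 * y + 0) with (- y) by ring. rewrite Ho. rring. }
  change (@eq R (RInt h (- a) a) (- RInt h (- a) a)) in E. lra.
Qed.

Lemma RInt_zero (h : R -> R) (a b : R) :
  a <= b -> (forall x, a < x < b -> h x = 0) -> RInt h a b = 0.
Proof.
  intros Hab Hh. rewrite (RInt_ext h (fun _ => 0)).
  - rewrite RInt_const. unfold scal; simpl; unfold mult; simpl. rring.
  - intros x Hx. rewrite Rmin_left, Rmax_right in Hx by lra. now apply Hh.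
Qed.

Lemma RInt_odd_supp (h : R -> R) (a b c : R) :
  (forall x, continuous h x) -> (forall x, h (- x) = - h x) ->
  (forall x, c < Rabs x -> h x = 0) -> 0 <= c -> a <= - c -> c <= b -> RInt h a b = 0.
Proof.
  intros Hc Ho Hs H0 Ha Hb.
  rewrite <- (RInt_split h a (- c) b Hc), <- (RInt_split h (- c) c b Hc).
  rewrite RInt_odd by assumption. rewrite 2 RInt_zero; try lra.
  - intros x Hx. apply Hs. rewrite Rabs_pos_eq; lra.
  - intros x Hx. apply Hs. rewrite Rabs_left; lra.
Qed.

(* The radial wave with zero data and source [F] is [avg (charint G)], [G s l = l * F s l]; here
   [charint G t x] runs along the characteristic [s + l = x], and even or odd extension in [l]
   accounts for the reflection at the axis. *)
Definition charint (G : R -> R -> R) (t x : R) : R := RInt (fun s => G s (x - s)) 0 t.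

(** Rescaled to [[-1, 1]], so that there is no division by [r] at the axis. *)
Definition avg (Y : R -> R -> R) (t r : R) : R := / 2 * RInt (fun s => Y t (t + r * s)) (-1) 1.

Lemma cont2_charint (G : R -> R -> R) : cont2 G -> cont2 (charint G).
Proof.
  intros HG z. apply (cts_RInt (fun (z : R * R) s => G s (snd z - s)) (fun _ => 0) (fun z => fst z));
    intros; cts.
Qed.

Lemma cont2_avg (Y : R -> R -> R) : cont2 Y -> cont2 (avg Y).
Proof.
  intros HY z. unfold avg. apply cts_mult. apply continuous_const.
  apply (cts_RInt (fun (z : R * R) s => Y (fst z) (fst z + snd z * s)) (fun _ => -1) (fun z => 1));
    intros; cts.
Qed.

Lemma avg_line (Y : R -> R -> R) (t r : R) :
  (forall x, continuous (Y t) x) -> r * avg Y t r = / 2 * RInt (Y t) (t - r) (t + r).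
Proof.
  intros HY. unfold avg.
  transitivity (/ 2 * (r * RInt (fun s => Y t (r * s + t)) (-1) 1)).
  - rewrite (RInt_ext (fun s => Y t (t + r * s)) (fun s => Y t (r * s + t)))
      by (intros; f_equal; ring). ring.
  - f_equal. rewrite RInt_lin by exact HY. f_equal; ring.
Qed.

Lemma avg_even (Y : R -> R -> R) (t r : R) :
  (forall x, continuous (Y t) x) -> avg Y t (- r) = avg Y t r.
Proof.
  intros HY. destruct (Req_dec r 0) as [H | H].
  - now rewrite H, Ropp_0.
  - apply (Rmult_eq_reg_l r); [ | exact H]. rewrite avg_line by exact HY.
    transitivity (- (- r * avg Y t (- r))); [ring | ]. rewrite avg_line by exact HY.
    rewrite <- (opp_RInt_swap (Y t) (t + r) (t - r)) by now apply ex_RInt_cts.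
    unfold opp; simpl. replace (t - - r) with (t + r) by ring. replace (t + - r) with (t - r) by ring.
    ring.
Qed.

Lemma is_derive_avg (Y : R -> R -> R) (t r : R) :
  (forall x, continuous (Y t) x) ->
  is_derive (fun r => r * avg Y t r) r (/ 2 * (Y t (t + r) + Y t (t - r))).
Proof.
  intros HY.
  apply (is_derive_ext (fun r => / 2 * (RInt (Y t) 0 (t + r) - RInt (Y t) 0 (t - r)))).
  { intros x. rewrite avg_line by exact HY. f_equal.
    rewrite <- (RInt_split (Y t) 0 (t - x) (t + x) HY). rring. }
  eapply is_derive_eq.
  - apply (is_derive_mult_R (fun _ => / 2)). apply is_derive_const.
    apply @is_derive_minus.
    + apply (is_derive_comp_R (fun y => RInt (Y t) 0 y) (fun r => t + r)).
      now apply is_derive_RInt_upper. instantiate (1 := 1). auto_derive; [trivial | ring].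
    + apply (is_derive_comp_R (fun y => RInt (Y t) 0 y) (fun r => t - r)).
      now apply is_derive_RInt_upper. instantiate (1 := -1). auto_derive; [trivial | ring].
  - unfold zero, minus, plus, opp; simpl. ring.
Qed.

Lemma is_derive_charint (G g : R -> R -> R) (t x : R) :
  (forall s l, is_derive (G s) l (g s l)) -> cont2 G -> cont2 g ->
  is_derive (charint G t) x (charint g t x).
Proof.
  intros HG Gc gc.
  apply (is_derive_RInt_fixed (fun x s => G s (x - s)) (fun x s => g s (x - s))).
  - intros y s. eapply is_derive_eq. apply (is_derive_comp_R (G s) (fun y => y - s)). apply HG.
    instantiate (1 := 1). auto_derive; [trivial | ring]. ring.
  - intros z; cts.
  - intros z; cts.
Qed.

Lemma is_derive_charint_diag (G g : R -> R -> R) (t c : R) :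
  (forall s l, is_derive (G s) l (g s l)) -> cont2 G -> cont2 g ->
  is_derive (fun t => charint G t (t + c)) t (charint g t (t + c) + G t c).
Proof.
  intros HG Gc gc. unfold charint. eapply is_derive_eq.
  - apply (is_derive_RInt_bound (fun t s => G s (t + c - s)) (fun t s => g s (t + c - s)) 0 (fun t => t) t 1).
    + intros y s. eapply is_derive_eq. apply (is_derive_comp_R (G s) (fun y => y + c - s)). apply HG.
      instantiate (1 := 1). auto_derive; [trivial | ring]. ring.
    + intros z; cts.
    + intros z; cts.
    + auto_derive; [trivial | ring].
  - cbv beta. replace (t + c - t) with c by ring. rring.
Qed.

(** Exchanging the integrals turns the characteristic form into Duhamel's, one source time [s] at a
    time. *)
Lemma avg_charint (H : R -> R -> R) (t r : R) :
  cont2 H ->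
  avg (charint H) t r = RInt (fun s => / 2 * RInt (fun sg => H s (t - s + r * sg)) (-1) 1) 0 t.
Proof.
  intros HH. unfold avg, charint.
  rewrite (RInt_Fubini (fun sg s => H s (t + r * sg - s))) by (intros z; cts).
  rewrite <- RInt_multl.
  - apply RInt_ext. intros s _. f_equal. apply RInt_ext. intros sg _. f_equal. ring.
  - apply ex_RInt_cts. intros s.
    apply (cts_RInt (T := R_UniformSpace) (fun s sg => H s (t + r * sg - s))); intros; cts.
Qed.

Section Duhamel.
Variables (k : R -> R) (H : R -> R -> R).
Hypothesis kc : forall x, continuous k x.
Hypothesis Hc : cont2 H.
Hypothesis Hodd : forall s l, H s (- l) = - H s l.
Let Y (t x : R) : R := k x + charint H t x.

Lemma cont2_duhamel : cont2 Y.
Proof. intros z. unfold Y. assert (C := cont2_charint H Hc). cts. Qed.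

(* [r * avg Y t r] grows along an outgoing ray at the rate [Y], because [H] is odd. *)
Lemma is_derive_duhamel_diag (t r d : R) :
  is_derive (fun d => (r + d) * avg Y (t + d) (r + d)) d (Y (t + d) (t + r + 2 * d)).
Proof.
  assert (Yc := cont2_duhamel).
  assert (Ys := fun t => cont2_section Y t Yc).
  (* On the ray only the upper endpoint moves, with speed 2, and it produces [Y]. The change of [Y]
     in time integrates [H (t + d)] over [[- (r + d), r + d]], which gives zero by oddness. *)
  apply (is_derive_ext (fun d => / 2 * RInt (Y (t + d)) (t - r) (t + r + 2 * d))).
  { intros e. rewrite avg_line by apply Ys. f_equal. f_equal; ring. }
  eapply is_derive_eq.
  - apply (is_derive_mult_R (fun _ => / 2)). apply is_derive_const.
    apply (is_derive_RInt_bound (fun d => Y (t + d)) (fun d x => H (t + d) (x - (t + d)))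
             (t - r) (fun d => t + r + 2 * d) d 2).
    + intros e x. unfold Y. eapply is_derive_eq.
      * apply @is_derive_plus. apply is_derive_const.
        apply (is_derive_comp_R (fun t => charint H t x) (fun e => t + e)).
        apply (is_derive_RInt_upper (fun s => H s (x - s))). intros; cts.
        instantiate (1 := 1). auto_derive; [trivial | ring].
      * unfold zero, plus; simpl. ring.
    + intros z. cts.
    + intros z. cts.
    + auto_derive; [trivial | ring].
  - cbv beta. unfold zero; simpl.
    rewrite (RInt_ext (fun x => H (t + d) (x - (t + d))) (fun x => H (t + d) (1 * x + - (t + d))))
      by (intros; f_equal; ring).
    rewrite <- (Rmult_1_l (RInt (fun x => H (t + d) (1 * x + - (t + d))) _ _)).
    rewrite (RInt_lin (H (t + d)) 1) by (intros; cts).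
    replace (1 * (t - r) + - (t + d)) with (- (r + d)) by ring.
    replace (1 * (t + r + 2 * d) + - (t + d)) with (r + d) by ring.
    rewrite RInt_odd. field. intros; cts. apply Hodd.
Qed.

Section Differentiable.
Variables (k' : R -> R) (h : R -> R -> R).
Hypothesis kd : forall x, is_derive k x (k' x).
Hypothesis k'c : forall x, continuous k' x.
Hypothesis Hd : forall s l, is_derive (H s) l (h s l).
Hypothesis hc : cont2 h.
Let y (t x : R) : R := k' x + charint h t x.

Lemma cont2_duhamel' : cont2 y.
Proof. intros z. unfold y. assert (C := cont2_charint h hc). cts. Qed.

Lemma is_derive_duhamel_x (t x : R) : is_derive (Y t) x (y t x).
Proof.
  apply (is_derive_plus k (charint H t)). apply kd. now apply is_derive_charint.
Qed.

(** Lets [u_t] be bounded through values of [Y], with no estimate of the derivative [h] of the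
    source. *)
Lemma avg_duhamel_diff (t r : R) : 2 * r * avg y t r = Y t (t + r) - Y t (t - r).
Proof.
  assert (yc := cont2_section y t cont2_duhamel').
  rewrite Rmult_assoc, avg_line by exact yc.
  rewrite (RInt_antiderivative (Y t)).
  field. apply is_derive_duhamel_x. exact yc.
Qed.

(** For fixed [s] the point [t + r * s] moves with [t]; the extra end term [H t (r * s)] is odd in
    [s] and integrates to zero. *)
Lemma is_derive_avg_t (t r : R) : is_derive (fun t => avg Y t r) t (avg y t r).
Proof.
  assert (Yc := cont2_duhamel). assert (yc := cont2_duhamel').
  unfold avg. eapply is_derive_eq.
  - apply (is_derive_mult_R (fun _ => / 2)). apply is_derive_const.
    apply (is_derive_RInt_fixed (fun t s => Y t (t + r * s)) (fun t s => y t (t + r * s) + H t (r * s))).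
    + intros x s. unfold Y, y. eapply is_derive_eq.
      * apply @is_derive_plus.
        -- apply (is_derive_comp_R k (fun t => t + r * s)). apply kd.
           instantiate (1 := 1). auto_derive; [trivial | ring].
        -- apply (is_derive_charint_diag H h); assumption.
      * unfold plus; simpl. ring.
    + intros z. cts.
    + intros z. cts.
  - unfold zero; simpl.
    assert (E : RInt (fun s => y t (t + r * s) + H t (r * s)) (-1) 1 =
                RInt (fun s => y t (t + r * s)) (-1) 1 + RInt (fun s => H t (r * s)) (-1) 1).
    { apply (RInt_plus (fun s => y t (t + r * s)) (fun s => H t (r * s)));
        apply ex_RInt_cts; intros; cts. }
    rewrite E. replace (-1) with (- (1)) at 3 by ring.
    rewrite (RInt_odd (fun s => H t (r * s))). ring.
    intros; cts. intros x. rewrite <- Hodd. f_equal. ring.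
Qed.
End Differentiable.
End Duhamel.

(** * Powers *)

Definition abspow (e x : R) : R := rpow (Rabs x) e.
(** The signed power [sgn x * |x| ^ e]: up to the factor [e + 1], the derivative of
    [abspow (e + 1)]. *)
Definition sgnpow (e x : R) : R := rpow x e - rpow (- x) e.

Lemma rpow_pos (a e : R) : 0 < a -> rpow a e = Rpower a e.
Proof. intros Ha. unfold rpow. destruct (Rle_dec a 0); [lra | reflexivity]. Qed.

Lemma rpow_nonpos (a e : R) : a <= 0 -> rpow a e = 0.
Proof. intros Ha. unfold rpow. destruct (Rle_dec a 0); [reflexivity | lra]. Qed.

Lemma rpow_ge_0 (a e : R) : 0 <= rpow a e.
Proof. unfold rpow. destruct (Rle_dec a 0). lra. apply Rlt_le, exp_pos. Qed.

Lemma Rpower_pos (a e : R) : 0 < Rpower a e.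
Proof. apply exp_pos. Qed.

Lemma rpow_le (a b e : R) : 0 <= e -> a <= b -> 0 < b -> rpow a e <= Rpower b e.
Proof.
  intros He Hab Hb. destruct (Rle_dec a 0).
  - rewrite rpow_nonpos by assumption. apply Rlt_le, Rpower_pos.
  - rewrite rpow_pos by lra. apply Rle_Rpower_l; lra.
Qed.

Lemma rpow_split (a e : R) : rpow a e = a * rpow a (e - 1).
Proof.
  destruct (Rle_dec a 0).
  - rewrite 2 rpow_nonpos by assumption. ring.
  - rewrite 2 rpow_pos by lra. rewrite <- (Rpower_1 a) at 2 by lra.
    rewrite <- Rpower_plus. f_equal. ring.
Qed.

Lemma abspow_rpow (e x : R) : abspow e x = rpow x e + rpow (- x) e.
Proof.
  unfold abspow. destruct (Rle_dec 0 x).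
  - rewrite Rabs_pos_eq by assumption. rewrite (rpow_nonpos (- x)) by lra. ring.
  - rewrite Rabs_left by lra. rewrite (rpow_nonpos x) by lra. ring.
Qed.

Lemma abspow_ge_0 (e x : R) : 0 <= abspow e x.
Proof. apply rpow_ge_0. Qed.

Lemma abspow_0 (e : R) : abspow e 0 = 0.
Proof. unfold abspow. rewrite Rabs_R0. apply rpow_nonpos. lra. Qed.

Lemma abspow_le (e x M : R) : 0 <= e -> 0 < M -> Rabs x <= M -> abspow e x <= Rpower M e.
Proof. intros. now apply rpow_le. Qed.

Lemma sgnpow_abs (e x : R) : Rabs (sgnpow e x) = abspow e x.
Proof.
  unfold sgnpow. rewrite abspow_rpow. destruct (Rle_dec 0 x).
  - rewrite (rpow_nonpos (- x)) by lra. rewrite Rabs_pos_eq. ring.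
    assert (H := rpow_ge_0 x e). lra.
  - rewrite (rpow_nonpos x) by lra. rewrite Rabs_left1. ring.
    assert (H := rpow_ge_0 (- x) e). lra.
Qed.

Lemma sgnpow_mult (e x : R) : x * sgnpow (e - 1) x = abspow e x.
Proof. rewrite abspow_rpow, (rpow_split x), (rpow_split (- x)). unfold sgnpow. ring. Qed.

Lemma continuous_rpow (e x : R) : 0 < e -> continuous (fun x => rpow x e) x.
Proof.
  intros He. destruct (Rtotal_order x 0) as [H | [H | H]].
  - apply (continuous_ext_loc _ (fun _ => 0)); [ | apply continuous_const].
    exists (mkposreal (- x) ltac:(lra)). intros y Hy.
    change (Rabs (y - x) < - x) in Hy. apply Rabs_def2 in Hy. symmetry. apply rpow_nonpos. lra.
  - subst x. apply filterlim_locally. intros eps.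
    exists (mkposreal (Rpower eps (/ e)) (Rpower_pos _ _)). intros y Hy.
    change (Rabs (y - 0) < Rpower eps (/ e)) in Hy. apply Rabs_def2 in Hy.
    change (Rabs (rpow y e - rpow 0 e) < eps).
    rewrite (rpow_nonpos 0) by lra. rewrite Rminus_0_r, Rabs_pos_eq by apply rpow_ge_0.
    destruct (Rle_dec y 0).
    + rewrite rpow_nonpos by assumption. apply cond_pos.
    + rewrite rpow_pos by lra.
      replace (pos eps) with (Rpower (Rpower eps (/ e)) e).
      * unfold Rpower at 1 2. apply exp_increasing. apply Rmult_lt_compat_l. exact He.
        apply ln_increasing; lra.
      * rewrite Rpower_mult, Rinv_l by lra. apply Rpower_1, cond_pos.
  - apply (continuous_ext_loc _ (fun x => Rpower x e)).
    + exists (mkposreal x H). intros y Hy.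
      change (Rabs (y - x) < x) in Hy. apply Rabs_def2 in Hy. symmetry. apply rpow_pos. lra.
    + apply (ex_derive_continuous (fun x => Rpower x e)). eexists.
      apply is_derive_Reals. now apply derivable_pt_lim_power.
Qed.

(** The difference quotient at [0] is [g h] itself, so [g] need only be continuous. *)
Lemma is_derive_mult_id (g : R -> R) : continuous g 0 -> is_derive (fun l => l * g l) 0 (g 0).
Proof.
  intros Hg. apply is_derive_Reals. intros eps Heps.
  destruct (proj1 (filterlim_locally _ _) Hg (mkposreal eps Heps)) as [d Hd].
  exists d. intros h Hh Hhd.
  replace ((0 + h) * g (0 + h) - 0 * g 0) with (h * g h) by (rewrite Rplus_0_l; ring).
  replace (h * g h / h) with (g h) by (field; assumption).
  apply Hd. change (Rabs (h - 0) < d). now rewrite Rminus_0_r.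
Qed.

Lemma is_derive_rpow (e x : R) : 1 < e -> is_derive (fun x => rpow x e) x (e * rpow x (e - 1)).
Proof.
  intros He. destruct (Rtotal_order x 0) as [H | [H | H]].
  - rewrite rpow_nonpos by lra. rewrite Rmult_0_r.
    apply (is_derive_ext_loc (fun _ => 0)); [ | apply @is_derive_const].
    exists (mkposreal (- x) ltac:(lra)). intros y Hy.
    change (Rabs (y - x) < - x) in Hy. apply Rabs_def2 in Hy. symmetry. apply rpow_nonpos. lra.
  - subst x. apply (is_derive_ext (fun x => x * rpow x (e - 1))).
    { intros t. symmetry. apply rpow_split. }
    eapply is_derive_eq. apply is_derive_mult_id. apply continuous_rpow. lra.
    rewrite rpow_nonpos by lra. ring.
  - rewrite rpow_pos by lra. apply (is_derive_ext_loc (fun x => Rpower x e)).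
    + exists (mkposreal x H). intros y Hy.
      change (Rabs (y - x) < x) in Hy. apply Rabs_def2 in Hy. symmetry. apply rpow_pos. lra.
    + apply is_derive_Reals. now apply derivable_pt_lim_power.
Qed.

Lemma continuous_abspow (e : R) : 0 < e -> forall x, continuous (abspow e) x.
Proof.
  intros He x. apply (continuous_comp Rabs (fun x => rpow x e)).
  apply continuous_Rabs. now apply continuous_rpow.
Qed.

Lemma continuous_sgnpow (e : R) : 0 < e -> forall x, continuous (sgnpow e) x.
Proof.
  intros He x. unfold sgnpow.
  assert (C : forall x, continuous (fun x => rpow x e) x) by (intros; now apply continuous_rpow).
  apply cts_minus. apply C. apply (cts_app (fun x => rpow x e)). exact C. cts.
Qed.

Lemma is_derive_abspow (e x : R) : 1 < e -> is_derive (abspow e) x (e * sgnpow (e - 1) x).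
Proof.
  intros He. apply (is_derive_ext (fun x => rpow x e + rpow (- x) e)).
  { intros; symmetry; apply abspow_rpow. }
  eapply is_derive_eq.
  - apply @is_derive_plus. now apply is_derive_rpow.
    apply (is_derive_comp_R (fun x => rpow x e) (fun x => - x)). now apply is_derive_rpow.
    instantiate (1 := -1). auto_derive; [trivial | ring].
  - unfold plus, sgnpow; simpl. ring.
Qed.

Lemma abspow_lipschitz (e a b M : R) :
  1 < e -> 0 < M -> Rabs a <= M -> Rabs b <= M ->
  Rabs (abspow e a - abspow e b) <= e * Rpower M (e - 1) * Rabs (a - b).
Proof.
  intros He HM Ha Hb.
  destruct (MVT_gen (abspow e) b a (fun x => e * sgnpow (e - 1) x)) as [c [Hc E]].
  - intros. now apply is_derive_abspow.
  - intros. apply continuity_pt_filterlim. apply continuous_abspow. lra.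
  - rewrite E, 2 Rabs_mult, sgnpow_abs, (Rabs_pos_eq e) by lra.
    apply Rmult_le_compat_r. apply Rabs_pos. apply Rmult_le_compat_l. lra.
    apply abspow_le; try lra.
    apply Rabs_le. apply Rabs_le_between in Ha. apply Rabs_le_between in Hb.
    revert Hc. unfold Rmin, Rmax. destruct (Rle_dec b a); lra.
Qed.

(** [v] may fail to be differentiable at [l = 0]. Elsewhere [v' = (w - v) / l], the prefactor [l]
    cancels the division, and [v * sgnpow (q - 1) v = abspow q v] leaves a formula that holds at the
    axis too. *)
Lemma is_derive_radial_power (q : R) (v w : R -> R) :
  1 < q -> (forall l, continuous v l) -> (forall l, is_derive (fun l => l * v l) l (w l)) ->
  forall l, is_derive (fun l => l * abspow q (v l)) l
              ((1 - q) * abspow q (v l) + q * (sgnpow (q - 1) (v l) * w l)).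
Proof.
  intros Hq Hv Hw l. destruct (Req_dec l 0) as [H | H].
  - subst l.
    assert (E : w 0 = v 0).
    { rewrite <- (is_derive_unique _ _ _ (Hw 0)).
      apply is_derive_unique. now apply is_derive_mult_id. }
    eapply is_derive_eq.
    + apply (is_derive_mult_id (fun l => abspow q (v l))).
      apply (cts_app (abspow q)). apply continuous_abspow; lra. apply Hv.
    + rewrite E, (Rmult_comm (sgnpow _ _)), sgnpow_mult. ring.
  - assert (Hl : locally l (fun y => y <> 0)).
    { exists (mkposreal (Rabs l) (Rabs_pos_lt _ H)). intros y Hy E. subst y.
      change (Rabs (0 - l) < Rabs l) in Hy. rewrite Rminus_0_l, Rabs_Ropp in Hy. lra. }
    assert (Hvd : is_derive v l ((w l - v l) / l)).
    { apply (is_derive_ext_loc (fun y => / y * (y * v y))).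
      - revert Hl. apply filter_imp. intros y Hy. apply Rminus_diag_uniq; field. exact Hy.
      - eapply is_derive_eq. apply is_derive_mult_R. instantiate (1 := - / (l ^ 2)).
        auto_derive; [exact H | field; exact H]. apply Hw. cbv beta. field. exact H. }
    eapply is_derive_eq.
    + apply is_derive_mult_R. instantiate (1 := 1). auto_derive; [trivial | ring].
      apply (is_derive_comp_R (abspow q) v). now apply is_derive_abspow. exact Hvd.
    + assert (E := sgnpow_mult q (v l)).
      transitivity (abspow q (v l) + q * (sgnpow (q - 1) (v l) * w l) - q * (v l * sgnpow (q - 1) (v l))).
      field; exact H. rewrite E. ring.
Qed.

(** * Weights and integrals along characteristics *)

Lemma Rpower_anti (x y e : R) : 0 < x -> x <= y -> 0 <= e -> Rpower y (- e) <= Rpower x (- e).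
Proof.
  intros Hx Hxy He. rewrite 2 Rpower_Ropp. apply Rinv_le_contravar. apply Rpower_pos.
  apply Rle_Rpower_l; lra.
Qed.

Lemma Rpower_le_1 (x e : R) : 1 <= x -> 0 <= e -> Rpower x (- e) <= 1.
Proof. intros Hx He. rewrite <- (Rpower_O x) by lra. apply Rle_Rpower; lra. Qed.

Lemma Rpower_mult_opp1 (x e : R) : 0 < x -> Rpower x (1 - e) = x * Rpower x (- e).
Proof. intros Hx. unfold Rminus. rewrite Rpower_plus, Rpower_1 by exact Hx. reflexivity. Qed.

Lemma RInt_power_bound (f : R -> R) (m k a t A e : R) :
  0 < m -> a <= t -> 0 < m * a + k -> e <> 1 -> (forall s, continuous f s) ->
  (forall s, a <= s <= t -> Rabs (f s) <= A * Rpower (m * s + k) (- e)) ->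
  Rabs (RInt f a t) <=
  A * ((Rpower (m * t + k) (1 - e) - Rpower (m * a + k) (1 - e)) / (m * (1 - e))).
Proof.
  intros Hm Hat Hk He Hf Hb.
  set (F := fun s => A * (Rpower (m * s + k) (1 - e) / (m * (1 - e)))).
  assert (HI : is_RInt (fun s => A * Rpower (m * s + k) (- e)) a t (minus (F t) (F a))).
  { assert (Hp : forall s, Rmin a t <= s <= Rmax a t -> 0 < m * s + k).
    { intros s Hs. rewrite Rmin_left, Rmax_right in Hs by lra. nra. }
    assert (HD : forall e s, 0 < m * s + k ->
       is_derive (fun s => Rpower (m * s + k) e) s (m * (e * Rpower (m * s + k) (e - 1)))).
    { intros e' s Hs. apply (is_derive_comp_R (fun x => Rpower x e') (fun s => m * s + k)).
      - apply is_derive_Reals. now apply derivable_pt_lim_power.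
      - auto_derive; [trivial | ring]. }
    apply (is_RInt_derive F); intros s Hs; apply Hp in Hs.
    - unfold F. eapply is_derive_eq.
      + apply (is_derive_mult_R (fun _ => A)). apply is_derive_const.
        apply (is_derive_mult_R _ (fun _ => / (m * (1 - e)))). apply HD; exact Hs. apply is_derive_const.
      + unfold zero; simpl. replace (1 - e - 1) with (- e) by ring. field. split; lra.
    - apply cts_mult. apply continuous_const.
      apply (ex_derive_continuous (fun s => Rpower (m * s + k) (- e))). eexists. apply HD; exact Hs. }
  apply (norm_RInt_le f (fun s => A * Rpower (m * s + k) (- e)) a t (RInt f a t) _ Hat Hb) in HI.
  - eapply Rle_trans. exact HI. unfold F, minus, plus, opp; simpl. right. field. split; lra.
  - apply (RInt_correct (V := R_CompleteNormedModule)). now apply ex_RInt_cts.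
Qed.

(** Support in the cone makes the integrand vanish where the base is below 1, so the integral can
    start where negative powers are at most 1. *)
Lemma RInt_cut (f : R -> R) (m k a t : R) :
  0 < m -> a <= t -> (forall s, continuous f s) ->
  (forall s, a <= s <= t -> m * s + k < 1 -> f s = 0) ->
  RInt f a t = 0 \/
  exists a', a <= a' <= t /\ 1 <= m * a' + k /\ RInt f a t = RInt f a' t.
Proof.
  intros Hm Hat Hf Hz. set (c := (1 - k) / m).
  assert (Hc : m * c = 1 - k) by (unfold c; field; lra).
  destruct (Rle_dec c a) as [H | H].
  { right. exists a. repeat split; try lra. nra. }
  destruct (Rle_dec c t) as [H' | H'].
  - right. exists c. repeat split; try lra.
    rewrite <- (RInt_split f a c t Hf). rewrite RInt_zero. rring. lra.
    intros s Hs. apply Hz. lra. nra.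
  - left. apply RInt_zero. lra. intros s Hs. apply Hz. lra. nra.
Qed.

(** For [e < 1] the power [1 - e] is positive and the upper endpoint decides; for [e > 1], in the
    two lemmas that follow, the lower one does. *)
Lemma RInt_power_lt1 (f : R -> R) (m k a t A e : R) :
  0 < m -> a <= t -> 0 <= A -> e < 1 -> (forall s, continuous f s) ->
  (forall s, a <= s <= t -> m * s + k < 1 -> f s = 0) ->
  (forall s, a <= s <= t -> 1 <= m * s + k -> Rabs (f s) <= A * Rpower (m * s + k) (- e)) ->
  Rabs (RInt f a t) <= A * (Rpower (m * t + k) (1 - e) / (m * (1 - e))).
Proof.
  intros Hm Hat HA He Hf Hz Hb.
  assert (Hpos : 0 < m * (1 - e)) by (apply Rmult_lt_0_compat; lra).
  destruct (RInt_cut f m k a t Hm Hat Hf Hz) as [E | [a' [Ha' [H1 E]]]].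
  - rewrite E, Rabs_R0. apply Rmult_le_pos. exact HA.
    apply Rlt_le, Rdiv_lt_0_compat. apply Rpower_pos. exact Hpos.
  - rewrite E. eapply Rle_trans.
    + apply (RInt_power_bound f m k a' t A e); try lra. exact Hf.
      intros s Hs. apply Hb. lra. nra.
    + apply Rmult_le_compat_l. exact HA. apply Rmult_le_compat_r.
      now apply Rlt_le, Rinv_0_lt_compat.
      assert (H := Rpower_pos (m * a' + k) (1 - e)). lra.
Qed.

Lemma RInt_power_gt1_tail (f : R -> R) (m k a t A e : R) :
  0 < m -> a <= t -> 0 < m * a + k -> 0 <= A -> 1 < e -> (forall s, continuous f s) ->
  (forall s, a <= s <= t -> Rabs (f s) <= A * Rpower (m * s + k) (- e)) ->
  Rabs (RInt f a t) <= A * (Rpower (m * a + k) (1 - e) / (m * (e - 1))).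
Proof.
  intros Hm Hat Hk HA He Hf Hb. eapply Rle_trans.
  - apply (RInt_power_bound f m k a t A e); try lra; assumption.
  - apply Rmult_le_compat_l. exact HA.
    replace ((Rpower (m * t + k) (1 - e) - Rpower (m * a + k) (1 - e)) / (m * (1 - e)))
      with ((Rpower (m * a + k) (1 - e) - Rpower (m * t + k) (1 - e)) / (m * (e - 1)))
      by (field; split; lra).
    apply Rmult_le_compat_r.
    + apply Rlt_le, Rinv_0_lt_compat, Rmult_lt_0_compat; lra.
    + assert (H := Rpower_pos (m * t + k) (1 - e)). lra.
Qed.

Lemma RInt_power_gt1 (f : R -> R) (m k a t A e : R) :
  0 < m -> a <= t -> 0 <= A -> 1 < e -> (forall s, continuous f s) ->
  (forall s, a <= s <= t -> m * s + k < 1 -> f s = 0) ->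
  (forall s, a <= s <= t -> 1 <= m * s + k -> Rabs (f s) <= A * Rpower (m * s + k) (- e)) ->
  Rabs (RInt f a t) <= A * (/ (m * (e - 1))).
Proof.
  intros Hm Hat HA He Hf Hz Hb.
  assert (Hpos : 0 < m * (e - 1)) by (apply Rmult_lt_0_compat; lra).
  destruct (RInt_cut f m k a t Hm Hat Hf Hz) as [E | [a' [Ha' [H1 E]]]].
  - rewrite E, Rabs_R0. apply Rmult_le_pos. exact HA.
    now apply Rlt_le, Rinv_0_lt_compat.
  - rewrite E. eapply Rle_trans.
    + apply (RInt_power_gt1_tail f m k a' t A e); try lra. exact Hf.
      intros s Hs. apply Hb. lra. nra.
    + apply Rmult_le_compat_l. exact HA.
      rewrite <- (Rmult_1_l (/ _)). apply Rmult_le_compat_r.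
      now apply Rlt_le, Rinv_0_lt_compat.
      replace (1 - e) with (- (e - 1)) by ring. apply Rpower_le_1; lra.
Qed.

Definition xi (t r : R) : R := t + Rabs r + 2.
Definition eta (t r : R) : R := t - Rabs r + 2.
(* On the cone [Rabs r <= t + 1] both bases are at least 1. *)
Definition wt (a c t r : R) : R := Rpower (xi t r) (- a) * Rpower (eta t r) (- c).

Definition in_cone (G : R -> R -> R) : Prop :=
  forall s l, 0 <= s -> s + 1 < Rabs l -> G s l = 0.
(** Asked only inside the cone, since outside it [eta] may fail to be positive and [Rpower] is then
    no power. *)
Definition dominated (G : R -> R -> R) (A a c : R) : Prop :=
  forall s l, 0 <= s -> Rabs l <= s + 1 -> Rabs (G s l) <= A * wt a c s l.

Lemma wt_pos (a c t r : R) : 0 < wt a c t r.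
Proof. apply Rmult_lt_0_compat; apply Rpower_pos. Qed.

Lemma wt_le_1 (a c t r : R) : 0 <= a -> 0 <= c -> 0 <= t -> Rabs r <= t + 1 -> wt a c t r <= 1.
Proof.
  intros Ha Hc Ht Hr. assert (H := Rabs_pos r). unfold wt. rewrite <- (Rmult_1_l 1).
  apply Rmult_le_compat; try (apply Rlt_le, Rpower_pos); apply Rpower_le_1; unfold xi, eta; lra.
Qed.

Lemma wt_even (a c t r : R) : wt a c t (- r) = wt a c t r.
Proof. unfold wt, xi, eta. now rewrite Rabs_Ropp. Qed.

Lemma Rpower_mult_base (x y e : R) : 0 < x -> 0 < y -> Rpower (x * y) e = Rpower x e * Rpower y e.
Proof. intros. symmetry. now apply Rpower_mult_distr. Qed.

Lemma wt_power (M a c e t r : R) :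
  0 < M -> Rpower (M * wt a c t r) e = Rpower M e * wt (e * a) (e * c) t r.
Proof.
  intros HM. unfold wt.
  rewrite Rpower_mult_base, Rpower_mult_base, 2 Rpower_mult.
  - do 2 f_equal; f_equal; ring.
  - apply Rpower_pos.
  - apply Rpower_pos.
  - exact HM.
  - apply wt_pos.
Qed.

Lemma wt_mult (a c a' c' t r : R) :
  wt a c t r * wt a' c' t r = wt (a + a') (c + c') t r.
Proof.
  unfold wt. rewrite 2 Ropp_plus_distr, 2 Rpower_plus. ring.
Qed.

Lemma wt_xi (a c t r : R) : 0 <= t -> xi t r * wt a c t r = wt (a - 1) c t r.
Proof.
  intros Ht. unfold wt. assert (H := Rabs_pos r).
  replace (- (a - 1)) with (1 - a) by ring.
  rewrite Rpower_mult_opp1 by (unfold xi; lra). ring.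
Qed.

(** * Decay of characteristic integrals *)

Section CharBounds.
Variables (G : R -> R -> R) (A a c : R).
Hypothesis Gc : cont2 G.
Hypothesis GA : dominated G A a c.
Hypothesis Gs : in_cone G.
Hypothesis A0 : 0 <= A.

Lemma char_cts (x : R) : forall s, continuous (fun s => G s (x - s)) s.
Proof. intros s. cts. Qed.

Lemma outgoing_zero (x s : R) : 0 <= s -> s <= x -> 2 * s + (2 - x) < 1 -> G s (x - s) = 0.
Proof. intros. apply Gs. lra. rewrite Rabs_pos_eq; lra. Qed.

(** On the characteristic [s + l = x], before it meets the axis ([s <= x]), [xi] is frozen at
    [x + 2] and [eta] runs; after reflection the two exchange roles, as [incoming_bound] records. *)
Lemma outgoing_bound (x s : R) : 0 <= s -> s <= x -> 1 <= 2 * s + (2 - x) ->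
  Rabs (G s (x - s)) <= A * Rpower (x + 2) (- a) * Rpower (2 * s + (2 - x)) (- c).
Proof.
  intros H0 H1 H2.
  assert (E : Rabs (x - s) = x - s) by (apply Rabs_pos_eq; lra).
  eapply Rle_trans. apply GA; lra. unfold wt, xi, eta. rewrite E, Rmult_assoc. right.
  do 3 f_equal; ring.
Qed.

Lemma incoming_bound (x s : R) : 0 <= s -> x <= s -> -1 <= x ->
  Rabs (G s (x - s)) <= A * Rpower (x + 2) (- c) * Rpower (2 * s + (2 - x)) (- a).
Proof.
  intros H0 H1 H2.
  assert (E : Rabs (x - s) = s - x) by (rewrite Rabs_left1; lra).
  eapply Rle_trans. apply GA; lra. unfold wt, xi, eta. rewrite E. right.
  rewrite (Rmult_assoc A). f_equal. rewrite Rmult_comm. f_equal; f_equal; ring.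
Qed.

Lemma charint_left (t x : R) : 0 <= t -> x < -1 -> charint G t x = 0.
Proof.
  intros Ht Hx. apply RInt_zero. exact Ht. intros s Hs. apply Gs. lra.
  rewrite Rabs_left; lra.
Qed.

Lemma charint_right (t x : R) : 0 <= t -> 2 * t + 1 < x -> charint G t x = 0.
Proof.
  intros Ht Hx. apply RInt_zero. exact Ht. intros s Hs. apply Gs. lra.
  rewrite Rabs_pos_eq; lra.
Qed.

Let Apos (x e : R) : 0 <= A * Rpower x e.
Proof. apply Rmult_le_pos. exact A0. apply Rlt_le, Rpower_pos. Qed.

(** With both exponents below 1, integration costs at most one factor [xi]. For [t - r] the
    characteristic is split where it meets the axis; on the stretch before, [eta <= xi] and
    [1 - a > 0] turn a power of [eta] into one of [xi]. *)
Lemma charint_slow (t r : R) :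
  a < 1 -> c < 1 -> 0 <= t -> 0 <= r <= t + 1 ->
  Rabs (charint G t (t + r)) <= (/ (1 - a) + / (1 - c)) * A * (xi t r * wt a c t r) /\
  Rabs (charint G t (t - r)) <= (/ (1 - a) + / (1 - c)) * A * (xi t r * wt a c t r).
Proof.
  intros Ha Hc Ht Hr. unfold wt, xi, eta. rewrite (Rabs_pos_eq r) by lra.
  set (X := t + r + 2). set (E := t - r + 2).
  assert (HX : 1 <= E /\ E <= X) by (unfold X, E; lra).
  assert (Ia : 0 < / (1 - a)) by (apply Rinv_0_lt_compat; lra).
  assert (Ic : 0 < / (1 - c)) by (apply Rinv_0_lt_compat; lra).
  assert (Pa := Rpower_pos X (- a)). assert (Pc := Rpower_pos E (- c)).
  assert (HQ : 0 < X * (Rpower X (- a) * Rpower E (- c)))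
    by (repeat apply Rmult_lt_0_compat; lra).
  assert (Hin : forall s0, 0 <= s0 -> s0 <= t -> t - r <= s0 ->
     Rabs (RInt (fun s => G s (t - r - s)) s0 t) <= / (1 - a) / 2 * A * (X * (Rpower X (- a) * Rpower E (- c)))).
  { intros s0 H0 H1 H2. eapply Rle_trans.
    - apply (RInt_power_lt1 _ 2 (2 - (t - r)) s0 t (A * Rpower (t - r + 2) (- c)) a); try lra.
      apply Apos. apply char_cts.
      + intros; lra.
      + intros s Hs _. apply incoming_bound; lra.
    - right. rewrite Rpower_mult_opp1 by lra.
      replace (2 * t + (2 - (t - r))) with X by (unfold X; ring). fold E. field. lra. }
  split.
  - eapply Rle_trans.
    + apply (RInt_power_lt1 _ 2 (2 - (t + r)) 0 t (A * Rpower (t + r + 2) (- a)) c); try lra.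
      apply Apos. apply char_cts.
      * intros s Hs Hs2. apply outgoing_zero; lra.
      * intros s Hs Hs2. apply outgoing_bound; lra.
    + replace (2 * t + (2 - (t + r))) with E by (unfold E; ring). fold X.
      rewrite Rpower_mult_opp1 by lra.
      apply Rle_trans with (/ (1 - c) * A * (X * (Rpower X (- a) * Rpower E (- c)))).
      * replace (A * Rpower X (- a) * (E * Rpower E (- c) / (2 * (1 - c)))) with
          (/ (1 - c) * A * (E / 2 * (Rpower X (- a) * Rpower E (- c)))) by (field; lra).
        apply Rmult_le_compat_l. nra. apply Rmult_le_compat_r. nra. lra.
      * apply Rmult_le_compat_r. lra. apply Rmult_le_compat_r; lra.
  - destruct (Rle_dec 0 (t - r)) as [H | H].
    + unfold charint. rewrite <- (RInt_split (fun s => G s (t - r - s)) 0 (t - r) t (char_cts (t - r))).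
      eapply Rle_trans. apply Rabs_triang.
      assert (H1 : Rabs (RInt (fun s => G s (t - r - s)) 0 (t - r)) <=
         / (1 - c) * A * (X * (Rpower X (- a) * Rpower E (- c)))).
      { eapply Rle_trans.
        - apply (RInt_power_lt1 _ 2 (2 - (t - r)) 0 (t - r) (A * Rpower (t - r + 2) (- a)) c); try lra.
          apply Apos. apply char_cts.
          + intros s Hs Hs2. apply outgoing_zero; lra.
          + intros s Hs Hs2. apply outgoing_bound; lra.
        - replace (2 * (t - r) + (2 - (t - r))) with E by (unfold E; ring). fold E.
          rewrite Rpower_mult_opp1 by lra.
          replace (A * Rpower E (- a) * (E * Rpower E (- c) / (2 * (1 - c)))) with
            (/ (1 - c) * A * (Rpower E (1 - a) / 2 * Rpower E (- c)))
            by (rewrite Rpower_mult_opp1 by lra; field; lra).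
          apply Rmult_le_compat_l. nra. rewrite <- Rmult_assoc. apply Rmult_le_compat_r. lra.
          rewrite <- Rpower_mult_opp1 by lra.
          assert (Rpower E (1 - a) <= Rpower X (1 - a)) by (apply Rle_Rpower_l; lra).
          assert (Hp := Rpower_pos E (1 - a)). lra. }
      assert (H2 := Hin (t - r) ltac:(lra) ltac:(lra) ltac:(lra)).
      assert (H3 : / (1 - a) / 2 * A * (X * (Rpower X (- a) * Rpower E (- c))) <=
                   / (1 - a) * A * (X * (Rpower X (- a) * Rpower E (- c)))).
      { apply Rmult_le_compat_r. lra. apply Rmult_le_compat_r; lra. }
      lra.
    + unfold charint. eapply Rle_trans. apply Hin; lra.
      apply Rmult_le_compat_r. lra. apply Rmult_le_compat_r; lra.
Qed.

Lemma charint_fast (t x : R) :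
  1 < a -> 1 < c -> 0 <= t -> -1 <= x ->
  Rabs (charint G t x) <= (/ (a - 1) + / (c - 1)) * A * Rpower (x + 2) (- a).
Proof.
  intros Ha Hc Ht Hx.
  assert (Ia : 0 < / (a - 1)) by (apply Rinv_0_lt_compat; lra).
  assert (Ic : 0 < / (c - 1)) by (apply Rinv_0_lt_compat; lra).
  assert (Pa := Rpower_pos (x + 2) (- a)).
  assert (Hin : forall s0, 0 <= s0 -> s0 <= t -> x <= s0 ->
     Rabs (RInt (fun s => G s (x - s)) s0 t) <= / (a - 1) * A * Rpower (x + 2) (- a)).
  { intros s0 H0 H1 H2. eapply Rle_trans.
    - apply (RInt_power_gt1_tail _ 2 (2 - x) s0 t (A * Rpower (x + 2) (- c)) a); try lra.
      apply Apos. apply char_cts. intros s Hs. apply incoming_bound; lra.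
    - replace (A * Rpower (x + 2) (- c) * (Rpower (2 * s0 + (2 - x)) (1 - a) / (2 * (a - 1)))) with
        (/ (a - 1) * A * (Rpower (x + 2) (- c) * (Rpower (2 * s0 + (2 - x)) (1 - a) / 2))) by (field; lra).
      apply Rmult_le_compat_l. nra.
      replace (- a) with (-1 + (1 - a)) by ring. rewrite Rpower_plus.
      apply Rmult_le_compat.
      + apply Rlt_le, Rpower_pos.
      + assert (H := Rpower_pos (2 * s0 + (2 - x)) (1 - a)). lra.
      + apply Rle_Rpower; lra.
      + replace (1 - a) with (- (a - 1)) by ring.
        assert (H := Rpower_pos (2 * s0 + (2 - x)) (- (a - 1))).
        assert (Rpower (2 * s0 + (2 - x)) (- (a - 1)) <= Rpower (x + 2) (- (a - 1)))
          by (apply Rpower_anti; lra). lra. }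
  assert (Hout : forall s1, 0 <= s1 -> s1 <= x ->
     Rabs (RInt (fun s => G s (x - s)) 0 s1) <= / (c - 1) * A * Rpower (x + 2) (- a)).
  { intros s1 H0 H1. eapply Rle_trans.
    - apply (RInt_power_gt1 _ 2 (2 - x) 0 s1 (A * Rpower (x + 2) (- a)) c); try lra.
      apply Apos. apply char_cts.
      + intros s Hs Hs2. apply outgoing_zero; lra.
      + intros s Hs Hs2. apply outgoing_bound; lra.
    - replace (A * Rpower (x + 2) (- a) * / (2 * (c - 1))) with
        (/ (c - 1) / 2 * (A * Rpower (x + 2) (- a))) by (field; lra).
      rewrite Rmult_assoc. apply Rmult_le_compat_r. apply Apos. lra. }
  assert (P1 : 0 <= / (a - 1) * A * Rpower (x + 2) (- a)) by (repeat apply Rmult_le_pos; lra).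
  assert (P2 : 0 <= / (c - 1) * A * Rpower (x + 2) (- a)) by (repeat apply Rmult_le_pos; lra).
  rewrite 2 Rmult_plus_distr_r. unfold charint.
  destruct (Rle_dec x 0) as [H | H].
  - assert (H1 := Hin 0 ltac:(lra) Ht H). lra.
  - destruct (Rle_dec t x) as [H' | H'].
    + assert (H1 := Hout t Ht H'). lra.
    + rewrite <- (RInt_split (fun s => G s (x - s)) 0 x t (char_cts x)). eapply Rle_trans. apply Rabs_triang.
      assert (H1 := Hin x ltac:(lra) ltac:(lra) ltac:(lra)).
      assert (H2 := Hout x ltac:(lra) ltac:(lra)). lra.
Qed.
End CharBounds.

(** The threshold [r = t / 2 + 1] is where [xi = 3 eta = 3 r]. Below it [xi <= 3 eta], and the bound
    at [t - r] serves on the whole interval; above it [1 / r <= 3 / xi], and integrating the power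
    yields [eta ^ (- b) / b]. Each regime contributes one term of [3 + 3 / b]. *)
Lemma avg_bound (Y : R -> R -> R) (N b : R) :
  0 < b -> 0 <= N -> cont2 Y ->
  (forall t x, 0 <= t -> -1 <= x -> Rabs (Y t x) <= N * Rpower (x + 2) (- (1 + b))) ->
  dominated (avg Y) ((3 + 3 / b) * N) 1 b.
Proof.
  intros Hb HN Yc HY t r0 Ht Hr0.
  assert (Ys := fun t => cont2_section Y t Yc).
  assert (Ib : 0 < / b) by now apply Rinv_0_lt_compat.
  assert (Hmain : forall r, 0 <= r <= t + 1 -> Rabs (avg Y t r) <= (3 + 3 / b) * N * wt 1 b t r).
  { intros r Hr. unfold wt, xi, eta. rewrite (Rabs_pos_eq r) by lra.
    rewrite Rpower_Ropp, Rpower_1 by lra.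
    assert (Pb := Rpower_pos (t - r + 2) (- b)).
    assert (IX : 0 < / (t + r + 2)) by (apply Rinv_0_lt_compat; lra).
    assert (PN : 0 <= N * (/ (t + r + 2) * Rpower (t - r + 2) (- b))) by (repeat apply Rmult_le_pos; lra).
    destruct (Rle_dec r (t / 2 + 1)) as [H | H].
    - apply Rle_trans with (3 * N * (/ (t + r + 2) * Rpower (t - r + 2) (- b))).
      2: { rewrite !Rmult_assoc. apply Rmult_le_compat_r. exact PN. unfold Rdiv; nra. }
      unfold avg. rewrite Rabs_mult, (Rabs_pos_eq (/ 2)) by lra.
      assert (H1 : Rabs (RInt (fun s => Y t (t + r * s)) (-1) 1) <=
         (1 - -1) * (N * Rpower (t - r + 2) (- (1 + b)))).
      { apply abs_RInt_le_const. lra. apply ex_RInt_cts. intros; cts.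
        intros s Hs. assert (t - r <= t + r * s) by nra.
        eapply Rle_trans. apply HY; lra. apply Rmult_le_compat_l. exact HN.
        apply Rpower_anti; lra. }
      assert (H2 : Rpower (t - r + 2) (- (1 + b)) <= 3 * (/ (t + r + 2) * Rpower (t - r + 2) (- b))).
      { replace (- (1 + b)) with (- (1) + - b) by ring.
        rewrite Rpower_plus, Rpower_Ropp, Rpower_1, <- Rmult_assoc by lra.
        apply Rmult_le_compat_r. lra.
        replace 3 with (/ / 3) by field. rewrite <- Rinv_mult. apply Rinv_le_contravar; lra. }
      assert (H3 : N * Rpower (t - r + 2) (- (1 + b)) <= N * (3 * (/ (t + r + 2) * Rpower (t - r + 2) (- b))))
        by (apply Rmult_le_compat_l; lra).
      lra.
    - apply Rle_trans with (3 / b * N * (/ (t + r + 2) * Rpower (t - r + 2) (- b))).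
      2: { rewrite !Rmult_assoc. rewrite Rmult_plus_distr_r. unfold Rdiv in *. lra. }
      assert (H1 : Rabs (RInt (Y t) (t - r) (t + r)) <= N * (Rpower (1 * (t - r) + 2) (1 - (1 + b)) / (1 * (1 + b - 1)))).
      { apply (RInt_power_gt1_tail (Y t) 1 2 (t - r) (t + r) N (1 + b)); try lra. apply Ys.
        intros s Hs. rewrite Rmult_1_l. apply HY; lra. }
      rewrite !Rmult_1_l in H1. replace (1 - (1 + b)) with (- b) in H1 by ring.
      replace (1 + b - 1) with b in H1 by ring.
      assert (H2 : avg Y t r = / r * (/ 2 * RInt (Y t) (t - r) (t + r))).
      { rewrite <- avg_line by apply Ys. field. lra. }
      rewrite H2, Rabs_mult, Rabs_mult, (Rabs_pos_eq (/ 2)) by lra.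
      assert (Ir : 0 < / r) by (apply Rinv_0_lt_compat; lra).
      rewrite (Rabs_pos_eq (/ r)) by lra.
      assert (H3 : / r <= 3 * / (t + r + 2)).
      { replace (3 * / (t + r + 2)) with (/ ((t + r + 2) / 3)) by (field; lra).
        apply Rinv_le_contravar; lra. }
      set (Q := N * (Rpower (t - r + 2) (- b) / b)) in *.
      assert (HQ : 0 <= Q) by (unfold Q, Rdiv; repeat apply Rmult_le_pos; lra).
      apply Rle_trans with (3 * / (t + r + 2) * Q).
      + apply Rmult_le_compat; try lra. apply Rmult_le_pos; [lra | apply Rabs_pos].
      + right. unfold Q. field. lra. }
  destruct (Rle_dec 0 r0).
  - apply Hmain. rewrite Rabs_pos_eq in Hr0; lra.
  - rewrite <- (Ropp_involutive r0), avg_even, wt_even by apply Ys. apply Hmain.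
    rewrite Rabs_left in Hr0; lra.
Qed.

Lemma Rabs_minus_le (x y : R) : Rabs (x - y) <= Rabs x + Rabs y.
Proof. unfold Rminus. rewrite <- (Rabs_Ropp y). apply Rabs_triang. Qed.

Lemma abspow_dominated (v : R -> R -> R) (B a c e : R) :
  0 < B -> 0 <= e -> dominated v B a c -> forall s l, 0 <= s -> Rabs l <= s + 1 ->
  abspow e (v s l) <= Rpower B e * wt (e * a) (e * c) s l.
Proof.
  intros HB He Hv s l Hs Hl. rewrite <- wt_power by exact HB. apply abspow_le.
  exact He. apply Rmult_lt_0_compat. exact HB. apply wt_pos. now apply Hv.
Qed.

Lemma Rabs_le_xi (s l : R) : 0 <= s -> Rabs l <= xi s l.
Proof. intros. unfold xi. lra. Qed.

Lemma in_cone_mult_abspow (v : R -> R -> R) (e : R) :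
  in_cone v -> in_cone (fun s l => l * abspow e (v s l)).
Proof. intros Hv s l Hs Hl. rewrite Hv by assumption. rewrite abspow_0. ring. Qed.

Lemma dominated_mult_abspow (v : R -> R -> R) (B a c e : R) :
  0 < B -> 0 <= e -> dominated v B a c ->
  dominated (fun s l => l * abspow e (v s l)) (Rpower B e) (e * a - 1) (e * c).
Proof.
  intros HB He Hv s l Hs Hl. rewrite Rabs_mult, (Rabs_pos_eq (abspow _ _)) by apply abspow_ge_0.
  rewrite <- wt_xi by exact Hs.
  replace (Rpower B e * (xi s l * wt (e * a) (e * c) s l))
    with (xi s l * (Rpower B e * wt (e * a) (e * c) s l)) by ring.
  apply Rmult_le_compat. apply Rabs_pos. apply abspow_ge_0. now apply Rabs_le_xi.
  now apply abspow_dominated.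
Qed.

(** For use where [xi] and [eta] have explicit upper bounds: plain constants are then absorbed in
    the weight. *)
Lemma wt_lower (a c t r : R) :
  a <= 1 -> c <= 1 -> 0 <= t -> Rabs r <= t + 1 -> / xi t r * / eta t r <= wt a c t r.
Proof.
  intros Ha Hc Ht Hr. assert (H := Rabs_pos r). unfold wt.
  assert (E : forall x, 1 <= x -> forall e, e <= 1 -> / x <= Rpower x (- e)).
  { intros x Hx e He. rewrite <- (Rpower_1 x) at 1 by lra. rewrite <- Rpower_Ropp.
    apply Rle_Rpower; lra. }
  apply Rmult_le_compat.
  - apply Rlt_le, Rinv_0_lt_compat. unfold xi; lra.
  - apply Rlt_le, Rinv_0_lt_compat. unfold eta; lra.
  - apply E. unfold xi; lra. exact Ha.
  - apply E. unfold eta; lra. exact Hc.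
Qed.

(** * From the decay of [v] to that of [u_t] *)

Section StrongBound.
Variables (q b B : R) (v : R -> R -> R).
Hypothesis hq : 1 < q < 2.
Hypothesis hb : 0 < b.
Hypothesis hbq : q * b < 1.
Hypothesis HB : 0 < B.
Hypothesis vc : cont2 v.
Hypothesis vs : in_cone v.
Hypothesis vB : dominated v B 1 b.
Hypothesis vD : forall s l d, 0 <= s -> 0 <= l <= s + 1 -> 0 <= d ->
  Rabs ((l + d) * v (s + d) (l + d) - l * v s l) <= d * (B * Rpower (s + l + 2) (- (1 + b))).

Let K (s l : R) : R := l * abspow q (v s l).

Let Kc : cont2 K.
Proof.
  intros z. unfold K. assert (C := continuous_abspow q ltac:(lra)). cts.
Qed.

Let Ks : in_cone K.
Proof. now apply in_cone_mult_abspow. Qed.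

Let KB : dominated K (Rpower B q) (q - 1) (q * b).
Proof.
  replace (q - 1) with (q * 1 - 1) by ring. apply dominated_mult_abspow; [exact HB | lra | exact vB].
Qed.

(** Gains [d / xi] over the bound [KB] on [K] itself. Since [v2 - v1] appears multiplied by [l + d],
    the increment [vD] of [l v] controls it and no derivative of [v] is needed; [m] bounds [v] at
    both ends because [eta] is constant and [xi] grows along the ray. *)
Lemma outgoing_increment (s l d : R) :
  0 <= s -> 0 <= l <= s + 1 -> 0 <= d ->
  Rabs (K (s + d) (l + d) - K s l) <=
  (2 * q + 1) * d * (Rpower B q * wt q (q * b) s l).
Proof.
  intros Hs Hl Hd.
  set (m := B * wt 1 b s l).
  assert (Hm : 0 < m) by (apply Rmult_lt_0_compat; [exact HB | apply wt_pos]).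
  assert (El : Rabs l = l) by (apply Rabs_pos_eq; lra).
  assert (Eld : Rabs (l + d) = l + d) by (apply Rabs_pos_eq; lra).
  assert (H1 : Rabs (v s l) <= m) by (apply vB; lra).
  assert (H2 : Rabs (v (s + d) (l + d)) <= m).
  { eapply Rle_trans. apply vB; lra. apply Rmult_le_compat_l. lra.
    unfold wt, xi, eta. rewrite El, Eld. replace (s + d - (l + d)) with (s - l) by ring.
    apply Rmult_le_compat_r. apply Rlt_le, Rpower_pos. apply Rpower_anti; lra. }
  assert (H3 := vD s l d Hs Hl Hd).
  assert (H4 : B * Rpower (s + l + 2) (- (1 + b)) <= m).
  { unfold m. apply Rmult_le_compat_l. lra. unfold wt, xi, eta. rewrite El.
    replace (- (1 + b)) with (- (1) + - b) by ring. rewrite Rpower_plus.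
    apply Rmult_le_compat_l. apply Rlt_le, Rpower_pos. apply Rpower_anti; lra. }
  assert (H5 := abspow_lipschitz q (v (s + d) (l + d)) (v s l) m ltac:(lra) Hm H2 H1).
  replace (Rpower B q * wt q (q * b) s l) with (Rpower m q)
    by (unfold m; rewrite wt_power by exact HB; f_equal; f_equal; ring).
  assert (Em : Rpower m q = Rpower m (q - 1) * m).
  { rewrite <- (Rpower_1 m) at 3 by exact Hm. rewrite <- Rpower_plus. f_equal. ring. }
  assert (H6 : abspow q (v s l) <= Rpower m q) by (apply abspow_le; lra).
  unfold K. set (v1 := v s l) in *. set (v2 := v (s + d) (l + d)) in *.
  replace ((l + d) * abspow q v2 - l * abspow q v1) with ((l + d) * (abspow q v2 - abspow q v1) + d * abspow q v1) by ring.
  eapply Rle_trans. apply Rabs_triang. rewrite 2 Rabs_mult, Eld, (Rabs_pos_eq d) by exact Hd.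
  rewrite (Rabs_pos_eq (abspow q v1)) by apply abspow_ge_0.
  assert (H7 : (l + d) * Rabs (v2 - v1) <= 2 * d * m).
  { rewrite <- Eld, <- Rabs_mult.
    replace ((l + d) * (v2 - v1)) with ((l + d) * v2 - l * v1 - d * v1) by ring.
    unfold Rminus at 1. eapply Rle_trans. apply Rabs_triang.
    rewrite Rabs_Ropp, Rabs_mult, (Rabs_pos_eq d) by exact Hd. nra. }
  assert (Pm := Rpower_pos m (q - 1)).
  assert (H8 : (l + d) * Rabs (abspow q v2 - abspow q v1) <= q * Rpower m (q - 1) * (2 * d * m)).
  { apply Rle_trans with (q * Rpower m (q - 1) * ((l + d) * Rabs (v2 - v1))).
    - apply Rle_trans with ((l + d) * (q * Rpower m (q - 1) * Rabs (v2 - v1))).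
      apply Rmult_le_compat_l; lra. right; ring.
    - apply Rmult_le_compat_l. nra. exact H7. }
  assert (H9 : d * abspow q v1 <= d * Rpower m q) by (apply Rmult_le_compat_l; lra).
  rewrite Em in *. nra.
Qed.

Let W (t r : R) : R := wt (q - 1) (q * b) t r.
Let Bq : R := Rpower B q.
Let S (t r : R) : R := charint K t (t + r) - charint K t (t - r).

Let Bq0 : 0 < Bq.
Proof. apply Rpower_pos. Qed.

(** Here [xi <= 3 r], so the factor [r] costs nothing and the two integrals are bounded
    separately. *)
Lemma char_diff_far (t r : R) : 0 <= t -> t / 2 + 1 < r <= t + 1 ->
  Rabs (S t r) <= 6 * (/ (2 - q) + / (1 - q * b)) * Bq * r * W t r.
Proof.
  intros Ht Hr.
  destruct (charint_slow K Bq (q - 1) (q * b) Kc KB Ks ltac:(lra) t r ltac:(lra) ltac:(lra) Ht ltac:(lra)) as [H1 H2].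
  replace (1 - (q - 1)) with (2 - q) in * by ring. fold (W t r) in *.
  assert (HW : 0 < W t r) by apply wt_pos.
  assert (I1 : 0 < / (2 - q)) by (apply Rinv_0_lt_compat; lra).
  assert (I2 : 0 < / (1 - q * b)) by (apply Rinv_0_lt_compat; lra).
  set (c := (/ (2 - q) + / (1 - q * b)) * Bq) in *.
  assert (Hc : 0 < c) by (unfold c; apply Rmult_lt_0_compat; lra).
  assert (Hx : xi t r * W t r <= 3 * r * W t r).
  { apply Rmult_le_compat_r. lra. unfold xi. rewrite Rabs_pos_eq; lra. }
  assert (H3 : c * (xi t r * W t r) <= c * (3 * r * W t r)) by (apply Rmult_le_compat_l; lra).
  unfold S. eapply Rle_trans. apply Rabs_minus_le.
  apply Rle_trans with (2 * (c * (3 * r * W t r))). lra. right. unfold c. ring.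
Qed.

(** The constraints force [t < 2] and [r <= 2]. The factor [r] comes from the factor [l] of [K], and
    [W] is at least [1 / 12] since [xi <= 6] and [eta <= 2]. *)
Lemma char_diff_tiny (t r : R) : 0 <= t -> t < r <= t / 2 + 1 ->
  Rabs (S t r) <= 96 * Bq * r * W t r.
Proof.
  intros Ht Hr.
  assert (HK : forall s l, 0 <= s -> Rabs (K s l) <= Rabs l * Bq).
  { intros s l Hs. destruct (Rle_dec (Rabs l) (s + 1)) as [Hl | Hl].
    - unfold K. rewrite Rabs_mult, (Rabs_pos_eq (abspow _ _)) by apply abspow_ge_0.
      apply Rmult_le_compat_l. apply Rabs_pos.
      eapply Rle_trans. apply (abspow_dominated v B 1 b q); try lra; assumption.
      rewrite <- (Rmult_1_r Bq). apply Rmult_le_compat_l. apply Rlt_le, Bq0.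
      apply wt_le_1; try lra. apply Rmult_le_pos; lra.
    - rewrite Ks by lra. rewrite Rabs_R0. apply Rmult_le_pos. apply Rabs_pos. apply Rlt_le, Bq0. }
  assert (H : forall x, Rabs x <= t + r -> (forall s, 0 <= s <= t -> Rabs (x - s) <= 2 * r) ->
     Rabs (charint K t x) <= (t - 0) * (2 * r * Bq)).
  { intros x _ Hx. apply abs_RInt_le_const. exact Ht. apply ex_RInt_cts. intros; cts.
    intros s Hs. eapply Rle_trans. apply HK; lra. apply Rmult_le_compat_r. apply Rlt_le, Bq0. now apply Hx. }
  assert (H1 := H (t + r)). assert (H2 := H (t - r)).
  assert (HW : 1 <= 12 * W t r).
  { assert (Hl := wt_lower (q - 1) (q * b) t r ltac:(lra) ltac:(lra) Ht).
    rewrite Rabs_pos_eq in Hl by lra. specialize (Hl ltac:(lra)). fold (W t r) in Hl.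
    unfold xi, eta in Hl. rewrite Rabs_pos_eq in Hl by lra.
    assert (/ 6 <= / (t + r + 2)) by (apply Rinv_le_contravar; lra).
    assert (/ 2 <= / (t - r + 2)) by (apply Rinv_le_contravar; lra).
    nra. }
  assert (E1 : Rabs (charint K t (t + r)) <= (t - 0) * (2 * r * Bq)).
  { apply H1. rewrite Rabs_pos_eq; lra. intros s Hs. rewrite Rabs_pos_eq; lra. }
  assert (E2 : Rabs (charint K t (t - r)) <= (t - 0) * (2 * r * Bq)).
  { apply H2. rewrite Rabs_left; lra. intros s Hs. rewrite Rabs_left; lra. }
  assert (HB0 := Bq0). assert (HrB : 0 < r * Bq) by (apply Rmult_lt_0_compat; lra).
  unfold S. eapply Rle_trans. apply Rabs_minus_le.
  assert (H3 : (t - 0) * (2 * r * Bq) <= 2 * (2 * (r * Bq))).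
  { replace ((t - 0) * (2 * r * Bq)) with (t * (2 * (r * Bq))) by ring.
    apply Rmult_le_compat_r; lra. }
  replace (96 * Bq * r * W t r) with (8 * (r * Bq) * (12 * W t r)) by ring.
  assert (8 * (r * Bq) * 1 <= 8 * (r * Bq) * (12 * W t r)) by (apply Rmult_le_compat_l; lra).
  lra.
Qed.

(* Near the axis the two characteristics are compared at equal [s - l], i.e. after a shift of
   [s] by [r]: differentiating across the cone instead would lose the decay of [v] in [s - l]. *)
Lemma char_diff_near (t r : R) : 0 <= r -> r <= t -> r <= t / 2 + 1 ->
  Rabs (S t r) <= (3 * (2 * q + 1) / (1 - q * b) + 6) * Bq * r * W t r.
Proof.
  intros H0 Hrt Hr.
  assert (Iqb : 0 < / (1 - q * b)) by (apply Rinv_0_lt_compat; lra).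
  assert (HqB : 0 < q * b) by (apply Rmult_lt_0_compat; lra).
  set (X := t + r + 2). set (E := t - r + 2).
  assert (HE : 2 <= E) by (unfold E; lra).
  assert (HXE : E <= X <= 3 * E) by (unfold X, E; lra).
  assert (EW : W t r = Rpower X (- (q - 1)) * Rpower E (- (q * b))).
  { unfold W, wt, xi, eta. now rewrite Rabs_pos_eq. }
  assert (PX := Rpower_pos X (- (q - 1))). assert (PE := Rpower_pos E (- (q * b))).
  assert (PE1 := Rpower_pos E (- (q - 1))).
  (* As [xi <= 3 eta] in this region, a negative power of [eta] may be replaced by one of [xi]; the
     exponent [q - 1] is below 1, so the price is at most 3. *)
  assert (HXE1 : Rpower E (- (q - 1)) <= 3 * Rpower X (- (q - 1))).
  { apply Rle_trans with (Rpower (/ 3 * X) (- (q - 1))).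
    - apply Rpower_anti; lra.
    - rewrite Rpower_mult_base by lra. apply Rmult_le_compat_r. lra.
      replace (Rpower (/ 3) (- (q - 1))) with (Rpower 3 (q - 1))
        by (unfold Rpower; rewrite ln_Rinv by lra; f_equal; ring).
      apply Rle_trans with (Rpower 3 1). apply Rle_Rpower; lra. rewrite Rpower_1; lra. }
  set (f1 := fun s => K s (t + r - s)). set (f2 := fun s => K s (t - r - s)).
  assert (f1c : forall s, continuous f1 s) by (intros; unfold f1; cts).
  assert (f2c : forall s, continuous f2 s) by (intros; unfold f2; cts).
  (* The shift by [r] leaves one interval of length [r] at each end, and their length supplies the
     factor [r]. *)
  assert (HS : S t r = RInt (fun s => f1 (1 * s + r) - f2 s) 0 (t - r)
                 + (RInt f1 0 r - RInt f2 (t - r) t)).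
  { unfold S, charint. fold f1 f2.
    rewrite <- (RInt_split f1 0 r t f1c), <- (RInt_split f2 0 (t - r) t f2c).
    assert (E1 : RInt (fun s => f1 (1 * s + r) - f2 s) 0 (t - r) =
       RInt (fun s => f1 (1 * s + r)) 0 (t - r) - RInt f2 0 (t - r)).
    { apply (RInt_minus (fun s => f1 (1 * s + r)) f2); apply ex_RInt_cts; intros; cts. }
    assert (E2 : RInt (fun s => f1 (1 * s + r)) 0 (t - r) = RInt f1 r t).
    { rewrite <- (Rmult_1_l (RInt _ 0 _)), (RInt_lin f1 1 r) by exact f1c. f_equal; ring. }
    rewrite E1, E2. rring. }
  (* Each increment carries [xi ^ (- q)], which is frozen at [E ^ (- q)]; integrating the power of
     [eta] adds [E ^ (1 - q * b)]. *)
  assert (HA : Rabs (RInt (fun s => f1 (1 * s + r) - f2 s) 0 (t - r)) <=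
     3 * (2 * q + 1) / (1 - q * b) * Bq * r * W t r).
  { eapply Rle_trans.
    - apply (RInt_power_lt1 _ 2 (2 - (t - r)) 0 (t - r)
        ((2 * q + 1) * r * (Bq * Rpower E (- q))) (q * b)); try lra.
      + apply Rmult_le_pos. apply Rmult_le_pos; lra. apply Rmult_le_pos. apply Rlt_le, Bq0.
        apply Rlt_le, Rpower_pos.
      + intros s. cts.
      + intros s Hs Hs2. unfold f1, f2. rewrite 2 Ks; try lra; rewrite Rabs_pos_eq; lra.
      + intros s Hs Hs2. unfold f1, f2.
        assert (HI := outgoing_increment s (t - r - s) r ltac:(lra) ltac:(lra) H0).
        replace (1 * s + r) with (s + r) by ring.
        replace (t + r - (s + r)) with (t - r - s + r) by ring.
        eapply Rle_trans. exact HI. right. unfold wt, xi, eta. rewrite Rabs_pos_eq by lra.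
        unfold Bq. rewrite !Rmult_assoc. do 4 f_equal; f_equal; unfold E; ring.
    - replace (2 * (t - r) + (2 - (t - r))) with E by (unfold E; ring).
      rewrite Rpower_mult_opp1 by lra.
      assert (EE : E * Rpower E (- q) = Rpower E (- (q - 1))).
      { rewrite <- Rpower_mult_opp1 by lra. f_equal. ring. }
      replace ((2 * q + 1) * r * (Bq * Rpower E (- q)) * (E * Rpower E (- (q * b)) / (2 * (1 - q * b))))
        with ((2 * q + 1) / (1 - q * b) * Bq * r * (/ 2 * (E * Rpower E (- q)) * Rpower E (- (q * b))))
        by (field; lra).
      rewrite EE, EW.
      apply Rle_trans with ((2 * q + 1) / (1 - q * b) * Bq * r * (3 * Rpower X (- (q - 1)) * Rpower E (- (q * b)))).
      + apply Rmult_le_compat_l.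
        * apply Rmult_le_pos; [ | exact H0]. apply Rmult_le_pos; [ | apply Rlt_le, Bq0].
          apply Rmult_le_pos; lra.
        * apply Rmult_le_compat_r; lra.
      + right. field. lra. }
  assert (HBB : Rabs (RInt f1 0 r) <= 3 * Bq * r * W t r).
  { assert (HBq := Bq0). assert (HW := wt_pos (q - 1) (q * b) t r). fold (W t r) in HW.
    (* If [t - r > 1], the stretch [0 < s < r] lies outside the cone; otherwise [E <= 3], and its
       power in the weight is at least [1 / 3]. *)
    destruct (Rle_dec (t - r) 1) as [H | H].
    - eapply Rle_trans.
      + apply (abs_RInt_le_const f1 0 r (Bq * Rpower X (- (q - 1))) H0).
        now apply ex_RInt_cts. intros s Hs. unfold f1.
        destruct (Rle_dec 1 (2 * s + (2 - (t + r)))) as [H1 | H1].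
        * eapply Rle_trans. apply (outgoing_bound K Bq (q - 1) (q * b) KB); lra.
          fold X. rewrite <- (Rmult_1_r (Bq * Rpower X _)) at 2.
          apply Rmult_le_compat_l. apply Rmult_le_pos; lra. apply Rpower_le_1; lra.
        * rewrite (outgoing_zero K Ks); try lra. rewrite Rabs_R0. apply Rmult_le_pos; lra.
      + rewrite EW.
        assert (/ 3 <= Rpower E (- (q * b))).
        { rewrite <- (Rpower_1 3) by lra. rewrite <- Rpower_Ropp.
          apply Rle_trans with (Rpower 3 (- (q * b))). apply Rle_Rpower; lra.
          apply Rpower_anti; unfold E in *; lra. }
        replace ((r - 0) * (Bq * Rpower X (- (q - 1)))) with (3 * Bq * r * (Rpower X (- (q - 1)) * / 3)) by field.
        apply Rmult_le_compat_l. apply Rmult_le_pos; lra. apply Rmult_le_compat_l; lra.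
    - rewrite RInt_zero; [ | exact H0 | ].
      + rewrite Rabs_R0. apply Rmult_le_pos. apply Rmult_le_pos; lra. lra.
      + intros s Hs. unfold f1. apply (outgoing_zero K Ks); lra. }
  assert (HC : Rabs (RInt f2 (t - r) t) <= 3 * Bq * r * W t r).
  { assert (HBq := Bq0). eapply Rle_trans.
    - apply (abs_RInt_le_const f2 (t - r) t (Bq * Rpower E (- (q * b)) * Rpower E (- (q - 1)))).
      lra. now apply ex_RInt_cts. intros s Hs. unfold f2.
      eapply Rle_trans. apply (incoming_bound K Bq (q - 1) (q * b) KB); lra. fold E.
      apply Rmult_le_compat_l. apply Rmult_le_pos; lra. apply Rpower_anti; unfold E in *; lra.
    - rewrite EW. replace (t - (t - r)) with r by ring.
      replace (r * (Bq * Rpower E (- (q * b)) * Rpower E (- (q - 1)))) with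
        (r * Bq * Rpower E (- (q * b)) * Rpower E (- (q - 1))) by ring.
      replace (3 * Bq * r * (Rpower X (- (q - 1)) * Rpower E (- (q * b)))) with
        (r * Bq * Rpower E (- (q * b)) * (3 * Rpower X (- (q - 1)))) by ring.
      apply Rmult_le_compat_l; [ | exact HXE1]. repeat apply Rmult_le_pos; lra. }
  rewrite HS. eapply Rle_trans. apply Rabs_triang.
  assert (HM := Rabs_minus_le (RInt f1 0 r) (RInt f2 (t - r) t)).
  rewrite 3 Rmult_plus_distr_r. lra.
Qed.

Lemma char_diff_bound (t r : R) : 0 <= t -> 0 <= r <= t + 1 ->
  Rabs (S t r) <= (6 * (/ (2 - q) + / (1 - q * b)) + 96 + (3 * (2 * q + 1) / (1 - q * b) + 6))
                  * Bq * r * W t r.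
Proof.
  intros Ht Hr.
  assert (I1 : 0 < / (2 - q)) by (apply Rinv_0_lt_compat; lra).
  assert (I2 : 0 < / (1 - q * b)) by (apply Rinv_0_lt_compat; lra).
  assert (I3 : 0 < 3 * (2 * q + 1) / (1 - q * b)) by (apply Rmult_lt_0_compat; lra).
  assert (HW := wt_pos (q - 1) (q * b) t r). fold (W t r) in HW. assert (HB0 := Bq0).
  assert (P : forall c1 c2, c1 <= c2 -> c1 * Bq * r * W t r <= c2 * Bq * r * W t r).
  { intros c1 c2 Hc. rewrite !Rmult_assoc. apply Rmult_le_compat_r; [ | exact Hc].
    apply Rmult_le_pos; [lra | apply Rmult_le_pos; lra]. }
  destruct (Rle_dec r (t / 2 + 1)).
  - destruct (Rle_dec r t).
    + eapply Rle_trans. apply char_diff_near; lra. apply P. lra.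
    + eapply Rle_trans. apply char_diff_tiny; lra. apply P. lra.
  - eapply Rle_trans. apply char_diff_far; lra. apply P. lra.
Qed.
End StrongBound.

(** * The fixed point *)

Lemma charint_minus (G1 G2 : R -> R -> R) (t x : R) :
  cont2 G1 -> cont2 G2 ->
  charint (fun s l => G1 s l - G2 s l) t x = charint G1 t x - charint G2 t x.
Proof.
  intros H1 H2. apply (RInt_minus (fun s => G1 s (x - s)) (fun s => G2 s (x - s)));
    apply ex_RInt_cts; intros; cts.
Qed.

Lemma avg_minus (Y1 Y2 : R -> R -> R) (t r : R) :
  cont2 Y1 -> cont2 Y2 ->
  avg (fun s l => Y1 s l - Y2 s l) t r = avg Y1 t r - avg Y2 t r.
Proof.
  intros H1 H2. unfold avg. rewrite <- Rmult_minus_distr_l. f_equal.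
  apply (RInt_minus (fun s => Y1 t (t + r * s)) (fun s => Y2 t (t + r * s)));
    apply ex_RInt_cts; intros; cts.
Qed.

Lemma avg_plus (Y1 Y2 : R -> R -> R) (t r : R) :
  cont2 Y1 -> cont2 Y2 ->
  avg (fun s l => Y1 s l + Y2 s l) t r = avg Y1 t r + avg Y2 t r.
Proof.
  intros H1 H2. unfold avg. rewrite <- Rmult_plus_distr_l. f_equal.
  apply (RInt_plus (fun s => Y1 t (t + r * s)) (fun s => Y2 t (t + r * s)));
    apply ex_RInt_cts; intros; cts.
Qed.

Lemma le_at_0_of_pos (f g : R -> R) (d : R) :
  continuous f 0 -> continuous g 0 -> 0 < d -> (forall r, 0 < r < d -> f r <= g r) -> f 0 <= g 0.
Proof.
  intros Hf Hg Hd H. apply Rnot_lt_le. intros Hlt.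
  assert (Hc : continuous (fun x => f x - g x) 0) by (now apply cts_minus).
  destruct (proj1 (filterlim_locally _ _) Hc (mkposreal (f 0 - g 0) ltac:(lra))) as [e He].
  set (r := Rmin (e / 2) (d / 2)).
  assert (Hr : 0 < r /\ r < e /\ r < d).
  { unfold r, Rmin. assert (0 < e) by apply cond_pos. destruct (Rle_dec (e / 2) (d / 2)); lra. }
  assert (Hb : ball 0 e r) by (change (Rabs (r - 0) < e); rewrite Rabs_pos_eq; lra).
  apply He in Hb. change (Rabs (f r - g r - (f 0 - g 0)) < f 0 - g 0) in Hb.
  apply Rabs_def2 in Hb. assert (H1 := H r ltac:(lra)). lra.
Qed.

Lemma Rpower_small (e x y : R) : 0 < e <= 1 -> y <= x -> Rpower e x <= Rpower e y.
Proof.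
  intros He Hxy. replace e with (/ / e) by (field; lra).
  assert (1 <= / e) by (rewrite <- Rinv_1; apply Rinv_le_contravar; lra).
  unfold Rpower. rewrite ln_Rinv by lra.
  replace (x * - ln (/ e)) with (- x * ln (/ e)) by ring.
  replace (y * - ln (/ e)) with (- y * ln (/ e)) by ring.
  apply (Rle_Rpower (/ e)); lra.
Qed.

Lemma geometric_limit (u : nat -> R) (c : R) :
  (forall n, Rabs (u (S n) - u n) <= c * (/ 2) ^ n) ->
  forall n, Rabs (real (Lim_seq u) - u n) <= 2 * c * (/ 2) ^ n.
Proof.
  intros Hu.
  (* Subtracting the term at [n + k] makes the telescoping induction on [k] close. *)
  assert (Hnk : forall n k, Rabs (u (n + k)%nat - u n) <= 2 * c * (/ 2) ^ n - 2 * c * (/ 2) ^ (n + k)).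
  { intros n k. induction k as [ | k IH].
    - rewrite Nat.add_0_r, 2 Rminus_diag, Rabs_R0. lra.
    - replace (n + S k)%nat with (S (n + k)) by lia. specialize (Hu (n + k)%nat).
      replace (u (S (n + k)) - u n) with ((u (S (n + k)) - u (n + k)%nat) + (u (n + k)%nat - u n)) by ring.
      eapply Rle_trans. apply Rabs_triang. simpl pow. lra. }
  assert (Hc : 0 <= c) by (specialize (Hu 0%nat); simpl in Hu; rewrite Rmult_1_r in Hu;
                           eapply Rle_trans; [apply Rabs_pos | exact Hu]).
  assert (Hb : forall n k, Rabs (u (n + k)%nat - u n) <= 2 * c * (/ 2) ^ n).
  { intros n k. assert (0 <= 2 * c * (/ 2) ^ (n + k)) by (apply Rmult_le_pos; [lra | apply pow_le; lra]).
    specialize (Hnk n k). lra. }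
  assert (Hex : ex_finite_lim_seq u).
  { apply ex_lim_seq_cauchy_corr. intros eps.
    assert (Hg : is_lim_seq (fun n => 2 * c * (/ 2) ^ n) 0).
    { replace (Finite 0) with (Rbar_mult (2 * c) 0) by (simpl; f_equal; ring).
      apply is_lim_seq_scal_l. apply is_lim_seq_geom. rewrite Rabs_pos_eq; lra. }
    apply is_lim_seq_spec in Hg. destruct (Hg (pos_div_2 eps)) as [N HN].
    exists N. intros n m Hn Hm.
    assert (HNN := HN N (le_n N)). rewrite Rminus_0_r in HNN. simpl in HNN.
    apply Rabs_def2 in HNN.
    replace n with (N + (n - N))%nat by lia. replace m with (N + (m - N))%nat by lia.
    replace (u (N + (n - N))%nat - u (N + (m - N))%nat) with
      ((u (N + (n - N))%nat - u N) - (u (N + (m - N))%nat - u N)) by ring.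
    eapply Rle_lt_trans. apply Rabs_minus_le.
    assert (H1 := Hb N (n - N)%nat). assert (H2 := Hb N (m - N)%nat). simpl in *. lra. }
  assert (Hb' : forall n k, Rabs (u (k + n)%nat - u n) <= 2 * c * (/ 2) ^ n)
    by (intros n k; rewrite (Nat.add_comm k n); apply Hb).
  intros n. destruct Hex as [l Hl]. rewrite (is_lim_seq_unique u l Hl). simpl.
  assert (Hl2 : is_lim_seq (fun k => Rabs (u (k + n)%nat - u n)) (Rabs (l - u n))).
  { apply (is_lim_seq_abs _ (Finite (l - u n))).
    apply is_lim_seq_minus'. now apply is_lim_seq_incr_n. apply is_lim_seq_const. }
  assert (Hle := is_lim_seq_le (fun k => Rabs (u (k + n)%nat - u n)) (fun _ => 2 * c * (/ 2) ^ n)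
    (Finite (Rabs (l - u n))) (Finite (2 * c * (/ 2) ^ n))
    (fun k => Hb' n k) Hl2 (is_lim_seq_const _)).
  exact Hle.
Qed.

Lemma geometric_small (c : R) (eps : posreal) : exists n, c * (/ 2) ^ n < eps.
Proof.
  assert (Hg : is_lim_seq (fun n => c * (/ 2) ^ n) 0).
  { replace (Finite 0) with (Rbar_mult c 0) by (simpl; f_equal; ring).
    apply is_lim_seq_scal_l. apply is_lim_seq_geom. rewrite Rabs_pos_eq; lra. }
  apply is_lim_seq_spec in Hg. destruct (Hg eps) as [N HN].
  exists N. specialize (HN N (le_n N)). rewrite Rminus_0_r in HN. apply Rabs_def2 in HN. lra.
Qed.

Lemma eq_of_geometric (x y c : R) : (forall n, Rabs (x - y) <= c * (/ 2) ^ n) -> x = y.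
Proof.
  intros H. destruct (Req_dec x y) as [E | E]; [exact E | exfalso].
  assert (Hp : 0 < Rabs (x - y)) by (apply Rabs_pos_lt; lra).
  destruct (geometric_small c (mkposreal _ Hp)) as [n Hn]. specialize (H n). simpl in Hn. lra.
Qed.

Lemma cont2_uniform_limit (f : nat -> R -> R -> R) (F : R -> R -> R) (c : R) :
  (forall n, cont2 (f n)) -> (forall n x y, Rabs (F x y - f n x y) <= c * (/ 2) ^ n) -> cont2 F.
Proof.
  intros Hf HF z. apply filterlim_locally. intros eps.
  destruct (geometric_small c (mkposreal (eps / 3) ltac:(assert (H := cond_pos eps); lra))) as [n Hn].
  simpl in Hn.
  assert (He : 0 < eps / 3) by (assert (H := cond_pos eps); lra).
  generalize (proj1 (filterlim_locally _ _) (Hf n z) (mkposreal _ He)).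
  apply filter_imp. intros w Hw.
  change (Rabs (f n (fst w) (snd w) - f n (fst z) (snd z)) < eps / 3) in Hw.
  change (Rabs (F (fst w) (snd w) - F (fst z) (snd z)) < eps).
  assert (H1 := HF n (fst w) (snd w)). assert (H2 := HF n (fst z) (snd z)).
  replace (F (fst w) (snd w) - F (fst z) (snd z)) with
    ((F (fst w) (snd w) - f n (fst w) (snd w)) + (f n (fst w) (snd w) - f n (fst z) (snd z))
      - (F (fst z) (snd z) - f n (fst z) (snd z))) by ring.
  eapply Rle_lt_trans. apply Rabs_minus_le.
  assert (H3 := Rabs_triang (F (fst w) (snd w) - f n (fst w) (snd w)) (f n (fst w) (snd w) - f n (fst z) (snd z))).
  lra.
Qed.

(** * The nonlinear map on sources *)

Section System.
Variables (p q b D : R) (kv ku ku' : R -> R).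
Hypothesis hq : 1 < q < 2.
Hypothesis hp : 2 < p < 3.
Hypothesis hb : 0 < b.
Hypothesis hbP : b <= p * (q - 1) - 2.
Hypothesis hqb : q * b < 1.
Hypothesis hpqb : 1 < p * (q * b).
Hypothesis D0 : 0 < D.
Hypothesis kvc : forall x, continuous kv x.
Hypothesis kvD : forall x, Rabs (kv x) <= D.
Hypothesis kvs : forall x, 1 < Rabs x -> kv x = 0.
Hypothesis kvi : forall x y, x <= -1 -> 1 <= y -> RInt kv x y = 0.
Hypothesis kud : forall x, is_derive ku x (ku' x).
Hypothesis ku'c : forall x, continuous ku' x.
Hypothesis kuD : forall x, Rabs (ku x) <= D.
Hypothesis ku'D : forall x, Rabs (ku' x) <= D.
Hypothesis kus : forall x, 1 < Rabs x -> ku x = 0.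

(* [kv] and [ku] encode the data: the free waves are [avg (fun _ => kv)] and [avg (fun _ => ku)].
   The unknown is [H s l = l * |u_t (s, l)| ^ p]. *)
Definition char_v (e : R) (H : R -> R -> R) (t x : R) : R := e * kv x + charint H t x.
Definition sol_v (e : R) (H : R -> R -> R) : R -> R -> R := avg (char_v e H).
Definition src_u (e : R) (H : R -> R -> R) (s l : R) : R := l * abspow q (sol_v e H s l).
Definition dsrc_u (e : R) (H : R -> R -> R) (s l : R) : R :=
  (1 - q) * abspow q (sol_v e H s l) +
  q * (sgnpow (q - 1) (sol_v e H s l) * (/ 2 * (char_v e H s (s + l) + char_v e H s (s - l)))).
Definition char_u (e : R) (H : R -> R -> R) (t x : R) : R := e * ku x + charint (src_u e H) t x.
(** An average of the [x]-derivative of [char_u], hence continuous at [r = 0]; [is_derive_sol_u]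
    identifies it with the time derivative of [u]. *)
Definition sol_ut (e : R) (H : R -> R -> R) : R -> R -> R :=
  avg (fun t x => e * ku' x + charint (dsrc_u e H) t x).
(* [Rmax t 0] freezes the unknown for negative times, so that all bounds are global in [t]. *)
Definition picard (e : R) (H : R -> R -> R) (t l : R) : R := l * abspow p (sol_ut e H (Rmax t 0) l).

(** The decay of [l |u_t|^p] when [u_t] has exponents [q - 1] and [q * b]; the factor [l], bounded
    by [xi], costs 1 in [al]. Both [al] and [ga] exceed 1, as [charint_fast] requires. *)
Let al : R := p * (q - 1) - 1.
Let ga : R := p * (q * b).

Record admissible (e : R) (H : R -> R -> R) : Prop := {
  admissible_cont : cont2 H;
  admissible_odd : forall s l, H s (- l) = - H s l;
  admissible_cone : in_cone H;
  admissible_dom : dominated H e al ga;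
  admissible_past : forall s l, s <= 0 -> H s l = H 0 l }.

Let al1 : 1 < al.
Proof. unfold al. lra. Qed.

Let kuc : forall x, continuous ku x.
Proof. exact (continuous_of_is_derive ku ku' kud). Qed.

Lemma cont2_char_v (e : R) (H : R -> R -> R) : cont2 H -> cont2 (char_v e H).
Proof. intros HH z. unfold char_v. assert (C := cont2_charint H HH). cts. Qed.

Lemma cont2_sol_v (e : R) (H : R -> R -> R) : cont2 H -> cont2 (sol_v e H).
Proof. intros HH. apply cont2_avg. now apply cont2_char_v. Qed.

Lemma cont2_src_u (e : R) (H : R -> R -> R) : cont2 H -> cont2 (src_u e H).
Proof.
  intros HH z. unfold src_u. assert (C := cont2_sol_v e H HH).
  assert (P := continuous_abspow q ltac:(lra)). cts.
Qed.

Lemma cont2_dsrc_u (e : R) (H : R -> R -> R) : cont2 H -> cont2 (dsrc_u e H).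
Proof.
  intros HH z. unfold dsrc_u. assert (C := cont2_sol_v e H HH). assert (C' := cont2_char_v e H HH).
  assert (P := continuous_abspow q ltac:(lra)). assert (P' := continuous_sgnpow (q - 1) ltac:(lra)). cts.
Qed.

Lemma cont2_char_u (e : R) (H : R -> R -> R) : cont2 H -> cont2 (char_u e H).
Proof. intros HH z. unfold char_u. assert (C := cont2_charint _ (cont2_src_u e H HH)). cts. Qed.

Let char_u' (e : R) (H : R -> R -> R) (t x : R) : R := e * ku' x + charint (dsrc_u e H) t x.

Let cont2_char_u' (e : R) (H : R -> R -> R) : cont2 H -> cont2 (char_u' e H).
Proof. intros HH z. unfold char_u'. assert (C := cont2_charint _ (cont2_dsrc_u e H HH)). cts. Qed.

Lemma cont2_sol_ut (e : R) (H : R -> R -> R) : cont2 H -> cont2 (sol_ut e H).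
Proof. intros HH. apply cont2_avg. exact (cont2_char_u' e H HH). Qed.

Lemma continuous_Rmax0 (x : R) : continuous (fun t => Rmax t 0) x.
Proof.
  apply (continuous_ext (fun t => / 2 * (t + Rabs t))).
  - intros t. unfold Rmax. destruct (Rle_dec t 0). rewrite Rabs_left1; lra. rewrite Rabs_pos_eq; lra.
  - cts.
Qed.

Lemma cont2_picard (e : R) (H : R -> R -> R) : cont2 H -> cont2 (picard e H).
Proof.
  intros HH z. unfold picard. assert (C := cont2_sol_ut e H HH). assert (P := continuous_abspow p ltac:(lra)).
  assert (M := continuous_Rmax0). cts. apply (cts_app (fun t => Rmax t 0)). exact M. cts.
Qed.

Lemma sol_v_even (e : R) (H : R -> R -> R) (t r : R) : cont2 H -> sol_v e H t (- r) = sol_v e H t r.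
Proof. intros HH. apply avg_even. apply cont2_section. now apply cont2_char_v. Qed.

Lemma sol_ut_even (e : R) (H : R -> R -> R) (t r : R) : cont2 H -> sol_ut e H t (- r) = sol_ut e H t r.
Proof. intros HH. apply avg_even. apply (cont2_section (char_u' e H)). now apply cont2_char_u'. Qed.

Lemma src_u_odd (e : R) (H : R -> R -> R) (s l : R) : cont2 H -> src_u e H s (- l) = - src_u e H s l.
Proof. intros HH. unfold src_u. rewrite sol_v_even by exact HH. ring. Qed.

Lemma is_derive_src_u (e : R) (H : R -> R -> R) (s l : R) :
  cont2 H -> is_derive (src_u e H s) l (dsrc_u e H s l).
Proof.
  intros HH. apply (is_derive_radial_power q (sol_v e H s)
    (fun l => / 2 * (char_v e H s (s + l) + char_v e H s (s - l)))).
  - lra.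
  - apply cont2_section. now apply cont2_sol_v.
  - intros x. apply (is_derive_avg (char_v e H)). apply cont2_section. now apply cont2_char_v.
Qed.

Let kue (e : R) (x : R) : is_derive (fun x => e * ku x) x (e * ku' x).
Proof.
  eapply is_derive_eq. apply (is_derive_mult_R (fun _ => e)). apply is_derive_const. apply kud.
  unfold zero; simpl; ring.
Qed.

Lemma sol_ut_diff (e : R) (H : R -> R -> R) (t r : R) :
  cont2 H -> 2 * r * sol_ut e H t r = char_u e H t (t + r) - char_u e H t (t - r).
Proof.
  intros HH. apply (avg_duhamel_diff (fun x => e * ku x) (src_u e H) (cont2_src_u e H HH)
    (fun x => e * ku' x) (dsrc_u e H) (kue e)).
  - intros; cts.
  - intros; now apply is_derive_src_u.
  - now apply cont2_dsrc_u.
Qed.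

Lemma is_derive_sol_u (e : R) (H : R -> R -> R) (t r : R) :
  cont2 H -> is_derive (fun t => avg (char_u e H) t r) t (sol_ut e H t r).
Proof.
  intros HH. apply (is_derive_avg_t (fun x => e * ku x) (src_u e H)) with (k' := fun x => e * ku' x) (h := dsrc_u e H).
  - intros; cts.
  - now apply cont2_src_u.
  - intros; now apply src_u_odd.
  - apply kue.
  - intros; cts.
  - intros; now apply is_derive_src_u.
  - now apply cont2_dsrc_u.
Qed.

(** In order, the constants in the bounds for characteristic integrals of [H], for [char_v], for
    [v], in [char_diff_bound], and for [u_t]. The factor [3 ^ (1 + b)] pays for the data, which live
    where [x + 2 <= 3]; [15 * D] is half of the [30 * D] in [ku_diff_bound]. *)
Let ch : R := / (al - 1) + / (ga - 1).
Let cY : R := D * Rpower 3 (1 + b) + ch.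
Let cv : R := (3 + 3 / b) * cY.
Let cS : R := 6 * (/ (2 - q) + / (1 - q * b)) + 96 + (3 * (2 * q + 1) / (1 - q * b) + 6).
Let cz : R := 15 * D + / 2 * cS * Rpower cv q.

Let ch0 : 0 < ch.
Proof. apply Rplus_lt_0_compat; apply Rinv_0_lt_compat; unfold ga; lra. Qed.

Let cY0 : 0 < cY.
Proof.
  assert (H := Rpower_pos 3 (1 + b)). unfold cY. apply Rplus_lt_0_compat.
  now apply Rmult_lt_0_compat. exact ch0.
Qed.

Let cYv : cY <= cv /\ 0 < cv.
Proof.
  assert (0 < 3 / b) by (apply Rdiv_lt_0_compat; lra). assert (H1 := cY0). unfold cv.
  split; nra.
Qed.

Let cS0 : 0 < cS.
Proof.
  assert (I1 : 0 < / (2 - q)) by (apply Rinv_0_lt_compat; lra).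
  assert (I2 : 0 < / (1 - q * b)) by (apply Rinv_0_lt_compat; lra).
  assert (I3 : 0 < 3 * (2 * q + 1) / (1 - q * b)) by (apply Rmult_lt_0_compat; lra).
  unfold cS. lra.
Qed.

Let cz0 : 0 < cz.
Proof.
  assert (H := Rpower_pos cv q). assert (H1 := cS0). unfold cz.
  assert (0 < cS * Rpower cv q) by now apply Rmult_lt_0_compat. lra.
Qed.

(** * Bounds for [v] and [u_t] in terms of the source *)

Section Bounds.
Variables (e : R) (H : R -> R -> R).
Hypothesis e0 : 0 < e.
Hypothesis e1 : e <= 1.
Hypothesis gH : admissible e H.

Let Hc : cont2 H := admissible_cont e H gH.

(** The place where [b <= p * (q - 1) - 2] acts: it says [1 + b <= al]. *)
Lemma charint_admissible_bound (G : R -> R -> R) (N t x : R) :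
  cont2 G -> in_cone G -> dominated G N al ga -> 0 <= N -> 0 <= t -> -1 <= x ->
  Rabs (charint G t x) <= ch * N * Rpower (x + 2) (- (1 + b)).
Proof.
  intros Gc Gs GN HN Ht Hx.
  eapply Rle_trans. apply (charint_fast G N al ga); try assumption; unfold ga; lra.
  apply Rmult_le_compat_l. apply Rmult_le_pos. apply Rlt_le, ch0. exact HN.
  apply Rle_Rpower. lra. unfold al. lra.
Qed.

Lemma char_v_bound (t x : R) : 0 <= t -> -1 <= x ->
  Rabs (char_v e H t x) <= cY * e * Rpower (x + 2) (- (1 + b)).
Proof.
  intros Ht Hx. unfold char_v. eapply Rle_trans. apply Rabs_triang.
  assert (H1 := charint_admissible_bound H e t x Hc (admissible_cone e H gH) (admissible_dom e H gH) ltac:(lra) Ht Hx).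
  assert (H2 : Rabs (e * kv x) <= D * Rpower 3 (1 + b) * e * Rpower (x + 2) (- (1 + b))).
  { rewrite Rabs_mult, (Rabs_pos_eq e) by lra.
    assert (P3 := Rpower_pos 3 (1 + b)). assert (Px := Rpower_pos (x + 2) (- (1 + b))).
    destruct (Rle_dec (Rabs x) 1) as [Hx1 | Hx1].
    - apply Rabs_le_between in Hx1.
      assert (E : 1 <= Rpower 3 (1 + b) * Rpower (x + 2) (- (1 + b))).
      { apply Rle_trans with (Rpower 3 (1 + b) * Rpower 3 (- (1 + b))).
        - rewrite <- Rpower_plus. replace (1 + b + - (1 + b)) with 0 by ring. rewrite Rpower_O; lra.
        - apply Rmult_le_compat_l. lra. apply Rpower_anti; lra. }
      replace (D * Rpower 3 (1 + b) * e * Rpower (x + 2) (- (1 + b))) with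
        (e * (D * (Rpower 3 (1 + b) * Rpower (x + 2) (- (1 + b))))) by ring.
      apply Rmult_le_compat_l. lra. apply Rle_trans with (D * 1). rewrite Rmult_1_r; apply kvD.
      apply Rmult_le_compat_l; lra.
    - rewrite kvs by lra. rewrite Rabs_R0, Rmult_0_r. repeat apply Rmult_le_pos; lra. }
  unfold cY. rewrite 2 Rmult_plus_distr_r. lra.
Qed.

(** [charint G] need not vanish on the interval averaged over. For each source time, however, that
    interval, moved back by [s], contains the support of [G s], and oddness cancels the two
    halves. *)
Lemma avg_charint_cone (G : R -> R -> R) (t r : R) :
  cont2 G -> (forall s l, G s (- l) = - G s l) -> in_cone G ->
  0 <= t -> t + 1 < Rabs r -> avg (charint G) t r = 0.
Proof.
  intros Gc Go Gs Ht Hr.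
  assert (Hm : forall r, t + 1 < r -> avg (charint G) t r = 0).
  { intros r' Hr'. rewrite avg_charint by exact Gc. apply RInt_zero. exact Ht. intros s Hs.
    rewrite (RInt_ext (fun sg => G s (t - s + r' * sg)) (fun sg => G s (r' * sg + (t - s))))
      by (intros; f_equal; ring).
    apply (Rmult_eq_reg_l r'); [ | lra].
    transitivity (/ 2 * (r' * RInt (fun sg => G s (r' * sg + (t - s))) (-1) 1)); [ring | ].
    rewrite (RInt_lin (G s) r' (t - s)) by (intros; cts).
    rewrite (RInt_odd_supp (G s) _ _ (s + 1)); try lra.
    - intros; cts.
    - intros; apply Go.
    - intros x Hx. apply Gs; lra. }
  destruct (Rle_dec 0 r).
  - apply Hm. rewrite Rabs_pos_eq in Hr; lra.
  - rewrite <- (Ropp_involutive r), avg_even. apply Hm. rewrite Rabs_left in Hr; lra.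
    apply cont2_section. now apply cont2_charint.
Qed.

Lemma sol_v_cone : in_cone (sol_v e H).
Proof.
  intros t r Ht Hr. unfold sol_v, char_v.
  rewrite (avg_plus (fun t x => e * kv x) (charint H)).
  - rewrite avg_charint_cone; try assumption; try apply gH. rewrite Rplus_0_r.
    (* For the data the corresponding cancellation is the hypothesis [kvi] that [kv] has integral
       zero. *)
    assert (Hm : forall r, t + 1 < r -> avg (fun _ x => e * kv x) t r = 0).
    { intros r' Hr'. apply (Rmult_eq_reg_l r'); [ | lra].
      rewrite (avg_line (fun _ x => e * kv x)) by (intros; cts).
      rewrite RInt_multl by now apply ex_RInt_cts. rewrite kvi by lra. ring. }
    destruct (Rle_dec 0 r).
    + apply Hm. rewrite Rabs_pos_eq in Hr; lra.
    + rewrite <- (Ropp_involutive r), avg_even. apply Hm. rewrite Rabs_left in Hr; lra.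
      intros; cts.
  - intros z; cts.
  - now apply cont2_charint.
Qed.

Lemma sol_v_dom : dominated (sol_v e H) (cv * e) 1 b.
Proof.
  unfold cv. rewrite Rmult_assoc. apply avg_bound.
  - exact hb.
  - apply Rmult_le_pos. apply Rlt_le, cY0. lra.
  - now apply cont2_char_v.
  - intros. now apply char_v_bound.
Qed.

Let cve : 0 < cv * e.
Proof. apply Rmult_lt_0_compat. apply cYv. exact e0. Qed.

(** The mean value theorem along an outgoing ray, where [char_v] is evaluated only at arguments
    [s + l + 2 * c >= s + l], so the decay at the start of the ray bounds it. *)
Lemma sol_v_increment (s l d : R) : 0 <= s -> 0 <= l <= s + 1 -> 0 <= d ->
  Rabs ((l + d) * sol_v e H (s + d) (l + d) - l * sol_v e H s l) <=
  d * (cv * e * Rpower (s + l + 2) (- (1 + b))).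
Proof.
  intros Hs Hl Hd.
  set (F := fun d => (l + d) * sol_v e H (s + d) (l + d)).
  assert (HF : forall x, is_derive F x (char_v e H (s + x) (s + l + 2 * x))).
  { intros x. apply (is_derive_duhamel_diag (fun x => e * kv x) H); try assumption.
    intros; cts. apply gH. }
  destruct (MVT_gen F 0 d (fun x => char_v e H (s + x) (s + l + 2 * x))) as [c [Hc' E]].
  - intros; apply HF.
  - intros x _. apply continuity_pt_filterlim. exact (continuous_of_is_derive F _ HF x).
  - rewrite Rmin_left, Rmax_right in Hc' by lra.
    replace (l * sol_v e H s l) with (F 0) by (unfold F; now rewrite 2 Rplus_0_r).
    change (Rabs (F d - F 0) <= d * (cv * e * Rpower (s + l + 2) (- (1 + b)))).
    rewrite E, Rabs_mult, (Rabs_pos_eq (d - 0)), Rminus_0_r, Rmult_comm by lra.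
    apply Rmult_le_compat_l. exact Hd.
    eapply Rle_trans. apply char_v_bound; lra. assert (HY := cYv).
    apply Rmult_le_compat. apply Rmult_le_pos; [apply Rlt_le, cY0 | lra].
    apply Rlt_le, Rpower_pos. apply Rmult_le_compat_r; lra.
    apply Rpower_anti; lra.
Qed.

Lemma src_u_cone : in_cone (src_u e H).
Proof. apply (in_cone_mult_abspow (sol_v e H)). exact sol_v_cone. Qed.

(** If [t - r > 1] both terms vanish. Otherwise [eta <= 3]. For [r <= 1] also [xi <= 5], and the
    mean value theorem supplies the factor [r]; for [r > 1] one has [xi <= 5 r], and the size of
    [ku] suffices. *)
Lemma ku_diff_bound (t r : R) : 0 <= t -> 0 < r <= t + 1 ->
  Rabs (ku (t + r) - ku (t - r)) <= 30 * D * r * wt (q - 1) (q * b) t r.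
Proof.
  intros Ht Hr.
  assert (HW := wt_lower (q - 1) (q * b) t r ltac:(lra) ltac:(lra) Ht).
  rewrite (Rabs_pos_eq r) in HW by lra. specialize (HW ltac:(lra)).
  unfold xi, eta in HW. rewrite (Rabs_pos_eq r) in HW by lra.
  assert (W0 := wt_pos (q - 1) (q * b) t r).
  set (W := wt (q - 1) (q * b) t r) in *. clearbody W.
  destruct (Rlt_dec 1 (t - r)) as [H1 | H1].
  - rewrite 2 kus. rewrite Rminus_0_r, Rabs_R0. repeat apply Rmult_le_pos; lra.
    rewrite Rabs_pos_eq; lra. rewrite Rabs_pos_eq; lra.
  - assert (I3 : / 3 <= / (t - r + 2)) by (apply Rinv_le_contravar; lra).
    destruct (Rle_dec r 1) as [H2 | H2].
    + assert (I5 : / 5 <= / (t + r + 2)) by (apply Rinv_le_contravar; lra).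
      assert (HW' : / 5 * / 3 <= W).
      { eapply Rle_trans; [ | exact HW]. apply Rmult_le_compat; lra. }
      assert (Hd : Rabs (ku (t + r) - ku (t - r)) <= 2 * r * D).
      { destruct (MVT_gen ku (t - r) (t + r) ku') as [c [_ E]].
        - intros; apply kud.
        - intros; apply continuity_pt_filterlim; apply kuc.
        - rewrite E, Rabs_mult. replace (t + r - (t - r)) with (2 * r) by ring.
          rewrite (Rabs_pos_eq (2 * r)), Rmult_comm by lra. apply Rmult_le_compat_l. lra. apply ku'D. }
      eapply Rle_trans. exact Hd.
      replace (30 * D * r * W) with (2 * r * D * (15 * W)) by ring.
      rewrite <- (Rmult_1_r (2 * r * D)) at 1. apply Rmult_le_compat_l.
      repeat apply Rmult_le_pos; lra. lra.
    + assert (I5 : / (5 * r) <= / (t + r + 2)) by (apply Rinv_le_contravar; lra).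
      assert (Ir : 0 < / (5 * r)) by (apply Rinv_0_lt_compat; lra).
      assert (HW' : / (5 * r) * / 3 <= W).
      { eapply Rle_trans; [ | exact HW]. apply Rmult_le_compat; lra. }
      assert (Hd : Rabs (ku (t + r) - ku (t - r)) <= 2 * D).
      { eapply Rle_trans. apply Rabs_minus_le. assert (A1 := kuD (t + r)). assert (A2 := kuD (t - r)). lra. }
      eapply Rle_trans. exact Hd.
      apply Rle_trans with (30 * D * r * (/ (5 * r) * / 3)). right. field. lra.
      apply Rmult_le_compat_l; [ | exact HW']. repeat apply Rmult_le_pos; lra.
Qed.

(** Only the endpoints [t - r] and [t + r] matter; they lie outside [[-1, 2 * t + 1]], where the
    characteristics miss the cone and the data vanish. *)
Lemma sol_ut_cone : in_cone (sol_ut e H).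
Proof.
  intros t r Ht Hr.
  assert (Hr0 : r <> 0) by (intros E; rewrite E, Rabs_R0 in Hr; lra).
  apply (Rmult_eq_reg_l (2 * r)); [ | lra]. rewrite Rmult_0_r, sol_ut_diff by exact Hc.
  assert (HX : forall x, x < -1 \/ 2 * t + 1 < x -> char_u e H t x = 0).
  { intros x [Hx | Hx]; unfold char_u.
    - rewrite (charint_left _ src_u_cone) by assumption. rewrite kus. ring. rewrite Rabs_left; lra.
    - rewrite (charint_right _ src_u_cone) by assumption. rewrite kus. ring. rewrite Rabs_pos_eq; lra. }
  unfold Rabs in Hr. destruct (Rcase_abs r).
  - rewrite 2 HX by lra. ring.
  - rewrite 2 HX by lra. ring.
Qed.

Lemma sol_ut_dom : dominated (sol_ut e H) (cz * e) (q - 1) (q * b).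
Proof.
  intros t r0 Ht Hr0.
  assert (Hpos : forall r, 0 < r <= t + 1 -> Rabs (sol_ut e H t r) <= cz * e * wt (q - 1) (q * b) t r).
  { intros r Hr. assert (W0 := wt_pos (q - 1) (q * b) t r).
    set (W := wt (q - 1) (q * b) t r) in *.
    apply (Rmult_le_reg_l (2 * r)). lra.
    rewrite <- (Rabs_pos_eq (2 * r)) at 1 by lra. rewrite <- Rabs_mult, sol_ut_diff by exact Hc.
    unfold char_u.
    replace (e * ku (t + r) + charint (src_u e H) t (t + r) - (e * ku (t - r) + charint (src_u e H) t (t - r)))
      with (e * (ku (t + r) - ku (t - r)) + (charint (src_u e H) t (t + r) - charint (src_u e H) t (t - r))) by ring.
    eapply Rle_trans. apply Rabs_triang. rewrite Rabs_mult, (Rabs_pos_eq e) by lra.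
    assert (H1 := ku_diff_bound t r Ht Hr). fold W in H1.
    assert (H2 := char_diff_bound q b (cv * e) (sol_v e H) hq hb hqb cve (cont2_sol_v e H Hc)
       sol_v_cone sol_v_dom sol_v_increment t r Ht ltac:(lra)).
    fold cS in H2. fold W in H2.
    assert (H3 : Rpower (cv * e) q <= Rpower cv q * e).
    { rewrite Rpower_mult_base by (assumption || apply cYv). apply Rmult_le_compat_l.
      apply Rlt_le, Rpower_pos. rewrite <- (Rpower_1 e) at 2 by exact e0.
      apply Rpower_small; lra. }
    assert (H4 : cS * Rpower (cv * e) q * r * W <= cS * (Rpower cv q * e) * r * W).
    { apply Rmult_le_compat_r. lra. apply Rmult_le_compat_r. lra.
      apply Rmult_le_compat_l. apply Rlt_le, cS0. exact H3. }
    assert (H5 : e * Rabs (ku (t + r) - ku (t - r)) <= e * (30 * D * r * W))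
      by (apply Rmult_le_compat_l; lra).
    change (fun s l => l * abspow q (sol_v e H s l)) with (src_u e H) in H2. cbv beta in H2. fold W in H2.
    apply Rle_trans with (e * (30 * D * r * W) + cS * (Rpower cv q * e) * r * W). lra.
    right. unfold cz. field. }
  (* The identity for [2 r u_t] says nothing at [r = 0]; there the bound follows by continuity. *)
  assert (Hnn : forall r, 0 <= r <= t + 1 -> Rabs (sol_ut e H t r) <= cz * e * wt (q - 1) (q * b) t r).
  { intros r Hr. destruct (Req_dec r 0) as [E | E]; [ | apply Hpos; lra]. subst r.
    apply (le_at_0_of_pos (fun r => Rabs (sol_ut e H t r)) (fun r => cz * e * wt (q - 1) (q * b) t r) 1).
    - assert (C := cont2_sol_ut e H Hc). cts.
    - apply cts_mult. apply continuous_const. unfold wt, xi, eta.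
      assert (HR : forall (g : R -> R) c, (forall x, continuous g x) -> 0 < g 0 ->
               continuous (fun x => Rpower (g x) c) 0).
      { intros g c Hg Hg0. apply (continuous_comp g (fun x => Rpower x c)). apply Hg.
        apply (ex_derive_continuous (fun x => Rpower x c)). eexists.
        apply is_derive_Reals. now apply derivable_pt_lim_power. }
      apply cts_mult; apply HR; try (intros; cts); rewrite Rabs_R0; lra.
    - lra.
    - intros r Hr'. apply Hpos. lra. }
  destruct (Rle_dec 0 r0).
  - apply Hnn. rewrite Rabs_pos_eq in Hr0; lra.
  - rewrite <- (Ropp_involutive r0), sol_ut_even, wt_even by exact Hc. apply Hnn.
    rewrite Rabs_left in Hr0; lra.
Qed.
End Bounds.

Lemma picard_admissible (e : R) (H : R -> R -> R) :
  0 < e -> e <= 1 -> Rpower cz p * e <= 1 -> admissible e H -> admissible e (picard e H).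
Proof.
  intros e0 e1 e2 gH. assert (Hc := admissible_cont e H gH).
  assert (Hmax : forall s, 0 <= s -> Rmax s 0 = s) by (intros; now apply Rmax_left).
  split.
  - now apply cont2_picard.
  - intros s l. unfold picard. rewrite sol_ut_even by exact Hc. ring.
  - intros s l Hs Hl. unfold picard. rewrite Hmax by exact Hs.
    exact (in_cone_mult_abspow _ p (sol_ut_cone e H gH) s l Hs Hl).
  - intros s l Hs Hl. unfold picard. rewrite Hmax by exact Hs.
    assert (cze : 0 < cz * e) by (apply Rmult_lt_0_compat; [exact cz0 | exact e0]).
    eapply Rle_trans.
    + apply (dominated_mult_abspow (sol_ut e H) (cz * e) (q - 1) (q * b) p cze); try lra; try assumption.
      now apply sol_ut_dom.
    + apply Rmult_le_compat_r. apply Rlt_le, wt_pos.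
      rewrite Rpower_mult_base by (exact cz0 || exact e0).
      (* [p > 2] yields two powers of [e]: one absorbs [Rpower cz p], the other is the radius of the
         ball. *)
      assert (HR : Rpower e p <= e * e).
      { replace (e * e) with (Rpower e 2).
        - apply Rpower_small; lra.
        - replace 2 with (1 + 1) by ring. rewrite Rpower_plus, Rpower_1 by exact e0. reflexivity. }
      apply Rle_trans with (Rpower cz p * (e * e)).
      * apply Rmult_le_compat_l. apply Rlt_le, Rpower_pos. exact HR.
      * assert (Rpower cz p * e * e <= 1 * e) by (apply Rmult_le_compat_r; lra). lra.
  - intros s l Hs. unfold picard. rewrite (Rmax_right s 0), (Rmax_right 0 0) by lra. reflexivity.
Qed.

Let c0 : R := / (2 - q) + / (1 - q * b).
Let cC : R := p * Rpower cz (p - 1) * (c0 * (q * Rpower cv (q - 1) * ((3 + 3 / b) * ch))).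

Let c00 : 0 < c0.
Proof. apply Rplus_lt_0_compat; apply Rinv_0_lt_compat; lra. Qed.

Let b3 : 0 < 3 + 3 / b.
Proof. assert (0 < 3 / b) by (apply Rdiv_lt_0_compat; lra). lra. Qed.

(** The factor [l] of [picard] supplies the [r] in [r |u_t - u_t'|], so [charint_slow] suffices and
    no gain near the axis is needed. Smallness comes from [|u_t|^(p - 1)], which carries a factor
    [e]. The exponents close up because [(p - 1) * (q - 1) + (q - 1) - 1 = al]. *)
Lemma picard_contraction (e d : R) (H1 H2 : R -> R -> R) :
  0 < e -> e <= 1 -> admissible e H1 -> admissible e H2 -> 0 <= d ->
  dominated (fun s l => H1 s l - H2 s l) d al ga ->
  dominated (fun s l => picard e H1 s l - picard e H2 s l) (cC * e * d) al ga.
Proof.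
  intros e0 e1 g1 g2 Hd HdH.
  assert (C1 := admissible_cont e H1 g1). assert (C2 := admissible_cont e H2 g2).
  assert (HC : cont2 (fun s l => H1 s l - H2 s l)) by (intros z; cts).
  assert (HS : in_cone (fun s l => H1 s l - H2 s l)).
  { intros s l Hs Hl. rewrite (admissible_cone e H1 g1), (admissible_cone e H2 g2) by assumption. ring. }
  assert (CV1 := cont2_sol_v e H1 C1). assert (CV2 := cont2_sol_v e H2 C2).
  assert (CY1 := cont2_char_v e H1 C1). assert (CY2 := cont2_char_v e H2 C2).
  set (dv := (3 + 3 / b) * (ch * d)).
  assert (Hdv : 0 <= dv).
  { unfold dv. apply Rmult_le_pos. apply Rlt_le, b3. apply Rmult_le_pos. apply Rlt_le, ch0. exact Hd. }
  assert (HV : dominated (fun s l => sol_v e H1 s l - sol_v e H2 s l) dv 1 b).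
  { intros s l Hs Hl. unfold sol_v. rewrite <- avg_minus by assumption.
    apply avg_bound; try assumption.
    - apply Rmult_le_pos. apply Rlt_le, ch0. exact Hd.
    - intros z; cts.
    - intros t x Ht Hx. unfold char_v.
      replace (e * kv x + charint H1 t x - (e * kv x + charint H2 t x)) with (charint H1 t x - charint H2 t x) by ring.
      rewrite <- charint_minus by assumption. now apply charint_admissible_bound. }
  assert (cve : 0 < cv * e) by (apply Rmult_lt_0_compat; [apply cYv | exact e0]).
  assert (cze : 0 < cz * e) by (apply Rmult_lt_0_compat; [exact cz0 | exact e0]).
  set (AK := q * Rpower cv (q - 1) * dv).
  assert (Pcv := Rpower_pos cv (q - 1)).
  assert (HAK : 0 <= AK).
  { unfold AK. apply Rmult_le_pos; [ | exact Hdv]. apply Rmult_le_pos; lra. }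
  assert (HK : dominated (fun s l => src_u e H1 s l - src_u e H2 s l) AK (q - 1) (q * b)).
  { intros s l Hs Hl. unfold src_u. rewrite <- Rmult_minus_distr_l, Rabs_mult.
    assert (Hm : 0 < cv * e * wt 1 b s l) by (apply Rmult_lt_0_compat; [exact cve | apply wt_pos]).
    assert (HL := abspow_lipschitz q (sol_v e H1 s l) (sol_v e H2 s l) _ ltac:(lra) Hm
      (sol_v_dom e H1 e0 g1 s l Hs Hl) (sol_v_dom e H2 e0 g2 s l Hs Hl)).
    rewrite wt_power in HL by exact cve. specialize (HV s l Hs Hl).
    assert (Hpow : Rpower (cv * e) (q - 1) <= Rpower cv (q - 1)).
    { rewrite Rpower_mult_base by (apply cYv || exact e0). rewrite <- (Rmult_1_r (Rpower cv _)) at 2.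
      apply Rmult_le_compat_l. lra. apply Rle_trans with (Rpower e 0); [apply Rpower_small; lra | rewrite Rpower_O; lra]. }
    assert (W1 := wt_pos ((q - 1) * 1) ((q - 1) * b) s l). assert (W2 := wt_pos 1 b s l).
    assert (HL2 : Rabs (abspow q (sol_v e H1 s l) - abspow q (sol_v e H2 s l)) <=
       q * (Rpower cv (q - 1) * wt ((q - 1) * 1) ((q - 1) * b) s l) * (dv * wt 1 b s l)).
    { eapply Rle_trans. exact HL. apply Rmult_le_compat.
      - apply Rmult_le_pos. lra. apply Rmult_le_pos. apply Rlt_le, Rpower_pos. lra.
      - apply Rabs_pos.
      - apply Rmult_le_compat_l. lra. apply Rmult_le_compat_r; lra.
      - exact HV. }
    apply Rle_trans with (xi s l * (q * (Rpower cv (q - 1) * wt ((q - 1) * 1) ((q - 1) * b) s l) * (dv * wt 1 b s l))).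
    - apply Rmult_le_compat; try apply Rabs_pos. now apply Rabs_le_xi. exact HL2.
    - right. unfold AK.
      transitivity (q * Rpower cv (q - 1) * dv * (xi s l * (wt ((q - 1) * 1) ((q - 1) * b) s l * wt 1 b s l))).
      ring. rewrite wt_mult, wt_xi by exact Hs. f_equal. f_equal; ring. }
  assert (CK : cont2 (fun s l => src_u e H1 s l - src_u e H2 s l)).
  { assert (K1 := cont2_src_u e H1 C1). assert (K2 := cont2_src_u e H2 C2). intros z; cts. }
  assert (KS : in_cone (fun s l => src_u e H1 s l - src_u e H2 s l)).
  { intros s l Hs Hl. rewrite (src_u_cone e H1 g1), (src_u_cone e H2 g2) by assumption. ring. }
  assert (HZ : forall t r, 0 <= t -> Rabs r <= t + 1 ->
     Rabs r * Rabs (sol_ut e H1 t r - sol_ut e H2 t r) <= c0 * AK * (xi t r * wt (q - 1) (q * b) t r)).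
  { assert (HZ0 : forall t r, 0 <= t -> 0 <= r <= t + 1 ->
      Rabs r * Rabs (sol_ut e H1 t r - sol_ut e H2 t r) <= c0 * AK * (xi t r * wt (q - 1) (q * b) t r)).
    { intros t r Ht Hr. rewrite <- Rabs_mult.
      destruct (charint_slow _ AK (q - 1) (q * b) CK HK KS HAK t r ltac:(lra) ltac:(lra) Ht Hr) as [B1 B2].
      rewrite charint_minus in B1, B2 by now apply cont2_src_u.
      replace (1 - (q - 1)) with (2 - q) in * by ring. fold c0 in B1, B2.
      replace (r * (sol_ut e H1 t r - sol_ut e H2 t r)) with
        (/ 2 * ((charint (src_u e H1) t (t + r) - charint (src_u e H2) t (t + r))
              - (charint (src_u e H1) t (t - r) - charint (src_u e H2) t (t - r)))).
      - rewrite Rabs_mult, (Rabs_pos_eq (/ 2)) by lra.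
        assert (HM := Rabs_minus_le (charint (src_u e H1) t (t + r) - charint (src_u e H2) t (t + r))
                (charint (src_u e H1) t (t - r) - charint (src_u e H2) t (t - r))). lra.
      - assert (Z1 := sol_ut_diff e H1 t r C1). assert (Z2 := sol_ut_diff e H2 t r C2). unfold char_u in Z1, Z2. lra. }
    intros t r Ht Hr. destruct (Rle_dec 0 r).
    - apply HZ0. exact Ht. rewrite Rabs_pos_eq in Hr; lra.
    - rewrite <- (Ropp_involutive r), (sol_ut_even e H1 t (- r) C1), (sol_ut_even e H2 t (- r) C2), wt_even.
      rewrite Rabs_Ropp. replace (xi t (- - r)) with (xi t (- r)) by (unfold xi; now rewrite !Rabs_Ropp).
      apply HZ0. exact Ht. rewrite Rabs_left in Hr; lra. }
  intros s l Hs Hl. unfold picard. rewrite Rmax_left by exact Hs.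
  rewrite <- Rmult_minus_distr_l, Rabs_mult.
  assert (Hm : 0 < cz * e * wt (q - 1) (q * b) s l) by (apply Rmult_lt_0_compat; [exact cze | apply wt_pos]).
  assert (HL := abspow_lipschitz p (sol_ut e H1 s l) (sol_ut e H2 s l) _ ltac:(lra) Hm
    (sol_ut_dom e H1 e0 e1 g1 s l Hs Hl) (sol_ut_dom e H2 e0 e1 g2 s l Hs Hl)).
  rewrite wt_power in HL by exact cze. specialize (HZ s l Hs Hl).
  assert (Hpow : Rpower (cz * e) (p - 1) <= Rpower cz (p - 1) * e).
  { rewrite Rpower_mult_base by (exact cz0 || exact e0). apply Rmult_le_compat_l.
    apply Rlt_le, Rpower_pos. rewrite <- (Rpower_1 e) at 2 by exact e0. apply Rpower_small; lra. }
  set (w1 := wt ((p - 1) * (q - 1)) ((p - 1) * (q * b)) s l) in *.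
  assert (W1 : 0 < w1) by apply wt_pos.
  assert (Pcz := Rpower_pos cz (p - 1)).
  apply Rle_trans with (p * (Rpower cz (p - 1) * e * w1) * (Rabs l * Rabs (sol_ut e H1 s l - sol_ut e H2 s l))).
  - apply Rle_trans with (Rabs l * (p * (Rpower (cz * e) (p - 1) * w1) * Rabs (sol_ut e H1 s l - sol_ut e H2 s l))).
    + apply Rmult_le_compat_l. apply Rabs_pos. exact HL.
    + rewrite <- (Rmult_assoc (Rabs l)), (Rmult_comm (Rabs l)), Rmult_assoc.
      apply Rmult_le_compat_r. apply Rmult_le_pos; apply Rabs_pos.
      apply Rmult_le_compat_l. lra. apply Rmult_le_compat_r; lra.
  - apply Rle_trans with (p * (Rpower cz (p - 1) * e * w1) * (c0 * AK * (xi s l * wt (q - 1) (q * b) s l))).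
    + apply Rmult_le_compat_l. 2: exact HZ.
      apply Rmult_le_pos. lra. apply Rmult_le_pos. apply Rmult_le_pos; lra. lra.
    + right. unfold cC, AK, dv.
      transitivity (p * Rpower cz (p - 1) * (c0 * (q * Rpower cv (q - 1) * ((3 + 3 / b) * ch))) * e * d
          * (xi s l * (w1 * wt (q - 1) (q * b) s l))). ring.
      unfold w1. rewrite wt_mult, wt_xi by exact Hs. f_equal. unfold al, ga. f_equal; ring.
Qed.

Let cC0 : 0 < cC.
Proof.
  unfold cC. apply Rmult_lt_0_compat. apply Rmult_lt_0_compat. lra. apply Rpower_pos.
  apply Rmult_lt_0_compat. exact c00. apply Rmult_lt_0_compat. apply Rmult_lt_0_compat. lra.
  apply Rpower_pos. apply Rmult_lt_0_compat. exact b3. exact ch0.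
Qed.

Fixpoint picard_iterate (e : R) (n : nat) : R -> R -> R :=
  match n with O => fun _ _ => 0 | S n => picard e (picard_iterate e n) end.

Lemma exists_fixpoint :
  exists eps0, 0 < eps0 /\ forall e, 0 < e < eps0 ->
    exists H, admissible e H /\ forall t l, 0 <= t -> H t l = l * abspow p (sol_ut e H t l).
Proof.
  assert (Pz := Rpower_pos cz p). assert (C0 := cC0).
  (* The entries give [e <= 1], invariance of the ball, and contraction with ratio [1 / 2]. *)
  exists (Rmin 1 (Rmin (/ Rpower cz p) (/ (2 * cC)))). split.
  { repeat apply Rmin_glb_lt. lra. now apply Rinv_0_lt_compat. apply Rinv_0_lt_compat. lra. }
  intros e [e0 He].
  assert (e1 : e <= 1) by (eapply Rlt_le, Rlt_le_trans; [exact He | apply Rmin_l]).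
  assert (e2 : Rpower cz p * e <= 1).
  { apply Rmult_le_reg_l with (/ Rpower cz p). now apply Rinv_0_lt_compat.
    rewrite <- Rmult_assoc, Rinv_l, Rmult_1_l, Rmult_1_r by lra.
    eapply Rlt_le, Rlt_le_trans. exact He. eapply Rle_trans. apply Rmin_r. apply Rmin_l. }
  assert (e3 : cC * e <= / 2).
  { apply Rmult_le_reg_l with (/ cC). now apply Rinv_0_lt_compat.
    rewrite <- Rmult_assoc, Rinv_l, Rmult_1_l by lra.
    replace (/ cC * / 2) with (/ (2 * cC)) by (field; lra).
    eapply Rlt_le, Rlt_le_trans. exact He. eapply Rle_trans. apply Rmin_r. apply Rmin_r. }
  assert (Hg : forall n, admissible e (picard_iterate e n)).
  { intros n. induction n as [ | n IH].
    - split; simpl.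
      + intros z. apply continuous_const.
      + intros; ring.
      + intros s l _ _. reflexivity.
      + intros s l _ _. rewrite Rabs_R0. apply Rmult_le_pos. lra. apply Rlt_le, wt_pos.
      + reflexivity.
    - simpl. now apply picard_admissible. }
  assert (Hstep : forall n, dominated (fun s l => picard_iterate e (S n) s l - picard_iterate e n s l) (e * (/ 2) ^ n) al ga).
  { intros n. induction n as [ | n IH].
    - intros s l Hs Hl. simpl pow. rewrite Rmult_1_r. simpl (picard_iterate e 0). rewrite Rminus_0_r.
      exact (admissible_dom e _ (Hg 1%nat) s l Hs Hl).
    - intros s l Hs Hl. assert (Hp : 0 <= e * (/ 2) ^ n) by (apply Rmult_le_pos; [lra | apply pow_le; lra]).
      eapply Rle_trans.
      + exact (picard_contraction e (e * (/ 2) ^ n) (picard_iterate e (S n)) (picard_iterate e n) e0 e1 (Hg _) (Hg _) Hp IH s l Hs Hl).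
      + apply Rmult_le_compat_r. apply Rlt_le, wt_pos. simpl pow.
        replace (e * (/ 2 * (/ 2) ^ n)) with (/ 2 * (e * (/ 2) ^ n)) by ring.
        now apply Rmult_le_compat_r. }
  set (H := fun t l => real (Lim_seq (fun n => picard_iterate e n t l))).
  assert (Hlim : forall n, dominated (fun s l => H s l - picard_iterate e n s l) (2 * e * (/ 2) ^ n) al ga).
  { intros n s l Hs Hl.
    replace (2 * e * (/ 2) ^ n * wt al ga s l) with (2 * (e * wt al ga s l) * (/ 2) ^ n) by ring.
    apply (geometric_limit (fun n => picard_iterate e n s l)). intros m.
    replace (e * wt al ga s l * (/ 2) ^ m) with (e * (/ 2) ^ m * wt al ga s l) by ring.
    now apply Hstep. }
  assert (Hpast : forall s l, s <= 0 -> H s l = H 0 l).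
  { intros s l Hs. unfold H. f_equal. apply Lim_seq_ext. intros n. now apply (admissible_past e). }
  assert (Hcone : in_cone H).
  { intros s l Hs Hl. unfold H. rewrite (Lim_seq_ext _ (fun _ => 0)).
    now rewrite Lim_seq_const. intros n. now apply (admissible_cone e _ (Hg n)). }
  assert (Hodd : forall s l, H s (- l) = - H s l).
  { intros s l. unfold H. rewrite (Lim_seq_ext _ (fun n => - picard_iterate e n s l)).
    rewrite Lim_seq_opp. now destruct (Lim_seq (fun n => picard_iterate e n s l)); simpl; try ring.
    intros n. apply (admissible_odd e). apply Hg. }
  assert (Hpos : forall n, 0 <= 2 * e * (/ 2) ^ n) by (intros; apply Rmult_le_pos; [lra | apply pow_le; lra]).
  (* Uniform on the whole plane: the weight is at most 1 in the cone, both terms vanish outside it,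
     and negative times reduce to [t = 0]. Continuity of [H] follows. *)
  assert (Hunif : forall n t l, Rabs (H t l - picard_iterate e n t l) <= 2 * e * (/ 2) ^ n).
  { assert (H0 : forall n t l, 0 <= t -> Rabs (H t l - picard_iterate e n t l) <= 2 * e * (/ 2) ^ n).
    { intros n t l Ht. destruct (Rle_dec (Rabs l) (t + 1)) as [Hl | Hl].
      - eapply Rle_trans. now apply Hlim. rewrite <- (Rmult_1_r (2 * e * _)) at 2.
        apply Rmult_le_compat_l. apply Hpos. apply wt_le_1; try assumption; unfold ga; lra.
      - rewrite Hcone, (admissible_cone e _ (Hg n)) by lra. rewrite Rminus_diag, Rabs_R0. apply Hpos. }
    intros n t l. destruct (Rle_dec 0 t). now apply H0.
    rewrite Hpast, (admissible_past e _ (Hg n)) by lra. apply H0. lra. }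
  assert (gH : admissible e H).
  { split; try assumption.
    - apply (cont2_uniform_limit (picard_iterate e) H (2 * e)). intros n; apply (admissible_cont e _ (Hg n)). exact Hunif.
    - intros s l Hs Hl.
      apply Rnot_lt_le. intros Hlt.
      destruct (geometric_small (2 * e * wt al ga s l)
        (mkposreal (Rabs (H s l) - e * wt al ga s l) ltac:(lra))) as [n Hn]. simpl in Hn.
      assert (A1 := Hlim n s l Hs Hl). assert (A2 := admissible_dom e _ (Hg n) s l Hs Hl).
      assert (A3 := Rabs_triang (H s l - picard_iterate e n s l) (picard_iterate e n s l)).
      replace (H s l - picard_iterate e n s l + picard_iterate e n s l) with (H s l) in A3 by ring. lra. }
  exists H. split. exact gH.
  intros t l Ht. replace (l * abspow p (sol_ut e H t l)) with (picard e H t l) by (unfold picard; now rewrite Rmax_left).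
  destruct (Rle_dec (Rabs l) (t + 1)) as [Hl | Hl].
  - apply (eq_of_geometric _ _ (2 * e * wt al ga t l)). intros n.
    assert (A1 := Hlim (S n) t l Ht Hl).
    assert (A2 := picard_contraction e _ H (picard_iterate e n) e0 e1 gH (Hg n) (Hpos n) (Hlim n) t l Ht Hl).
    assert (W0 := wt_pos al ga t l).
    assert (A3 : cC * e * (2 * e * (/ 2) ^ n) * wt al ga t l <= / 2 * (2 * e * (/ 2) ^ n) * wt al ga t l).
    { apply Rmult_le_compat_r. lra. apply Rmult_le_compat_r. apply Hpos. exact e3. }
    replace (H t l - picard e H t l) with ((H t l - picard_iterate e (S n) t l) - (picard e H t l - picard e (picard_iterate e n) t l))
      by (simpl; ring).
    eapply Rle_trans. apply Rabs_minus_le. simpl pow in A1. lra.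
  - rewrite Hcone by lra. symmetry. apply (admissible_cone e (picard e H)); [now apply picard_admissible | exact Ht | lra].
Qed.
End System.

(** * Kirchhoff formula for radial functions *)

Lemma avg_ext (Y1 Y2 : R -> R -> R) (t r : R) :
  (forall x, Y1 t x = Y2 t x) -> avg Y1 t r = avg Y2 t r.
Proof. intros H. unfold avg. f_equal. apply RInt_ext. intros; apply H. Qed.

(** Evenness removes the absolute value in [radial_sph_mean], and all three terms become averages
    over the same interval. [h] and [l * Phi] are compared only for [s >= 0], which is where the
    fixed point solves its equation. *)
Lemma kirchhoff_radial (f g : pt -> R) (F : R -> pt -> R) (phi phi' gam : R -> R)
    (Phi h : R -> R -> R) (t : R) (x : pt) :
  0 <= t ->
  (forall y, is_derive phi y (phi' y)) -> (forall y, continuous phi' y) ->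
  (forall y, continuous gam y) ->
  (forall y, phi (- y) = phi y) -> (forall y, gam (- y) = gam y) ->
  (forall y, f y = phi (nrm3 y)) -> (forall y, g y = gam (nrm3 y)) ->
  cont2 h ->
  (forall s y, continuous (Phi s) y) -> (forall s y, Phi s (- y) = Phi s y) ->
  (forall s y, F s y = Phi s (nrm3 y)) ->
  (forall s l, 0 <= s -> h s l = l * Phi s l) ->
  kirchhoff f g F t x =
  avg (fun t y => phi y + y * phi' y + y * gam y + charint h t y) t (nrm3 x).
Proof.
  intros Ht Hphi phi'c gamc ephi egam Hf Hg hc Phic ePhi HF Hh.
  assert (phic := continuous_of_is_derive phi phi' Hphi).
  set (rho := nrm3 x).
  assert (Habs : forall k : R -> R, (forall y, k (- y) = k y) -> forall y, k (Rabs y) = k y).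
  { intros k Hk y. unfold Rabs. destruct (Rcase_abs y); [apply Hk | reflexivity]. }
  assert (Hmean : forall (m : pt -> R) (k : R -> R) r, (forall y, continuous k y) ->
     (forall y, k (- y) = k y) -> (forall y, m y = k (nrm3 y)) ->
     r * sph_mean m x r = / 2 * RInt (fun s => (r + rho * s) * k (r + rho * s)) (-1) 1).
  { intros m k r Hk He Hm. rewrite (sph_mean_ext m (fun y => k (nrm3 y))) by exact Hm.
    rewrite radial_sph_mean by exact Hk. f_equal. apply RInt_ext. intros s _. fold rho.
    now rewrite (Habs k He). }
  unfold kirchhoff.
  assert (E1 : Derive (fun r => r * sph_mean f x r) t =
     / 2 * RInt (fun s => phi (t + rho * s) + (t + rho * s) * phi' (t + rho * s)) (-1) 1).
  { apply is_derive_unique.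
    apply (is_derive_ext (fun r => / 2 * RInt (fun s => (r + rho * s) * phi (r + rho * s)) (-1) 1)).
    { intros r. symmetry. now apply Hmean. }
    eapply is_derive_eq.
    - apply (is_derive_mult_R (fun _ => / 2)). apply is_derive_const.
      apply (is_derive_RInt_fixed (fun r s => (r + rho * s) * phi (r + rho * s))
        (fun r s => phi (r + rho * s) + (r + rho * s) * phi' (r + rho * s))).
      + intros r s. eapply is_derive_eq.
        * apply is_derive_mult_R. instantiate (1 := 1). auto_derive; [trivial | ring].
          apply (is_derive_comp_R phi (fun r => r + rho * s)). apply Hphi.
          instantiate (1 := 1). auto_derive; [trivial | ring].
        * cbv beta. ring.
      + intros z; cts.
      + intros z; cts.
    - unfold zero; simpl. ring. }
  assert (E3 : RInt (fun s => (t - s) * sph_mean (F s) x (t - s)) 0 t = avg (charint h) t rho).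
  { rewrite avg_charint by exact hc. apply RInt_ext. intros s Hs.
    rewrite Rmin_left, Rmax_right in Hs by lra.
    rewrite (Hmean (F s) (Phi s)); [ | apply Phic | apply ePhi | apply HF].
    f_equal. apply RInt_ext. intros sg _. symmetry. apply Hh. lra. }
  rewrite E1, (Hmean g gam) by assumption. rewrite E3.
  rewrite (avg_plus (fun t y => phi y + y * phi' y + y * gam y) (charint h)).
  - rewrite (avg_plus (fun t y => phi y + y * phi' y) (fun t y => y * gam y)).
    + reflexivity.
    + intros z; cts.
    + intros z; cts.
  - intros z; cts.
  - now apply cont2_charint.
Qed.

(** * Back to functions on [R^3] *)

Lemma continuous_nrm3 {T : UniformSpace} (f : T -> pt) (z : T) :
  continuous f z -> continuous (fun z => nrm3 (f z)) z.
Proof.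
  intros Hf. unfold nrm3, c1, c2, c3.
  apply (continuous_ext (fun z => sqrt (fst (fst (f z)) * fst (fst (f z)) +
     snd (fst (f z)) * snd (fst (f z)) + snd (f z) * snd (f z)))).
  { intros w. f_equal. ring. }
  cts; exact Hf.
Qed.

Lemma cont_half_radial (W : R -> R -> R) : cont2 W -> cont_half (fun t x => W t (nrm3 x)).
Proof.
  intros HW t x _.
  assert (C : continuous (fun z : R * pt => W (fst z) (nrm3 (snd z))) (t, x)).
  { apply (cts_app2 W (fun z : R * pt => fst z) (fun z => nrm3 (snd z))).
    exact HW. cts. apply (continuous_nrm3 (fun z : R * pt => snd z)). cts. }
  eapply filterlim_filter_le_1; [ | exact C].
  intros P [d Hd]. exists d. intros y Hy _. now apply Hd.
Qed.

Lemma is_dt_half_of_is_derive (w wt : R -> pt -> R) :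
  (forall t x, is_derive (fun t => w t x) t (wt t x)) -> is_dt_half w wt.
Proof.
  intros H t x _. apply filterlim_locally. intros eps.
  destruct (proj1 (is_derive_Reals _ _ _) (H t x) eps (cond_pos eps)) as [d Hd].
  exists d. intros h Hh [Hh0 _]. apply (Hd h Hh0).
  change (Rabs (h - 0) < d) in Hh. now rewrite Rminus_0_r in Hh.
Qed.

(** * Radial data as even functions on the third axis *)

Lemma nrm3_axis (y : R) : nrm3 (0, 0, y) = Rabs y.
Proof.
  unfold nrm3, c1, c2, c3; simpl. rewrite <- sqrt_Rsqr_abs. f_equal. unfold Rsqr. ring.
Qed.

Lemma radial_profile (f : pt -> R) (x : pt) : radial f -> f x = f (0, 0, nrm3 x).
Proof. intros H. apply H. rewrite nrm3_axis, Rabs_pos_eq. reflexivity. apply sqrt_pos. Qed.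

Lemma radial_profile_even (f : pt -> R) (y : R) : radial f -> f (0, 0, - y) = f (0, 0, y).
Proof. intros H. apply H. now rewrite 2 nrm3_axis, Rabs_Ropp. Qed.

Lemma supp_profile (f : pt -> R) (y : R) : supp_unit_ball f -> 1 < Rabs y -> f (0, 0, y) = 0.
Proof. intros H Hy. apply H. now rewrite nrm3_axis. Qed.

Lemma cont3_profile (f : pt -> R) : cont3 f -> forall y, continuous (fun y => f (0, 0, y)) y.
Proof.
  intros H y. apply (continuous_comp (fun y : R => (0, 0, y) : pt) f); [ | apply H].
  apply cts_pair. apply continuous_const. apply continuous_id.
Qed.

Lemma C1_profile (f : pt -> R) : C1_3 f ->
  forall y, is_derive (fun y => f (0, 0, y)) y (d3 f (0, 0, y)).
Proof.
  intros (_ & _ & _ & H & _) y. apply (Derive_correct (fun y => f (0, 0, y))).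
  exact (H (0, 0, y)).
Qed.

Lemma derive_outside (f f' : R -> R) :
  (forall y, is_derive f y (f' y)) -> (forall y, 1 < Rabs y -> f y = 0) ->
  forall y, 1 < Rabs y -> f' y = 0.
Proof.
  intros Hd Hf y Hy. rewrite <- (is_derive_unique f y (f' y) (Hd y)).
  apply is_derive_unique. apply (is_derive_ext_loc (fun _ => 0)); [ | apply @is_derive_const].
  exists (mkposreal (Rabs y - 1) ltac:(lra)). intros z Hz.
  change (Rabs (z - y) < Rabs y - 1) in Hz. symmetry. apply Hf.
  assert (H := Rabs_triang_inv y (y - z)). replace (y - (y - z)) with z in H by rring.
  rewrite (Rabs_minus_sym y z) in H. lra.
Qed.

Lemma bounded_of_support (f : R -> R) :
  (forall y, continuous f y) -> (forall y, 1 < Rabs y -> f y = 0) ->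
  exists D, 0 < D /\ forall y, Rabs (f y) <= D.
Proof.
  intros Hc Hs.
  destruct (continuity_ab_maj (fun y => Rabs (f y)) (-1) 1 ltac:(lra)) as [m [Hm _]].
  { intros c _. apply continuity_pt_filterlim.
    assert (C : continuous (fun y => Rabs (f y)) c) by cts. exact C. }
  exists (Rabs (f m) + 1). assert (H := Rabs_pos (f m)). split. lra.
  intros y. destruct (Rle_dec (Rabs y) 1) as [Hy | Hy].
  - apply Rabs_le_between in Hy. specialize (Hm y Hy). simpl in Hm. lra.
  - rewrite Hs, Rabs_R0; lra.
Qed.

(** The support hypothesis is silent at radius 1; continuity fills the gap. *)
Lemma profile_boundary (f : R -> R) :
  (forall y, continuous f y) -> (forall y, 1 < Rabs y -> f y = 0) -> f 1 = 0.
Proof.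
  intros Hc Hs. assert (H : Rabs (f (1 + 0)) <= 0).
  { apply (le_at_0_of_pos (fun r => Rabs (f (1 + r))) (fun _ => 0) 1).
    - cts.
    - cts.
    - lra.
    - intros r Hr. rewrite Hs. rewrite Rabs_R0; lra. rewrite Rabs_pos_eq; lra. }
  rewrite Rplus_0_r in H. assert (H1 := Rabs_pos (f 1)). apply Rabs_eq_0. lra.
Qed.

(** Provides the hypothesis [kvi]: [phi + l * phi'] is the derivative of [l * phi], which vanishes
    at both ends, and [l * gam] is odd. *)
Lemma RInt_profile (phi phi' gam : R -> R) (x y : R) :
  (forall y, is_derive phi y (phi' y)) -> (forall y, continuous phi' y) ->
  (forall y, continuous gam y) ->
  (forall y, phi (- y) = phi y) -> (forall y, gam (- y) = gam y) ->
  (forall y, 1 < Rabs y -> phi y = 0) -> (forall y, 1 < Rabs y -> gam y = 0) ->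
  x <= -1 -> 1 <= y -> RInt (fun l => phi l + l * phi' l + l * gam l) x y = 0.
Proof.
  intros Hphi phi'c gamc ephi egam sphi sgam Hx Hy.
  assert (phic := continuous_of_is_derive phi phi' Hphi).
  assert (E : RInt (fun l => phi l + l * phi' l + l * gam l) x y =
    RInt (fun l => phi l + l * phi' l) x y + RInt (fun l => l * gam l) x y).
  { apply (RInt_plus (fun l => phi l + l * phi' l) (fun l => l * gam l)); apply ex_RInt_cts; intros; cts. }
  assert (H1 := profile_boundary phi phic sphi).
  assert (Hend : forall l, 1 <= Rabs l -> phi l = 0).
  { intros l Hl. destruct (Req_dec (Rabs l) 1) as [El | El]; [ | apply sphi; lra].
    unfold Rabs in El. destruct (Rcase_abs l).
    - rewrite <- (Ropp_involutive l), ephi, El. exact H1.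
    - rewrite El. exact H1. }
  rewrite E, (RInt_antiderivative (fun l => l * phi l)).
  - rewrite (Hend x), (Hend y).
    rewrite (RInt_odd_supp (fun l => l * gam l) x y 1); try lra.
    + intros; cts.
    + intros l. rewrite egam. ring.
    + intros l Hl. rewrite sgam by exact Hl. ring.
    + rewrite Rabs_pos_eq; lra.
    + rewrite Rabs_left; lra.
  - intros l. eapply is_derive_eq. apply is_derive_mult_R.
    instantiate (1 := 1). auto_derive; [trivial | ring]. apply Hphi. cbv beta. ring.
  - intros; cts.
Qed.

Theorem theorem1p3 (p q : R)
  (hpq : p * (q - 1) > 2 + 1 / (p * q))
  (hq : 1 < q < 2) (hp : 2 < p < 3)
  (f g ft gt : pt -> R)
  (hf : C2_3 f) (hft : C2_3 ft) (hg : C1_3 g) (hgt : C1_3 gt)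
  (rf : radial f) (rg : radial g) (rft : radial ft) (rgt : radial gt)
  (sf : supp_unit_ball f) (sg : supp_unit_ball g)
  (sft : supp_unit_ball ft) (sgt : supp_unit_ball gt) :
  exists eps0 : R, 0 < eps0 /\
    forall eps : R, 0 < eps < eps0 ->
      exists (u v ut : R -> pt -> R),
        cont_half u /\ cont_half v /\ cont_half ut /\
        is_dt_half u ut /\
        (forall (t : R) (x : pt), 0 <= t ->
           u t x = kirchhoff (scal_fun eps f) (scal_fun eps g)
                     (fun s y => rpow (Rabs (v s y)) q) t x) /\
        (forall (t : R) (x : pt), 0 <= t ->
           v t x = kirchhoff (scal_fun eps ft) (scal_fun eps gt)
                     (fun s y => rpow (Rabs (ut s y)) p) t x).
Proof.
  (* [b] is the decay rate of [v] off the cone; [1 / (p q) < b <= p (q - 1) - 2] is where the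
     hypothesis on the exponents enters. *)
  set (b := Rmin (p * (q - 1) - 2) (/ (2 * q))).
  assert (hb : 0 < b /\ b <= p * (q - 1) - 2 /\ q * b < 1 /\ 1 < p * (q * b)).
  { assert (Hpq : 0 < p * q) by (apply Rmult_lt_0_compat; lra).
    assert (Ipq : 0 < 1 / (p * q)) by (apply Rdiv_lt_0_compat; lra).
    assert (Iq : 0 < / (2 * q)) by (apply Rinv_0_lt_compat; lra).
    assert (Eq : q * / (2 * q) = / 2) by (field; lra).
    assert (B1 : b <= p * (q - 1) - 2) by apply Rmin_l.
    assert (B2 : b <= / (2 * q)) by apply Rmin_r.
    assert (q * b <= / 2) by (rewrite <- Eq; apply Rmult_le_compat_l; lra).
    repeat split; try lra.
    - apply Rmin_glb_lt; lra.
    - unfold b, Rmin. destruct (Rle_dec (p * (q - 1) - 2) (/ (2 * q))).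
      + assert (H1 : p * q * (1 / (p * q)) < p * q * (p * (q - 1) - 2)) by (apply Rmult_lt_compat_l; lra).
        replace (p * q * (1 / (p * q))) with 1 in H1 by (field; lra). lra.
      + rewrite Eq. lra. }
  destruct hb as (hb0 & hbP & hqb & hpqb).
  set (phi := fun y => f (0, 0, y)). set (phi1 := fun y => d3 f (0, 0, y)).
  set (phi2 := fun y => d3 (d3 f) (0, 0, y)).
  set (gam := fun y => g (0, 0, y)). set (gam1 := fun y => d3 g (0, 0, y)).
  set (psi := fun y => ft (0, 0, y)). set (psi1 := fun y => d3 ft (0, 0, y)).
  set (del := fun y => gt (0, 0, y)).
  assert (phid : forall y, is_derive phi y (phi1 y)) by apply (C1_profile f (proj1 hf)).
  assert (phi1d : forall y, is_derive phi1 y (phi2 y)) by apply (C1_profile (d3 f) (proj2 (proj2 (proj2 hf)))).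
  assert (gamd : forall y, is_derive gam y (gam1 y)) by apply (C1_profile g hg).
  assert (psid : forall y, is_derive psi y (psi1 y)) by apply (C1_profile ft (proj1 hft)).
  assert (phi2c : forall y, continuous phi2 y).
  { apply cont3_profile. destruct hf as (_ & _ & _ & (_ & _ & _ & _ & _ & _ & H)). exact H. }
  assert (gam1c : forall y, continuous gam1 y).
  { apply cont3_profile. destruct hg as (_ & _ & _ & _ & _ & _ & H). exact H. }
  assert (psi1c : forall y, continuous psi1 y).
  { apply cont3_profile. destruct hft as ((_ & _ & _ & _ & _ & _ & H) & _). exact H. }
  assert (delc : forall y, continuous del y) by apply (cont3_profile gt (proj1 hgt)).
  assert (phic := continuous_of_is_derive phi phi1 phid).
  assert (phi1c := continuous_of_is_derive phi1 phi2 phi1d).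
  assert (gamc := continuous_of_is_derive gam gam1 gamd).
  assert (psic := continuous_of_is_derive psi psi1 psid).
  assert (sphi : forall y, 1 < Rabs y -> phi y = 0) by (intros; now apply supp_profile).
  assert (sgam : forall y, 1 < Rabs y -> gam y = 0) by (intros; now apply supp_profile).
  assert (spsi : forall y, 1 < Rabs y -> psi y = 0) by (intros; now apply supp_profile).
  assert (sdel : forall y, 1 < Rabs y -> del y = 0) by (intros; now apply supp_profile).
  assert (sphi1 := derive_outside phi phi1 phid sphi).
  assert (sphi2 := derive_outside phi1 phi2 phi1d sphi1).
  assert (sgam1 := derive_outside gam gam1 gamd sgam).
  assert (spsi1 := derive_outside psi psi1 psid spsi).
  assert (ephi : forall y, phi (- y) = phi y) by (intros; now apply radial_profile_even).
  assert (egam : forall y, gam (- y) = gam y) by (intros; now apply radial_profile_even).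
  assert (epsi : forall y, psi (- y) = psi y) by (intros; now apply radial_profile_even).
  assert (edel : forall y, del (- y) = del y) by (intros; now apply radial_profile_even).
  (* By [kirchhoff_radial] the data enter only through these combinations. [ku'] takes two
     derivatives of [f] and one of [g]. *)
  set (ku := fun l => phi l + l * phi1 l + l * gam l).
  set (ku' := fun l => phi1 l + (phi1 l + l * phi2 l) + (gam l + l * gam1 l)).
  set (kv := fun l => psi l + l * psi1 l + l * del l).
  assert (kuc : forall y, continuous ku y) by (intros; unfold ku; cts).
  assert (ku'c : forall y, continuous ku' y) by (intros; unfold ku'; cts).
  assert (kvc : forall y, continuous kv y) by (intros; unfold kv; cts).
  assert (kud : forall y, is_derive ku y (ku' y)).
  { assert (Hid : forall (k k' : R -> R) y, is_derive k y (k' y) ->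
        is_derive (fun l => l * k l) y (k y + y * k' y)).
    { intros k k' y Hk. eapply is_derive_eq. apply is_derive_mult_R.
      instantiate (1 := 1). auto_derive; [trivial | ring]. exact Hk. cbv beta. ring. }
    intros y. apply (is_derive_plus (fun l => phi l + l * phi1 l) (fun l => l * gam l)).
    - apply (is_derive_plus phi (fun l => l * phi1 l)). apply phid. now apply Hid.
    - now apply Hid. }
  assert (kus : forall y, 1 < Rabs y -> ku y = 0).
  { intros y Hy. unfold ku. rewrite sphi, sphi1, sgam by exact Hy. ring. }
  assert (ku's := derive_outside ku ku' kud kus).
  assert (kvs : forall y, 1 < Rabs y -> kv y = 0).
  { intros y Hy. unfold kv. rewrite spsi, spsi1, sdel by exact Hy. ring. }
  destruct (bounded_of_support ku kuc kus) as [D1 [D10 HD1]].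
  destruct (bounded_of_support ku' ku'c ku's) as [D2 [D20 HD2]].
  destruct (bounded_of_support kv kvc kvs) as [D3 [D30 HD3]].
  set (D := D1 + D2 + D3).
  assert (HD : D1 <= D /\ D2 <= D /\ D3 <= D /\ 0 < D) by (unfold D; lra).
  destruct HD as (HDa & HDb & HDc & HD0).
  destruct (exists_fixpoint p q b D kv ku ku' hq hp hb0 hbP hqb hpqb HD0 kvc
    (fun y => Rle_trans _ _ _ (HD3 y) HDc) kvs
    (fun x y Hx Hy => RInt_profile psi psi1 del x y psid psi1c delc epsi edel spsi sdel Hx Hy)
    kud ku'c (fun y => Rle_trans _ _ _ (HD1 y) HDa) (fun y => Rle_trans _ _ _ (HD2 y) HDb) kus)
    as [eps0 [Heps0 Hfix]].
  exists eps0. split. exact Heps0. intros eps Heps.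
  destruct (Hfix eps Heps) as [H [gH HH]]. clear Hfix.
  assert (Hc := admissible_cont p q b eps H gH).
  assert (Cv := cont2_sol_v kv kvc eps H Hc).
  assert (Cz := cont2_sol_ut q kv ku' hq kvc ku'c eps H Hc).
  assert (pwp := continuous_abspow p ltac:(lra)). assert (pwq := continuous_abspow q ltac:(lra)).
  exists (fun t x => avg (char_u q kv ku eps H) t (nrm3 x)), (fun t x => sol_v kv eps H t (nrm3 x)),
    (fun t x => sol_ut q kv ku' eps H t (nrm3 x)).
  split; [ | split; [ | split; [ | split; [ | split ]]]].
  - apply cont_half_radial. apply cont2_avg. now apply (cont2_char_u q kv ku ku').
  - now apply cont_half_radial.
  - now apply cont_half_radial.
  - apply is_dt_half_of_is_derive. intros t x. now apply is_derive_sol_u.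
  - intros t x Ht. symmetry.
    rewrite (kirchhoff_radial _ _ _ (fun y => eps * phi y) (fun y => eps * phi1 y) (fun y => eps * gam y)
      (fun s y => abspow q (sol_v kv eps H s y)) (src_u q kv eps H)); try assumption.
    + apply avg_ext. intros y. unfold char_u, ku. ring.
    + intros y. now apply (is_derive_scal phi).
    + intros; cts.
    + intros; cts.
    + intros y. now rewrite ephi.
    + intros y. now rewrite egam.
    + intros y. unfold scal_fun. now rewrite (radial_profile f y rf).
    + intros y. unfold scal_fun. now rewrite (radial_profile g y rg).
    + now apply cont2_src_u.
    + intros; cts.
    + intros s y. now rewrite sol_v_even.
    + reflexivity.
    + reflexivity.
  - intros t x Ht. symmetry.
    rewrite (kirchhoff_radial _ _ _ (fun y => eps * psi y) (fun y => eps * psi1 y) (fun y => eps * del y)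
      (fun s y => abspow p (sol_ut q kv ku' eps H s y)) H); try assumption.
    + apply avg_ext. intros y. unfold char_v, kv. ring.
    + intros y. now apply (is_derive_scal psi).
    + intros; cts.
    + intros; cts.
    + intros y. now rewrite epsi.
    + intros y. now rewrite edel.
    + intros y. unfold scal_fun. now rewrite (radial_profile ft y rft).
    + intros y. unfold scal_fun. now rewrite (radial_profile gt y rgt).
    + intros; cts.
    + intros s y. now rewrite sol_ut_even.
    + reflexivity.
Qed.
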